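(* Let $F:\mathcal K\to L^2(\Omega)$ be uniformly continuous, let $\bar X\in\mathcal K$, $\bar V\in L^2(\Omega)$, and let $X\in \mathrm{Lip}_{\rm loc}([0,\infty);\mathcal K)$ together with $Y(t):=\bar V+\int_0^tF[X(s)]\,ds$ satisfy $X(0)=\bar X$ and $$\dot X(t)+\partial I_{\mathcal K}(X(t))\ni Y(t)\quad\text{for a.e. }t>0 .$$ Then the following hold. (1) The right derivative $V(t):=\frac{d^+}{dt}X(t)$ exists in $L^2(\Omega)$ for all $t\ge 0$. (2) $V(t)=\big(Y(t)-\partial I_{\mathcal K}(X(t))\big)^\circ$ for all $t\ge0$, where $A^\circ$ denotes the unique element of minimal norm of a closed convex set $A\subset L^2(\Omega)$. In particular $V(t)+\partial I_{\mathcal K}(X(t))\ni Y(t)$ for all $t\ge 0$. (3) $V(t)=\mathsf P_{T_{X(t)}\mathcal K}(Y(t))$ for all $t\ge0$. (4) $V$ is right-continuous at all $t\ge0$ (with values in $L^2(\Omega)$); in particular $\lim_{t\downarrow0}V(t)=\bar V$ if and only if $\bar V\in T_{\bar X}\mathcal K$. If $\mathcal T^0\subset(0,\infty)$ is the set of all times at which $s\mapsto\|V(s)\|_{L^2(\Omega)}$ is continuous, then $(0,\infty)\setminus\mathcal T^0$ is Lebesgue negligible, and at every point of $\mathcal T^0$ the map $V$ is continuous and $X$ is differentiable in $L^2(\Omega)$. Setting $\varrho_t:=X(t)_\#\mathfrak m$, for every $t\in\mathcal T^0$ there exists a unique $v_t\in L^2(\mathbb R,\varrho_t)$ such that $$\dot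 X(t)=V(t)=\mathsf P_{\mathcal H_{X(t)}}(Y(t))=v_t\circ X(t)\in\mathcal H_{X(t)} .$$ (5) Suppose moreover that $f:\mathcal P_2(\mathbb R)\to\mathcal M(\mathbb R)$ satisfies $$\int_{\mathbb R}\psi(x)\,f[\varrho](dx)=\int_\Omega\psi(X_\varrho(m))\,F[X_\varrho](m)\,dm\quad\text{for all }\psi\in C_c^\infty(\mathbb R),\ \varrho\in\mathcal P_2(\mathbb R),$$ and that $\bar\varrho=\bar X_\#\mathfrak m$ and $\bar V=\bar v\circ\bar X$ with $\bar v\in L^2(\mathbb R,\bar\varrho)$. Then the couple $(\varrho,v)$, $\varrho(t,\cdot)=\varrho_t$, $v(t,\cdot)=v_t$, is a distributional solution in $(0,\infty)\times\mathbb R$ of $$\partial_t\varrho+\partial_x(\varrho v)=0,\qquad \partial_t(\varrho v)+\partial_x(\varrho v^2)=f[\varrho],$$ such that $\lim_{t\downarrow0}\varrho(t,\cdot)=\bar\varrho$ in $\mathcal P_2(\mathbb R)$ and $\lim_{t\downarrow0,\ t\in\mathcal T^0}\varrho(t,\cdot)v(t,\cdot)=\bar\varrho\,\bar v$ in $\mathcal M(\mathbb R)$.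
   Context: $\Omega=(0,1)$ and $\mathfrak m$ is Lebesgue measure on $\Omega$. $\mathcal K\subset L^2(\Omega)$ is the closed convex cone of nondecreasing functions (right-continuous representatives). For $X\in\mathcal K$: $\Omega_X$ is the open set of $m\in\Omega$ such that $X$ is constant in a neighborhood of $m$; $\mathcal H_X:=\{U\in L^2(\Omega): U \text{ is (a.e.) constant in each interval }(\alpha,\beta)\subset\Omega_X\}$; $\partial I_{\mathcal K}(X)=\{W\in L^2(\Omega):\int_\Omega W(\tilde X-X)\,dm\le0\ \forall\tilde X\in\mathcal K\}$ is the normal cone (subdifferential of the indicator function of $\mathcal K$); $T_X\mathcal K$ is the closure in $L^2(\Omega)$ of $\{\theta(\tilde X-X):\tilde X\in\mathcal K,\theta\ge0\}$. $\mathsf P_C$ is the metric projection in $L^2(\Omega)$ onto the closed convex set $C$. $F:\mathcal K\to L^2(\Omega)$ is called uniformly continuous if there is $C\ge0$ with $\|F[X]\|_{L^2(\Omega)}\le C(1+\|X\|_{L^2(\Omega)})$ for all $X\in\mathcal K$, and a modulus of continuity $\omega$ (a concave continuous function $\omega:[0,\infty)\to[0,\infty)$ with $0=\omega(0)<\omega(r)$ for $r>0$) with $\|F[X_1]-F[X_2]\|_{L^2(\Omega)}\le\omega(\|X_1-X_2\|_{L^2(\Omega)})$ for all $X_1,X_2\in\mathcal K$. $\mathcal P_2(\mathbb R)$ is the space of Borel probability measures with finite second moment, with the Wasserstein distance $W_2$; $\mathcal M(\mathbb R)$ is the space of finite signed Borel measures, with the weak topology induced by duality with bounded continuous functions. For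 $\varrho\in\mathcal P_2(\mathbb R)$, $X_\varrho\in\mathcal K$ is the unique element of $\mathcal K$ with $(X_\varrho)_\#\mathfrak m=\varrho$. *)

(* Defs.v *)
From HB Require Import structures.
From mathcomp Require Import all_boot all_order all_algebra.
From mathcomp Require Import all_classical all_reals all_analysis.

Set Implicit Arguments.
Unset Strict Implicit.
Unset Printing Implicit Defensive.
Import Order.TTheory GRing.Theory Num.Theory.
Import numFieldNormedType.Exports.

Local Open Scope classical_set_scope.
Local Open Scope ring_scope.

(* [LfunType mu p1] consists of functions, not of classes modulo a.e. equality,
   so the topology of the p-norm is not Hausdorff: limits are unique up to a.e.
   equality, and closed sets are stable under it. *)
Section Lfun_topology.
Context d (T : measurableType d) (R : realType).
Variables (mu : {measure set T -> \bar R}) (p : \bar R) (p1 : (1 <= p)%E).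

Definition Lp_norm (f : LfunType mu p1) : R := fine 'N[mu]_p[EFin \o f].

Definition Lp_ball (f : LfunType mu p1) (e : R) (g : LfunType mu p1) : Prop :=
  Lp_norm (f - g) < e.

Lemma Lp_norm0 : Lp_norm 0 = 0.
Proof. by rewrite /Lp_norm Lnorm0// gt_eqF// (lt_le_trans _ p1). Qed.

Lemma Lp_norm_subC (f g : LfunType mu p1) : Lp_norm (f - g) = Lp_norm (g - f).
Proof.
rewrite /Lp_norm -(LnormrN (f - g)); congr (fine 'N[mu]_p[EFin \o _]).
by apply/funext => x; rewrite /= opprB.
Qed.

Lemma Lp_ball_center f (e : R) : 0 < e -> Lp_ball f e f.
Proof. by rewrite /Lp_ball subrr Lp_norm0. Qed.

Lemma Lp_ball_sym f g (e : R) : Lp_ball f e g -> Lp_ball g e f.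
Proof. by rewrite /Lp_ball Lp_norm_subC. Qed.

Lemma Lp_ball_triangle f g h (e1 e2 : R) :
  Lp_ball f e1 g -> Lp_ball g e2 h -> Lp_ball f (e1 + e2) h.
Proof.
rewrite /Lp_ball => fg gh; rewrite -(subrKA g).
by rewrite (le_lt_trans (ler_LnormD (f - g) (g - h)))// ltrD.
Qed.

HB.instance Definition _ :=
  hasNbhs.Build (LfunType mu p1) (nbhs_ (entourage_ Lp_ball)).

HB.instance Definition _ := Nbhs_isPseudoMetric.Build R (LfunType mu p1)
  erefl Lp_ball_center Lp_ball_sym Lp_ball_triangle erefl.

End Lfun_topology.

Definition unit_measure (R : realType) : set (measurableTypeR R) -> \bar R :=
  mrestr lebesgue_measure (measurable_itv `]0, 1[).

HB.instance Definition _ (R : realType) := Measure.on (@unit_measure R).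

Lemma unit_measure_setT (R : realType) : @unit_measure R setT = 1%E.
Proof.
by rewrite /unit_measure /mrestr setTI lebesgue_measure_itv/= lte_fin ltr01 sube0.
Qed.

HB.instance Definition _ (R : realType) :=
  Measure_isProbability.Build _ _ _ (@unit_measure R) (@unit_measure_setT R).

Notation leb01 R := (@unit_measure R : probability (measurableTypeR R) R).
Notation L2 R := (LfunType (leb01 R) (lee1n 2)).

Local Notation lebesgue R := (@lebesgue_measure R).

Section L2_unit_interval.
Context {R : realType}.
Implicit Types (U V W : L2 R) (C : set (L2 R)).

Definition L2_inner U W : R := \int[leb01 R]_m (U m * W m).

Definition is_min_norm_element C U : Prop :=
  C U /\ forall W, C W -> Lp_norm U <= Lp_norm W.

Definition is_projection C V U : Prop :=
  C U /\ forall W, C W -> Lp_norm (V - U) <= Lp_norm (V - W).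

(* Elements of the cone are the right-continuous representatives themselves;
   their values outside `]0, 1[ are irrelevant. *)
Definition monotone_cone : set (L2 R) := [set X |
  {in `]0, 1[ &, {homo (X : R -> R) : m m' / m <= m'}} /\
  forall m : R, m \in `]0, 1[ -> X m' @[m' --> m^'+] --> X m].

Definition constancy_set (X : L2 R) : set R :=
  [set m : R | 0 < m < 1 /\ \forall m' \near m, X m' = X m].

Definition const_on_constancy (X : L2 R) : set (L2 R) := [set U |
  forall a b : R, `]a, b[ `<=` constancy_set X ->
    exists c : R, \forall m \ae leb01 R, `]a, b[%classic m -> U m = c].

Definition normal_cone (X : L2 R) : set (L2 R) := [set W |
  forall X', monotone_cone X' -> L2_inner W (X' - X) <= 0].

Definition tangent_cone (X : L2 R) : set (L2 R) :=
  closure [set theta *: (X' - X) | theta in [set x | (0 : R) <= x] &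
                                   X' in monotone_cone].

Definition modulus_of_continuity (omega : R -> R) : Prop :=
  [/\ forall r s t : R, 0 <= r -> 0 <= s -> 0 <= t <= 1 ->
        t * omega r + (1 - t) * omega s <= omega (t * r + (1 - t) * s),
      {within `[0, +oo[, continuous omega},
      omega 0 = 0 &
      forall r, 0 < r -> 0 < omega r].

(* Only the values of [F] on [monotone_cone] are constrained. *)
Definition uniformly_continuous_force (F : L2 R -> L2 R) : Prop :=
  (exists2 C : R, 0 <= C & forall X, monotone_cone X ->
     Lp_norm (F X) <= C * (1 + Lp_norm X)) /\
  (exists2 omega : R -> R, modulus_of_continuity omega &
     forall X1 X2, monotone_cone X1 -> monotone_cone X2 ->
       Lp_norm (F X1 - F X2) <= omega (Lp_norm (X1 - X2))).

Definition locally_lipschitz_curve (X : R -> L2 R) : Prop :=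
  forall T : R, 0 < T -> exists L : R, forall s t : R,
    s \in `[0, T] -> t \in `[0, T] -> Lp_norm (X t - X s) <= L * `|t - s|.

Definition has_deriv (X : R -> L2 R) (t : R) V : Prop :=
  (h^-1 *: (X (t + h) - X t)) @[h --> 0^'] --> V.

Definition has_right_deriv (X : R -> L2 R) (t : R) V : Prop :=
  (h^-1 *: (X (t + h) - X t)) @[h --> 0^'+] --> V.

(* Bochner integral over a bounded interval, through simple functions
   [\sum_(i < k n) \1_(A n i) *: c n i]. *)
Definition is_bochner_integral (a b : R) (g : R -> L2 R) (I : L2 R) : Prop :=
  exists (k : nat -> nat) (A : nat -> nat -> set (measurableTypeR R))
         (c : nat -> nat -> L2 R),
    let simple n (s : R) : L2 R := \sum_(i < k n) \1_(A n i) s *: c n i in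
    [/\ forall n i, measurable (A n i),
        \forall s \ae lebesgue R, `[a, b]%classic s ->
          simple n s @[n --> \oo] --> g s,
        (\int[lebesgue R]_(s in `[a, b]) (Lp_norm (g s - simple n s))%:E)%E
          @[n --> \oo] --> 0%E &
        (\sum_(i < k n) fine (lebesgue R (A n i `&` `[a, b])) *: c n i)
          @[n --> \oo] --> I].

End L2_unit_interval.

Section measures_on_the_line.
Context {R : realType}.

Definition law (X : L2 R) : probability R R := distribution (leb01 R) X.

Definition is_velocity (X V : L2 R) (w : R -> R) : Prop :=
  w \in Lfun (law X) 2%:E /\ V = w \o X %[ae leb01 R].

Definition finite_second_moment (rho : probability R R) : Prop :=
  (\int[rho]_x (x ^+ 2)%:E < +oo)%E.

Definition is_coupling (mu nu : probability R R)
    (gamma : probability (R * R)%type R) : Prop :=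
  forall A : set R, measurable A ->
    gamma (A `*` setT) = mu A /\ gamma (setT `*` A) = nu A.

Definition wasserstein2 (mu nu : probability R R) : \bar R :=
  (ereal_inf [set \int[gamma]_z ((z.1 - z.2) ^+ 2)%:E |
              gamma in is_coupling mu nu] `^ 2^-1)%E.

(* The Jordan decomposition does not depend on the chosen Hahn decomposition. *)
Definition charge_integral (nu : {charge set R -> \bar R}) (g : R -> R) : R :=
  let: exist P exN := cid (Hahn_decomposition nu) in
  let: exist N nuPN := cid exN in
  \int[jordan_pos nuPN]_x g x - \int[jordan_neg nuPN]_x g x.

End measures_on_the_line.

Section test_functions.
Context {R : realType} {V W : normedModType R}.

Definition smooth (phi : V -> W) : Prop :=
  forall vs : seq V, let psi := foldr (fun v g => 'D_v g) phi vs in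
    continuous psi /\ forall x v, derivable psi x v.

Definition test_function (U : set V) (phi : V -> W) : Prop :=
  let supp := closure [set x | phi x != 0] in
  [/\ smooth phi, compact supp & supp `<=` U].

End test_functions.

(* [Z] is the element [X_rho] of the cone with law [rho], which is unique on
   `]0, 1[. *)
Definition force_compatible (R : realType) (F : L2 R -> L2 R)
    (f : probability R R -> {charge set R -> \bar R}) : Prop :=
  forall (psi : R -> R), @test_function R R R setT psi ->
  forall rho : probability R R, finite_second_moment rho ->
  forall Z : L2 R, monotone_cone Z ->
    (forall A : set R, measurable A -> law Z A = rho A) ->
    charge_integral (f rho) psi = \int[leb01 R]_m (psi (Z m) * F Z m).

Section pressureless_euler.
Context {R : realType}.
Variables (rho : R -> probability R R) (v : R -> R -> R).

Definition space_time_test (phi : R * R -> R) : Prop :=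
  @test_function R (R * R)%type R (`]0, +oo[ `*` setT) phi.

Definition locally_finite_energy : Prop :=
  (\forall t \ae lebesgue R, 0 < t -> v t \in Lfun (rho t) 2%:E) /\
  forall a b : R, 0 < a -> a < b -> (lebesgue R).-integrable `[a, b]
    (fun t => (\int[rho t]_x (v t x ^+ 2)%:E)%E).

Definition continuity_equation : Prop :=
  forall phi, space_time_test phi ->
    let pairing (t : R) :=
      \int[rho t]_x ('D_(1, 0) phi (t, x) + v t x * 'D_(0, 1) phi (t, x)) in
    (lebesgue R).-integrable `]0, +oo[ (EFin \o pairing) /\
    \int[lebesgue R]_(t in `]0, +oo[) pairing t = 0.

Definition momentum_equation (force : R -> {charge set R -> \bar R}) : Prop :=
  forall phi, space_time_test phi ->
    let pairing (t : R) :=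
      \int[rho t]_x (v t x * 'D_(1, 0) phi (t, x)
                     + v t x ^+ 2 * 'D_(0, 1) phi (t, x)) in
    let source (t : R) := charge_integral (force t) (fun x => phi (t, x)) in
    [/\ (lebesgue R).-integrable `]0, +oo[ (EFin \o pairing),
        (lebesgue R).-integrable `]0, +oo[ (EFin \o source) &
        - (\int[lebesgue R]_(t in `]0, +oo[) pairing t) =
        \int[lebesgue R]_(t in `]0, +oo[) source t].

Definition distributional_solution (force : R -> {charge set R -> \bar R}) :=
  [/\ locally_finite_energy, continuity_equation & momentum_equation force].

End pressureless_euler.

(* Main.v *)
Require Import Defs.
From HB Require Import structures.
From mathcomp Require Import all_boot all_order all_algebra.
From mathcomp Require Import all_classical all_reals all_analysis.
From mathcomp Require Import measurable_realfun zify ring lra.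

(** The inclusion says that the velocity of [X] is the driving term [Y], corrected
    by an element of the normal cone of the monotone functions at [X t]; it is
    the gradient flow of the indicator of a closed convex cone in a Hilbert
    space, so its solutions regularize: the velocity is the element of minimal
    norm of [Y t - normal_cone (X t)].

    Existence of the right derivative. Integrating the inclusion over
    [[t, t + h]] shows that the difference quotient belongs to [Y t] minus a set
    slightly larger than the normal cone at [X t] ([difference_quotient_relaxed]),
    while comparing [X] with the stationary curve [X t] bounds its norm by the
    minimal norm, up to a term of order [h] ([difference_quotient_le]). The
    parallelogram identity turns almost minimizers over such relaxed cones into a
    Cauchy family ([minimal_selection]), so the quotients converge strongly to
    the minimal element. The inclusion holds for almost every time only, and the
    inequalities are integrated by a growth lemma for Lipschitz functions whose
    right Dini derivatives are bounded off a null set ([dini_growth_ae]).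

    Continuity. Monotonicity of the normal cones implies that two time translates
    of [X] separate at most as fast as [Y] varies, so that the speed minus a
    linear term is nonincreasing ([velocity_norm_growth]). It follows that the
    speed has countably many discontinuities; and as [Y t - V s] lies in a
    relaxed normal cone at [X t] for [s] close to [t], an upper bound on the speed
    [V s] already forces [V s] to be close to [V t] ([velocity_close]). Hence [V]
    is continuous from the right, and continuous where the speed is.

    Projections. The residual [Y t - V t] is normal, thus polar to the tangent
    cone, and minimality makes it orthogonal to [V t]: this is Moreau's
    decomposition ([projection_tangent_cone]). It is also orthogonal to all the
    functions of [X t] in L2, because [X t + e psi(X t)] and [X t - e psi(X t)] are
    monotone for Lipschitz [psi] and small [e] ([normal_cone_orthogonal_comp]).
    The functions that are constant on the intervals where [X t] is constant are,
    up to null sets, such compositions ([const_on_constancy_factor]), and a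
    two-sided derivative is one of them ([deriv_const_on_constancy]), which gives the
    projection on that subspace and the velocity field.

    Equations. For a test function [phi], the curve [A t = phi(t, X t)] has the
    right derivative [B t = d_t phi (t, X t) + V t * d_x phi (t, X t)]
    ([test_curve_right_deriv]). The integrals over time of the derivatives of
    [<1, A>] and of [<Y, A>] vanish; the first is the continuity equation, and
    the second is the momentum equation because [<Y, B> = <V, B>], [B t] being a
    function of [X t] ([velocity_pairing]). The initial values are attained since
    [X] and [V] are continuous from the right at 0, and [V 0] is the given initial
    velocity when that is a function of the initial position
    ([initial_velocity]). *)

Set Implicit Arguments.
Unset Strict Implicit.
Unset Printing Implicit Defensive.
Import Order.TTheory GRing.Theory Num.Theory.
Import numFieldNormedType.Exports.

Local Open Scope classical_set_scope.
Local Open Scope ring_scope.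

(* Norms and inner products are unknowns of linear arithmetic; left in place,
   they would be unfolded to integrals when hypotheses are compared. *)
Ltac generalize_norms := repeat match goal with
  | |- context [@Lp_norm ?d ?T ?R ?mu ?p ?p1 ?U] =>
      move: (@Lp_norm d T R mu p p1 U) => ?
  | |- context [@L2_inner ?R ?U ?W] => move: (@L2_inner R U W) => ?
  end.

Ltac real_lra := repeat match goal with
  | H : is_true (Order.le _ _) |- _ => revert H
  | H : is_true (Order.lt _ _) |- _ => revert H
  end; generalize_norms; repeat match goal with x := _ |- _ => clearbody x end;
  clear; lra.

(** * The space L2 of the unit interval *)

(** Integrals of nonnegative functions are suprema over the simple functions
    below them, so they are monotone even without measurability. *)
Lemma ge0_integral_le_nomeas d (T : measurableType d) (R : realType)
    (mu : {measure set T -> \bar R}) (D : set T) (f h : T -> \bar R) :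
  (forall x, D x -> 0 <= f x)%E -> (forall x, D x -> f x <= h x)%E ->
  (\int[mu]_(x in D) f x <= \int[mu]_(x in D) h x)%E.
Proof.
move=> f0 fh; rewrite !ge0_integralE//; last first.
  by move=> x Dx; exact: le_trans (f0 x Dx) (fh x Dx).
apply: le_ereal_sup => _ [k kf <-]; exists k => // x.
apply: le_trans (kf x) _; rewrite /patch; case: ifPn => //.
by rewrite inE => /fh.
Qed.

Section L2_pointwise.
Context {R : realType}.
Implicit Types (U V : L2 R).

Lemma L2_addE U V m : (U + V) m = U m + V m. Proof. by []. Qed.
Lemma L2_oppE U m : (- U) m = - U m. Proof. by []. Qed.
Lemma L2_scaleE (a : R) U m : (a *: U) m = a * U m. Proof. by []. Qed.
Definition L2E := (L2_addE, L2_oppE, L2_scaleE).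

End L2_pointwise.

Section L2_hilbert.
Context {R : realType}.
Implicit Types (U V W : L2 R) (a b : R).

Lemma Lfun2P d (T : measurableType d) (mu : {measure set T -> \bar R})
    (f : T -> R) : measurable_fun setT f ->
  mu.-integrable setT (EFin \o (fun x => f x ^+ 2)) -> f \in Lfun mu 2%:E.
Proof.
move=> mf /integrableP[_ fi]; rewrite inE; apply/andP; split; rewrite inE//=.
rewrite /finite_norm unlock poweR_lty//.
apply: le_lt_trans fi; apply: ge0_le_integral => //=.
- apply/measurable_EFinP.
  apply: (@measurableT_comp _ _ _ _ _ _ (fun x : R => x `^ 2)%R) => //.
  exact/measurableT_comp.
- by apply/measurable_EFinP; apply: measurableT_comp => //; exact: measurable_funX.
- by move=> x _; rewrite lee_fin powR_mulrn// normrX.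
Qed.

Lemma L2_integrableM U V :
  (leb01 R).-integrable setT (EFin \o (fun m => U m * V m)).
Proof. by apply/Lfun1_integrable/Lfun2_mul_Lfun1; exact: LfunP. Qed.

Lemma L2_innerC U V : L2_inner U V = L2_inner V U.
Proof. by apply: eq_Rintegral => m _; rewrite mulrC. Qed.

Lemma L2_innerDl U V W : L2_inner (U + V) W = L2_inner U W + L2_inner V W.
Proof.
rewrite /L2_inner -RintegralD//; try exact: L2_integrableM.
by apply: eq_Rintegral => m _; rewrite -mulrDl.
Qed.

Lemma L2_innerZl a U W : L2_inner (a *: U) W = a * L2_inner U W.
Proof.
rewrite /L2_inner -RintegralZl//; last exact: L2_integrableM.
by apply: eq_Rintegral => m _; rewrite mulrA.
Qed.

Lemma L2_innerNl U W : L2_inner (- U) W = - L2_inner U W.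
Proof. by rewrite -scaleN1r L2_innerZl mulN1r. Qed.

Lemma L2_innerBl U V W : L2_inner (U - V) W = L2_inner U W - L2_inner V W.
Proof. by rewrite L2_innerDl L2_innerNl. Qed.

Lemma L2_inner0l W : L2_inner 0 W = 0.
Proof. by rewrite -(scale0r (0 : L2 R)) L2_innerZl mul0r. Qed.

Lemma L2_innerDr U V W : L2_inner W (U + V) = L2_inner W U + L2_inner W V.
Proof. by rewrite !(L2_innerC W) L2_innerDl. Qed.

Lemma L2_innerZr a U W : L2_inner W (a *: U) = a * L2_inner W U.
Proof. by rewrite !(L2_innerC W) L2_innerZl. Qed.

Lemma L2_innerNr U W : L2_inner W (- U) = - L2_inner W U.
Proof. by rewrite !(L2_innerC W) L2_innerNl. Qed.

Lemma L2_innerBr U V W : L2_inner W (U - V) = L2_inner W U - L2_inner W V.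
Proof. by rewrite !(L2_innerC W) L2_innerBl. Qed.

Lemma L2_inner0r W : L2_inner W 0 = 0.
Proof. by rewrite L2_innerC L2_inner0l. Qed.

Lemma L2_norm_ge0 U : 0 <= Lp_norm U.
Proof. by rewrite fine_ge0// Lnorm_ge0. Qed.

Lemma L2_norm_sq U : Lp_norm U ^+ 2 = L2_inner U U.
Proof.
rewrite /Lp_norm -powR_mulrn ?fine_ge0 ?Lnorm_ge0// -fine_poweR.
rewrite powR_Lnorm//; congr fine; apply: eq_integral => m _ /=.
by rewrite powR_mulrn// -normrX ger0_norm ?sqr_ge0// expr2.
Qed.

Lemma L2_norm_triangle U V : Lp_norm (U + V) <= Lp_norm U + Lp_norm V.
Proof. exact: ler_LnormD. Qed.

Lemma L2_normZ a U : Lp_norm (a *: U) = `|a| * Lp_norm U.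
Proof.
apply/eqP; rewrite -(@eqrXn2 _ 2)//; first last.
- by rewrite mulr_ge0// L2_norm_ge0.
- exact: L2_norm_ge0.
by rewrite exprMn !L2_norm_sq L2_innerZl L2_innerZr real_normK ?num_real//; apply/eqP; ring.
Qed.

Lemma L2_normN U : Lp_norm (- U) = Lp_norm U.
Proof. by rewrite -scaleN1r L2_normZ normrN1 mul1r. Qed.

Lemma L2_norm_sq_sub U V :
  Lp_norm (U - V) ^+ 2 = Lp_norm U ^+ 2 - 2 * L2_inner U V + Lp_norm V ^+ 2.
Proof.
by rewrite !L2_norm_sq !(L2_innerBl, L2_innerBr) (L2_innerC V U); ring.
Qed.

Lemma L2_norm_sq_add U V :
  Lp_norm (U + V) ^+ 2 = Lp_norm U ^+ 2 + 2 * L2_inner U V + Lp_norm V ^+ 2.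
Proof.
by rewrite !L2_norm_sq !(L2_innerDl, L2_innerDr) (L2_innerC V U); ring.
Qed.

Lemma L2_cauchy_schwarz U V : L2_inner U V <= Lp_norm U * Lp_norm V.
Proof.
have : Lp_norm (U + V) ^+ 2 <= (Lp_norm U + Lp_norm V) ^+ 2.
  by rewrite lerXn2r ?nnegrE ?addr_ge0 ?L2_norm_ge0// L2_norm_triangle.
by rewrite L2_norm_sq_add sqrrD; lra.
Qed.

Lemma L2_cauchy_schwarz_abs U V : `|L2_inner U V| <= Lp_norm U * Lp_norm V.
Proof.
rewrite ler_norml L2_cauchy_schwarz andbT lerNl -L2_innerNl.
by rewrite (le_trans (L2_cauchy_schwarz _ _))// L2_normN.
Qed.

Lemma L2_dist_triangle U V W :
  Lp_norm (U - W) <= Lp_norm (U - V) + Lp_norm (V - W).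
Proof. by rewrite -(subrKA V) L2_norm_triangle. Qed.

Lemma L2_dist_dist U V : `|Lp_norm U - Lp_norm V| <= Lp_norm (U - V).
Proof.
rewrite ler_norml lerBlDr; apply/andP; split.
  rewrite lerNl opprB lerBlDr Lp_norm_subC -{1}(subrK U V).
  exact: L2_norm_triangle.
by rewrite -{1}(subrK V U) L2_norm_triangle.
Qed.

Lemma L2_inner_ae U U' V : U = U' %[ae leb01 R] ->
  L2_inner U V = L2_inner U' V.
Proof.
move=> UU'; congr fine; apply: ae_eq_integral => //.
- exact: (measurable_int (leb01 R) (L2_integrableM _ _)).
- exact: (measurable_int (leb01 R) (L2_integrableM _ _)).
- by apply: filterS UU' => m /= + mT => -> //.
Qed.

Lemma L2_norm_eq0P U : Lp_norm U = 0 <-> U = 0 %[ae leb01 R].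
Proof.
split=> [|U0]; first exact: fine_Lnormr_eq0.
have : Lp_norm U ^+ 2 = 0.
  rewrite L2_norm_sq (@L2_inner_ae _ 0) ?L2_inner0l//.
by move/eqP; rewrite sqrf_eq0 => /eqP.
Qed.

Lemma L2_dist_eq0P U V : Lp_norm (U - V) = 0 <-> U = V %[ae leb01 R].
Proof.
rewrite L2_norm_eq0P; split; apply: filterS => m /= /(_ I) UV _.
  by apply/eqP; rewrite -subr_eq0; apply/eqP.
by apply/eqP; rewrite subr_eq0; apply/eqP.
Qed.

Lemma L2_norm_ae U V : U = V %[ae leb01 R] -> Lp_norm U = Lp_norm V.
Proof.
move=> /L2_dist_eq0P UV; apply/eqP; rewrite -subr_eq0 -normr_le0 -UV.
exact: L2_dist_dist.
Qed.

Lemma L2_cvgP {T : Type} (F : set_system T) {FF : Filter F} (f : T -> L2 R) U :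
  f @ F --> U <-> forall e : R, 0 < e -> \forall s \near F, Lp_norm (f s - U) < e.
Proof.
split=> [/cvg_ballP fU e /fU|fU]; last apply/cvg_ballP => e /fU.
  by apply: filterS => s; rewrite Lp_norm_subC.
by apply: filterS => s; rewrite Lp_norm_subC.
Qed.

End L2_hilbert.

Section L2_complete.
Context {R : realType}.
Implicit Types (U V W P : L2 R) (u : nat -> L2 R).

Lemma half_gt0 (e : R) : 0 < e -> 0 < e / 2.
Proof. by move=> e0; rewrite divr_gt0. Qed.

Lemma near_geometric (e : R) : 0 < e ->
  \forall n \near \oo, 2 * 2^-1 ^+ n < e.
Proof.
move=> e0; have : (2 * 2^-1 ^+ n : R) @[n --> \oo] --> (2 * 0 : R).
  by apply: cvgMr; apply: cvg_expr; rewrite ger0_norm// invf_lt1// ltr1n.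
rewrite mulr0 => /cvgr0Pnorm_lt/(_ e e0); apply: filterS => n.
by apply: le_lt_trans; exact: ler_norm.
Qed.

Lemma L2_norm_sqE U :
  (\int[leb01 R]_m (U m ^+ 2)%:E)%E = (Lp_norm U ^+ 2)%:E.
Proof.
rewrite L2_norm_sq /L2_inner /Rintegral fineK//.
exact: integrable_fin_num (L2_integrableM _ _).
Qed.

(** Fatou's lemma for the squares. *)
Lemma L2_fatou u (f : measurableTypeR R -> R) (C : R) :
  measurable_fun setT f -> (forall n, Lp_norm (u n) <= C) ->
  (\forall m \ae leb01 R, u n m @[n --> \oo] --> f m) ->
  exists2 U : L2 R, U =1 f & Lp_norm U <= C.
Proof.
move=> mf uC uf.
have C0 : 0 <= C by rewrite (le_trans _ (uC 0%N)) ?L2_norm_ge0.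
have mf2 : measurable_fun setT (EFin \o (fun m => f m ^+ 2)).
  by apply/measurable_EFinP; exact: measurable_funX.
have mu2 n : measurable_fun setT (EFin \o (fun m => u n m ^+ 2)).
  by apply/measurable_EFinP; exact: measurable_funX.
have fC : (\int[leb01 R]_m (f m ^+ 2)%:E <= (C ^+ 2)%:E)%E.
  rewrite (ae_eq_integral
    (fun m => limn_einf (fun n => (u n m ^+ 2)%:E))) //; last first.
  - apply: filterS uf => m um _; apply/esym.
    have : (u n m ^+ 2)%:E @[n --> \oo] --> (f m ^+ 2)%:E.
      by apply: cvg_EFin; [exact: nearW|exact: cvgM].
    by move=> /cvg_limn_einf_sup[].
  - have -> : (fun m => limn_einf (fun n => (u n m ^+ 2)%:E)) =
      (\- (fun m => limn_esup (fun n => - (u n m ^+ 2)%:E)))%E.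
      by [].
    apply/measurableT_comp => //; apply: measurable_fun_limn_esup => n.
    by apply: (measurableT_comp _ (mu2 n)).
  apply: (le_trans (fatou _ measurableT mu2 _)).
    by move=> n m _ /=; rewrite lee_fin sqr_ge0.
  rewrite limn_einf_lim; apply: lime_le; first exact: is_cvg_einfs.
  apply: nearW => n; apply: (@le_trans _ _ (\int[leb01 R]_m (u n m ^+ 2)%:E)%E).
    by apply: ereal_inf_lbound; exists n => /=.
  by rewrite L2_norm_sqE lee_fin lerXn2r ?nnegrE ?L2_norm_ge0.
have fL : f \in Lfun (leb01 R) 2%:E.
  apply: Lfun2P => //; apply/integrableP; split => //.
  apply: le_lt_trans (ltry (C ^+ 2)); apply: le_trans fC.
  rewrite le_eqVlt; apply/orP; left; apply/eqP/eq_integral => m _ /=.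
  by rewrite ger0_norm ?sqr_ge0.
exists (Lfun_Sub (lee1n 2) fL) => //.
rewrite -(@ler_pXn2r _ 2)// ?nnegrE ?L2_norm_ge0//.
by rewrite -lee_fin -L2_norm_sqE.
Qed.

Definition unit_L2 : L2 R := Lfun_Sub (lee1n 2) (Lfun_cst (leb01 R) 1 2).

Lemma unit_L2_norm : Lp_norm unit_L2 = 1.
Proof.
apply/eqP; rewrite -(@eqrXn2 _ 2)// ?L2_norm_ge0// -eqe -L2_norm_sqE.
rewrite (eq_integral (cst 1%E)) ?integral_cst//=; last first.
  by move=> m _; rewrite expr1n.
by rewrite expr1n mul1e; apply/eqP; exact: probability_setT.
Qed.

Lemma L2_inner_unit U : L2_inner unit_L2 U = \int[leb01 R]_m U m.
Proof. by apply: eq_Rintegral => m _; rewrite mul1r. Qed.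

Lemma L2_norm_le U V : (forall m, `|U m| <= `|V m|) -> Lp_norm U <= Lp_norm V.
Proof.
move=> UV; rewrite -(@ler_pXn2r _ 2)// ?nnegrE ?L2_norm_ge0//.
rewrite -lee_fin -!L2_norm_sqE; apply: ge0_integral_le_nomeas => m _.
  by rewrite lee_fin sqr_ge0.
rewrite lee_fin -[leLHS]real_normK ?num_real// -[leRHS]real_normK ?num_real//.
by rewrite ler_pXn2r ?nnegrE.
Qed.

Lemma L2_abs U : exists2 Z : L2 R, Z =1 (fun m => `|U m|) & Lp_norm Z = Lp_norm U.
Proof.
have nU : (fun m => `|U m| : R) \in Lfun (leb01 R) 2%:E.
  apply: Lfun2P; first exact: measurableT_comp.
  apply: eq_integrable (Lfun2_integrable_sqr (LfunP U)) => // m _ /=.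
  by rewrite -normrX ger0_norm ?sqr_ge0.
exists (Lfun_Sub (lee1n 2) nU) => //.
by apply/eqP; rewrite eq_le !L2_norm_le// => m /=; rewrite normr_id.
Qed.

Lemma L2_norm_le_add P U V : (forall m, `|P m| <= `|U m| + `|V m|) ->
  Lp_norm P <= Lp_norm U + Lp_norm V.
Proof.
move=> PUV; have [Z1 Z1E <-] := L2_abs U; have [Z2 Z2E <-] := L2_abs V.
apply: le_trans (L2_norm_triangle Z1 Z2); apply: L2_norm_le => m.
by rewrite L2E Z1E Z2E (ger0_norm (addr_ge0 _ _)).
Qed.

Lemma L2_integral_abs_le U :
  (\int[leb01 R]_m `|U m|%:E <= (Lp_norm U)%:E)%E.
Proof.
have [Z ZE Zn] := L2_abs U.
have := L2_cauchy_schwarz unit_L2 Z; rewrite unit_L2_norm mul1r Zn -lee_fin.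
rewrite L2_inner_unit /Rintegral fineK => [|]; last first.
  have := integrable_fin_num measurableT (L2_integrableM unit_L2 Z).
  by under eq_integral do rewrite /= mul1r.
by under eq_integral do rewrite /= ZE.
Qed.

(** The increments have summable norms, hence a summable integral: the
    telescoping series converges absolutely almost everywhere. *)
Lemma L2_fast_cvg_ae u : (forall n, Lp_norm (u n.+1 - u n) <= 2^-1 ^+ n) ->
  \forall m \ae leb01 R, cvgn (fun n => u n m).
Proof.
move=> fastu.
pose d n (m : measurableTypeR R) : \bar R := `|u n.+1 m - u n m|%:E.
have md n : measurable_fun setT (d n).
  apply/measurable_EFinP; apply: measurableT_comp => //.
  exact: measurable_funB.
have d0 n m : setT m -> (0 <= d n m)%E by rewrite lee_fin.
have sumd : (\int[leb01 R]_m (\sum_(0 <= n <oo) d n m) < +oo)%E.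
  rewrite integral_nneseries//.
  apply: (@le_lt_trans _ _ (\sum_(0 <= n <oo) (2^-1 ^+ n)%:E)%E).
    apply: lee_nneseries => n *; first by apply: integral_ge0 => m _; exact: d0.
    by apply: le_trans (L2_integral_abs_le (u n.+1 - u n)) _; rewrite lee_fin.
  rewrite (_ : (\sum_(0 <= n <oo) _)%E = 2%:E) ?ltry//.
  apply/cvg_lim => //.
  have : (EFin \o series (geometric 1 (2^-1 : R))) @ \oo --> 2%:E.
    apply: cvg_EFin; first exact: nearW.
    have : series (geometric 1 (2^-1 : R)) @ \oo --> (1 * (1 - 2^-1)^-1 : R).
      by apply: cvg_geometric_series; rewrite ger0_norm//; lra.
    by rewrite (_ : 1 * (1 - 2^-1)^-1 = 2 :> R)//; field.
  apply: cvg_trans; apply: near_eq_cvg; apply: nearW => n /=.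
  by rewrite /series/= -sumEFin; apply: eq_bigr => i _; rewrite mul1r.
have : (leb01 R).-integrable setT (fun m => (\sum_(0 <= n <oo) d n m)%E).
  have mS : measurable_fun setT (fun m => (\sum_(0 <= n <oo) d n m)%E).
    by apply: ge0_emeasurable_sum => // n m _ _; exact: d0.
  apply/integrableP; split; first exact: mS.
  apply: le_lt_trans sumd; apply: ge0_le_integral => //=.
  - exact: measurableT_comp.
  - by move=> m _; rewrite gee0_abs//; apply: nneseries_ge0 => n _ _; exact: d0.
move=> /(integrable_ae measurableT); apply: filterS => m /(_ I) sumdm.
have : cvgn (series (fun n => u n.+1 m - u n m)).
  apply: normed_cvg; apply/cvg_ex.
  exists (fine (\sum_(0 <= n <oo) d n m)%E).
  have := @is_cvg_nneseries R (d^~ m) xpredT 0 (fun n _ _ => d0 n m I).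
  move=> /cvg_ex[l dl]; rewrite (cvg_lim _ dl)// in sumdm *.
  have := dl; rewrite -(fineK sumdm) => /fine_cvg.
  apply: cvg_trans; apply: near_eq_cvg; apply: nearW => n /=.
  by rewrite /series/= /d sumEFin.
move=> /cvg_ex[l ul]; apply/cvg_ex; exists (l + u 0%N m).
apply: cvg_trans (cvgD ul (cvg_cst (u 0%N m))).
apply: near_eq_cvg; apply: nearW => n /=.
by rewrite fctE /series/= (telescope_sumr (fun k => u k m))// subrK.
Qed.

Lemma L2_fast_dist u : (forall n, Lp_norm (u n.+1 - u n) <= 2^-1 ^+ n) ->
  forall k n, (k <= n)%N -> Lp_norm (u n - u k) <= 2 * 2^-1 ^+ k.
Proof.
move=> fastu k n kn.
suff : Lp_norm (u n - u k) <= 2 * (2^-1 ^+ k - 2^-1 ^+ n).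
  move=> /le_trans; apply; rewrite ler_pM2l// gerBl exprn_ge0//.
elim: n kn => [|n IH].
  rewrite leqn0 => /eqP ->; rewrite !subrr Lp_norm0 mulr0//.
rewrite leq_eqVlt ltnS => /orP[/eqP ->|kn].
  by rewrite !subrr Lp_norm0 mulr0.
apply: le_trans (L2_dist_triangle _ (u n) _) _.
apply: le_trans (lerD (fastu n) (IH kn)) _.
by rewrite exprS; lra.
Qed.

(** The limit exists almost everywhere, and Fatou's lemma transfers to it the
    bounds on the distances between the terms of the sequence. *)
Lemma L2_fast_limit u : (forall n, Lp_norm (u n.+1 - u n) <= 2^-1 ^+ n) ->
  exists2 U : L2 R, forall k, Lp_norm (U - u k) <= 2 * 2^-1 ^+ k &
    \forall m \ae leb01 R, u n m @[n --> \oo] --> U m.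
Proof.
move=> fastu; have [N [mN N0 sN]] := L2_fast_cvg_ae fastu.
pose v n := (u n : R -> R) \_ (~` N).
pose f m := limn (v ^~ m).
have vE n m : ~ N m -> v n m = u n m by move=> Nm; rewrite /v patchT ?inE.
have v0 n m : N m -> v n m = 0 by move=> Nm; rewrite /v patchC ?inE//= setCK inE.
have vf m : v n m @[n --> \oo] --> f m.
  rewrite /f; apply/cvg_ex.
  have [Nm|Nm] := pselect (N m).
    exists 0; rewrite (_ : v ^~ m = cst 0); first exact: cvg_cst.
    by apply/funext => n; rewrite v0.
  rewrite (_ : v ^~ m = (fun n => u n m)); last by apply/funext => n; rewrite vE.
  by apply/cvg_ex; apply: contrapT => /sN; exact: Nm.
have mf : measurable_fun setT (f : measurableTypeR R -> R).
  apply: (measurable_fun_cvg (h := v)) => // n.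
  apply/(measurable_restrict _ (measurableC mN) measurableT).
  by rewrite setTI; exact: measurable_funTS.
have uf : \forall m \ae leb01 R, u n m @[n --> \oo] --> f m.
  exists N; split=> // m /= ufm; apply: contrapT => Nm; apply: ufm.
  have := vf m; rewrite (_ : v ^~ m = (fun n => u n m))//.
  by apply/funext => n; rewrite vE.
have Uk k : exists2 U : L2 R, U =1 (fun m => f m - u k m) &
    Lp_norm U <= 2 * 2^-1 ^+ k.
  apply: (@L2_fatou (fun n => u (n + k)%N - u k)).
  - exact: measurable_funB.
  - by move=> n; apply: (L2_fast_dist fastu); exact: leq_addl.
  - apply: filterS uf => m um; apply: cvgB; last exact: cvg_cst.
    by rewrite (cvg_shiftn k (fun n => u n m)).
have [U0 U0E _] := Uk 0%N.
exists (U0 + u 0%N).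
  move=> k; have [U1 U1E U1k] := Uk k; rewrite (_ : _ - _ = U1)//.
  apply/LfuneqP => m; rewrite U1E.
  by rewrite [LHS](_ : _ = U0 m + u 0%N m - u k m)// U0E subrK.
apply: filterS uf => m; rewrite (_ : (U0 + u 0%N) m = U0 m + u 0%N m)//.
by rewrite U0E subrK.
Qed.

Lemma L2_cauchy_fast u :
  (forall e : R, 0 < e -> exists N, forall n p, (N <= n)%N -> (N <= p)%N ->
     Lp_norm (u n - u p) < e) ->
  exists2 phi : nat -> nat, forall n, (n <= phi n)%N &
    forall n, Lp_norm (u (phi n.+1) - u (phi n)) <= 2^-1 ^+ n.
Proof.
move=> cu.
have /choice[N NP] : forall k, exists N, forall n p, (N <= n)%N -> (N <= p)%N ->
    Lp_norm (u n - u p) < 2^-1 ^+ k.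
  by move=> k; apply: cu; rewrite exprn_gt0.
pose phi n := (\sum_(i < n.+1) N i + n)%N.
exists phi => n; first exact: leq_addl.
have Nphi i : (N n <= phi n)%N.
  by rewrite /phi big_ord_recr/=; lia.
apply/ltW/NP; rewrite /phi !big_ord_recr/=; lia.
Qed.

Lemma L2_complete u :
  (forall e : R, 0 < e -> exists N, forall n p, (N <= n)%N -> (N <= p)%N ->
     Lp_norm (u n - u p) < e) ->
  exists U : L2 R, u n @[n --> \oo] --> U.
Proof.
move=> cu; have [phi phin fast] := L2_cauchy_fast cu.
have [U Uu _] := L2_fast_limit fast.
exists U; apply/L2_cvgP => e e0.
have [N NP] := cu (e / 2) (half_gt0 e0).
have small := near_geometric (half_gt0 e0).
near=> n.
apply: le_lt_trans (L2_dist_triangle _ (u (phi n)) _) _.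
have : Lp_norm (u n - u (phi n)) < e / 2.
  have nN : (N <= n)%N by near: n; exact: nbhs_infty_ge.
  by apply: NP => //; exact: leq_trans nN (phin n).
have : 2 * 2^-1 ^+ n < e / 2.
  by near: n.
have := Uu n; rewrite Lp_norm_subC; real_lra.
Unshelve. all: by end_near. Qed.

(** A subsequence with geometrically decreasing increments converges almost
    everywhere, to a limit that has to be [U]. *)
Lemma L2_cvg_ae_subseq u U : u n @[n --> \oo] --> U ->
  exists2 phi : nat -> nat, forall n, (n <= phi n)%N &
    \forall m \ae leb01 R, u (phi n) m @[n --> \oo] --> U m.
Proof.
move=> /L2_cvgP uU.
have [e e0|phi phin fast] := @L2_cauchy_fast u.
  have [N _ NP] := uU (e / 2) (half_gt0 e0).
  exists N => n p Nn Np.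
  apply: le_lt_trans (L2_dist_triangle _ U _) _.
  have := NP _ Nn; have := NP _ Np; rewrite (Lp_norm_subC U) /=; real_lra.
have [V Vu Vae] := L2_fast_limit fast.
exists phi; first exact: phin.
suff VU : V = U %[ae leb01 R].
  by move: Vae VU; apply: filterS2 => m + /(_ I) <-.
apply/L2_dist_eq0P/eqP; rewrite eq_le L2_norm_ge0 andbT.
apply/ler_addgt0Pl => e e0; rewrite addr0.
have small := near_geometric (half_gt0 e0).
have [N _ NP] := uU (e / 2) (half_gt0 e0).
near \oo => n.
apply: le_trans (L2_dist_triangle _ (u (phi n)) _) _.
have : Lp_norm (u (phi n) - U) < e / 2.
  apply: NP => /=; apply: leq_trans (phin n).
  by near: n; exact: nbhs_infty_ge.
have : 2 * 2^-1 ^+ n < e / 2.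
  by near: n.
have := Vu n; real_lra.
Unshelve. all: by end_near. Qed.

End L2_complete.

(** * Growth of functions with bounded right Dini derivative *)

Section dini.
Context {R : realType}.
Implicit Types (f n : R -> R) (a b c e L : R).

Lemma lipschitz_cvg_left f a b L :
  (forall s t, a <= s -> s <= t -> t <= b -> `|f t - f s| <= L * (t - s)) ->
  forall t, a < t -> t <= b -> f s @[s --> t^'-] --> f t.
Proof.
move=> fL t at_ tb; apply/cvgrPdist_lt => e e0.
have L1 : 0 < `|L| + 1 by rewrite ltr_wpDl.
near=> s.
have st : s < t by near: s; exact: nbhs_left_lt.
have as_ : a <= s by near: s; exact: nbhs_left_ge.
have : t - s < e / (`|L| + 1) by near: s; apply: nbhs_left_ltBl; rewrite divr_gt0.
rewrite ltr_pdivlMr// => h.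
apply: le_lt_trans (fL _ _ as_ (ltW st) tb) _; apply: le_lt_trans h.
rewrite mulrC ler_wpM2l ?subr_ge0 ?(ltW st)//.
by rewrite (le_trans (ler_norm _))// lerDl.
Unshelve. all: by end_near. Qed.

(** If the bound fails at the slope [c + e], look at the last time up to which
    it holds: left continuity says that it holds there, and the Dini bound
    pushes it further. *)
Lemma dini_growth f a b c : a <= b ->
  (forall t, a < t -> t <= b -> f s @[s --> t^'-] --> f t) ->
  (forall t, a <= t -> t < b -> forall e, 0 < e ->
     \forall s \near t^'+, f s - f t <= (c + e) * (s - t)) ->
  f b - f a <= c * (b - a).
Proof.
move=> ab fl fD.
suff key e : 0 < e -> f b - f a <= (c + e) * (b - a).
  apply/ler_addgt0Pl => e e0.
  have ba : 0 < b - a + 1 by rewrite ltr_wpDl ?subr_ge0.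
  apply: le_trans (key (e / (b - a + 1)) (divr_gt0 e0 ba)) _.
  rewrite mulrDl addrC lerD2r mulrAC ler_pdivrMr// ler_pM2l//.
  by rewrite lerDl.
move=> e0.
pose g s := f s - f a - (c + e) * (s - a).
pose S := [set t | a <= t <= b /\ g t <= 0].
have Sa : S a by split; rewrite ?lexx//= /g !subrr mulr0 subrr.
have Sb : ubound S b by move=> t [/andP[]].
have hS : has_sup S by split; [exists a|exists b].
pose tau := sup S.
have atau : a <= tau by exact: (sup_upper_bound hS).
have taub : tau <= b by apply: ge_sup => //; exists a.
have gtau : g tau <= 0.
  rewrite leNgt; apply/negP => gt0.
  have at_ : a < tau.
    rewrite lt_neqAle atau andbT; apply/eqP => ata.
    by move: gt0; rewrite -ata /g !subrr mulr0 subrr ltxx.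
  have : g s @[s --> tau^'-] --> g tau.
    apply: cvgB; first by apply: cvgB; [exact: fl|exact: cvg_cst].
    apply: cvgMr; apply: cvgB; last exact: cvg_cst.
    exact: cvg_at_left_filter cvg_id.
  move=> /cvgr_gt/(_ _ gt0).
  rewrite /at_left near_withinE => -[/= d d0 dP].
  have [s Ss ts] := sup_adherent d0 hS.
  have stau : s <= tau by exact: (sup_upper_bound hS).
  have [/andP[_ _] gs] := Ss.
  have [st|st] := ltP s tau; last first.
    have stE : s = tau by apply/eqP; rewrite eq_le stau.
    by move: gs; rewrite stE leNgt gt0.
  have : 0 < g s.
    apply: dP => //=; rewrite ger0_norm ?subr_ge0//.
    by rewrite ltrBlDr addrC -ltrBlDr.
  by rewrite ltNge gs.
suff taubE : tau = b.
  by move: gtau; rewrite taubE /g subr_le0.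
apply/eqP; rewrite eq_le taub/= leNgt; apply/negP => tb.
have := fD _ atau tb _ e0 => fD'.
near tau^'+ => s.
have ts : tau < s by near: s; exact: nbhs_right_gt.
have : S s.
  split.
    apply/andP; split; first by rewrite (le_trans atau)// ltW.
    by near: s; exact: nbhs_right_ltW.
  have : f s - f tau <= (c + e) * (s - tau) by near: s.
  by move: gtau; rewrite /g; real_lra.
by move=> /(sup_upper_bound hS); rewrite leNgt ts.
Unshelve. all: by end_near. Qed.

Lemma lebesgue_itvoc (s t : R) : s <= t ->
  @lebesgue_measure R `]s, t]%classic = (t - s)%:E.
Proof.
rewrite le_eqVlt => /predU1P[->|st]; first by rewrite set_itvoc0 measure0 subrr.
by rewrite lebesgue_measure_itv/= lte_fin st.
Qed.

Lemma integrable_cst_itvoc (s t c : R) : s <= t ->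
  (@lebesgue_measure R).-integrable `]s, t] (EFin \o cst c).
Proof.
move=> st; apply: measurable_bounded_integrable => //.
  by rewrite [X in (X < _)%E](lebesgue_itvoc st) ltry.
by exists `|c|; split=> // M /ltW cM r _.
Qed.

Lemma lebesgue_itv_cap_fin (O : set R) a t : open O ->
  (@lebesgue_measure R (O `&` `[a, t]) < +oo)%E.
Proof.
move=> oO; apply: (@le_lt_trans _ _ (@lebesgue_measure R `[a, t]%classic)).
  apply: le_measure; rewrite ?inE//.
  by apply: measurableI => //; exact: open_measurable.
by rewrite lebesgue_measure_itv; case: ifP => _; rewrite ltry.
Qed.

(** The exceptional null set is covered by an open set of small measure, whose
    distribution function grows at unit speed on that set and absorbs there the
    Lipschitz growth of [f]. *)
Lemma dini_growth_ae f a b c L (N : set R) : a <= b ->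
  (@lebesgue_measure R).-negligible N ->
  (forall s t, a <= s -> s <= t -> t <= b -> `|f t - f s| <= L * (t - s)) ->
  (forall t, a <= t -> t < b -> ~ N t -> forall e, 0 < e ->
     \forall s \near t^'+, f s - f t <= (c + e) * (s - t)) ->
  f b - f a <= c * (b - a).
Proof.
move=> ab [N' [mN' N'0 NN']] fL fD.
have {}N'0 : @lebesgue_measure R (N' : set R) = 0%E := N'0.
(* [f - K g] grows at a rate at most [c], on [N] because [g] grows there at unit
   speed, and elsewhere because [g] is nondecreasing. *)
pose K : R := `|L| + `|c|.
have K0 : 0 <= K by rewrite addr_ge0.
apply/ler_addgt0Pl => eta eta0.
have K1 : 0 < K + 1 by rewrite ltr_wpDl.
have [|O [oO N'O Oeta]] := @lebesgue_regularity_outer R N' (eta / (K + 1)) mN' _ (divr_gt0 eta0 K1).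
  by rewrite [X in (X < _)%E](_ : _ = 0%E) ?ltry.
have mO : measurable (O : set (measurableTypeR R)) by exact: open_measurable.
have {}Oeta : (@lebesgue_measure R O <= (eta / (K + 1))%:E)%E.
  rewrite -(setDUK N'O); apply: le_trans (measureU2 _ _ _) _ => //.
    exact: measurableD.
  by rewrite [X in (X + _)%E](_ : _ = 0%E) ?add0e// ltW.
pose g t := fine (@lebesgue_measure R (O `&` `[a, t])).
have gE t : (g t)%:E = @lebesgue_measure R (O `&` `[a, t]).
  by rewrite fineK// ge0_fin_numE//; exact: lebesgue_itv_cap_fin.
have mOI (s t : R) : measurable ((O `&` `]s, t]) : set (measurableTypeR R)).
  exact: measurableI.
have gD s t : a <= s -> s <= t ->
    (g t)%:E = ((g s)%:E + @lebesgue_measure R (O `&` `]s, t]))%E.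
  move=> as_ st; rewrite !gE -measureU//.
  - congr (lebesgue_measure _); rewrite -setIUr; congr (_ `&` _).
    apply/seteqP; split => x /=; rewrite !in_itv/=.
      move=> /andP[ax xt]; have [xs|sx] := leP x s; [left|right].
        by rewrite ax.
      by rewrite xt.
    by case => /andP[h1 h2]; apply/andP; split; real_lra.
  - by apply: measurableI.
  - apply/seteqP; split => x //= [[_ +] [_ +]].
    by rewrite !in_itv/= => /andP[_ xs] /andP[]; rewrite ltNge xs.
have gmono s t : a <= s -> s <= t -> 0 <= g t - g s <= t - s.
  move=> as_ st; have := gD s t as_ st.
  have : (@lebesgue_measure R (O `&` `]s, t]) <= (t - s)%:E)%E.
    by rewrite -lebesgue_itvoc//; apply: le_measure; rewrite ?inE.
  have : (0 <= @lebesgue_measure R (O `&` `]s, t]))%E by [].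
  case: (lebesgue_measure (O `&` `]s, t])) => // r.
  rewrite !lee_fin -EFinD => r0 rts [->]; real_lra.
have gO s t : a <= s -> s <= t -> `]s, t] `<=` O -> g t - g s = t - s.
  move=> as_ st stO; have := gD s t as_ st.
  rewrite (setIidr stO) lebesgue_itvoc// -EFinD => -[->]; real_lra.
have ga : g a = 0.
  apply/EFin_inj; rewrite gE; apply/eqP.
  rewrite eq_le measure_ge0 andbT.
  apply: (@le_trans _ _ (@lebesgue_measure R `[a, a]%classic)).
    by apply: le_measure; rewrite ?inE//; exact: measurableI.
  by rewrite set_itv1 lebesgue_measure_set1.
have gb : g b <= eta / (K + 1).
  rewrite -lee_fin gE; apply: le_trans Oeta; apply: le_measure; rewrite ?inE//.
  by apply: measurableI.
have := @dini_growth (fun t => f t - K * g t) a b c ab.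
have Lle : L <= `|L| by exact: ler_norm.
have cle : - c <= `|c| by rewrite -normrN ler_norm.
have h : f b - K * g b - (f a - K * g a) <= c * (b - a) ->
    f b - f a <= eta + c * (b - a).
  rewrite ga mulr0 subr0.
  have : K * g b <= eta.
    apply: le_trans (ler_wpM2l K0 gb) _.
    by rewrite mulrCA ler_piMr ?(ltW eta0)// ler_pdivrMr// mul1r lerDl.
  real_lra.
move=> H; apply/h/H.
  apply: (@lipschitz_cvg_left _ a b (`|L| + K)) => s t as_ st tb.
  have := fL s t as_ st tb; have /andP[g0 g1] := gmono s t as_ st.
  have gK : K * (g t - g s) <= K * (t - s) by exact: ler_wpM2l.
  have gK0 : 0 <= K * (g t - g s) by exact: mulr_ge0.
  have LL : L * (t - s) <= `|L| * (t - s) by rewrite ler_wpM2r// subr_ge0.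
  rewrite !ler_norml => /andP[f1 f2]; apply/andP; split; real_lra.
move=> t at_ tb e e0.
have [Nt|Nt] := pselect (N t).
  have Ot : O t by apply: N'O; exact: NN'.
  have [d /= d0 dO] : nbhs t O by exact: open_nbhs_nbhs.
  near=> s.
  have ts : t < s by near: s; exact: nbhs_right_gt.
  have sb : s <= b by near: s; exact: nbhs_right_ltW.
  have std : s - t < d by near: s; exact: nbhs_right_ltDr.
  have tsO : `]t, s] `<=` O.
    move=> x /=; rewrite in_itv/= => /andP[tx xs]; apply: dO => /=.
    by rewrite ltr0_norm; real_lra.
  have := gO t s at_ (ltW ts) tsO.
  have := fL t s at_ (ltW ts) sb.
  have LL : L * (s - t) <= `|L| * (s - t) by rewrite ler_wpM2r// subr_ge0 ltW.
  have cc : - c * (s - t) <= `|c| * (s - t) by rewrite ler_wpM2r// subr_ge0 ltW.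
  have ee : 0 <= e * (s - t) by rewrite mulr_ge0 ?(ltW e0)// subr_ge0 ltW.
  rewrite ler_norml => /andP[_ f2] gE'.
  have -> : f s - K * g s - (f t - K * g t) = f s - f t - K * (s - t).
    by rewrite -gE'; ring.
  rewrite /K; real_lra.
have := fD t at_ tb Nt e e0 => fDt.
near=> s.
have ts : t < s by near: s; exact: nbhs_right_gt.
have /andP[g0 _] := gmono t s at_ (ltW ts).
have gK0 : 0 <= K * (g s - g t) by exact: mulr_ge0.
have : f s - f t <= (c + e) * (s - t) by near: s.
real_lra.
Unshelve. all: by end_near. Qed.

(** The square of a norm is easier to differentiate than the norm; the
    regularization [sqrt (n ^ 2 + d ^ 2)] avoids the division by zero. *)
Lemma sqr_growth n a b c L (N : set R) : a <= b -> 0 <= c ->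
  (forall t, 0 <= n t) ->
  (@lebesgue_measure R).-negligible N ->
  (forall s t, a <= s -> s <= t -> t <= b -> `|n t - n s| <= L * (t - s)) ->
  (forall t, a <= t -> t < b -> ~ N t -> forall e, 0 < e ->
     \forall s \near t^'+, n s ^+ 2 - n t ^+ 2 <= 2 * (c * n t + e) * (s - t)) ->
  n b <= n a + c * (b - a).
Proof.
move=> ab c0 n0 NN nL nD.
apply/ler_addgt0Pl => d d0.
pose f t := Num.sqrt (n t ^+ 2 + d ^+ 2).
have r0 t : 0 < n t ^+ 2 + d ^+ 2 by rewrite ltr_wpDl ?sqr_ge0// exprn_gt0.
have f0 t : 0 < f t by rewrite sqrtr_gt0.
have f2 t : f t ^+ 2 = n t ^+ 2 + d ^+ 2 by rewrite sqr_sqrtr// ltW.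
have fn t : n t <= f t.
  by rewrite -(@ler_pXn2r _ 2)// ?nnegrE ?(ltW (f0 _))// f2 lerDl sqr_ge0.
have fd t : d <= f t.
  by rewrite -(@ler_pXn2r _ 2)// ?nnegrE ?(ltW (f0 _)) ?(ltW d0)// f2 lerDr sqr_ge0.
have fa : f a <= n a + d.
  rewrite -(@ler_pXn2r _ 2)// ?nnegrE ?(ltW (f0 _)) ?addr_ge0 ?(ltW d0)//.
  by rewrite f2 sqrrD; have := mulr_ge0 (n0 a) (ltW d0); real_lra.
have fdiff s t : (f s - f t) * (f s + f t) = (n s - n t) * (n s + n t).
  by rewrite -!subr_sqr !f2; ring.
have fL s t : a <= s -> s <= t -> t <= b -> `|f t - f s| <= L * (t - s).
  move=> as_ st tb; apply: le_trans (nL s t as_ st tb).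
  have fs : 0 < f t + f s by rewrite addr_gt0.
  rewrite -(ler_pM2r fs) -{1}(gtr0_norm fs) -normrM fdiff normrM.
  rewrite ler_wpM2l// ger0_norm ?addr_ge0// lerD//.
suff : f b - f a <= c * (b - a) by have := fn b; real_lra.
apply: (dini_growth_ae ab NN fL) => t at_ tb Nt e e0.
have := nD t at_ tb Nt (e * d) (mulr_gt0 e0 d0) => nDt.
near=> s.
have ts : 0 < s - t by rewrite subr_gt0; near: s; exact: nbhs_right_gt.
have : n s ^+ 2 - n t ^+ 2 <= 2 * (c * n t + e * d) * (s - t) by near: s.
have -> : n s ^+ 2 - n t ^+ 2 = f s ^+ 2 - f t ^+ 2 by rewrite !f2; ring.
move=> H; rewrite -(ler_pM2r (f0 t)).
have h1 : (c * n t + e * d) * (s - t) <= (c + e) * (s - t) * f t.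
  rewrite mulrAC ler_pM2r// mulrDl lerD// ler_wpM2l// ltW//.
have : 0 <= (f s - f t) ^+ 2 by exact: sqr_ge0.
rewrite sqrrB; move: H h1; rewrite !expr2; real_lra.
Unshelve. all: by end_near. Qed.

End dini.

(** * The normal cone and its element of minimal norm *)

Section cone.
Context {R : realType}.
Implicit Types (U V W X Y Z : L2 R) (e eta : R).

Lemma monotone_cone0 : monotone_cone (0 : L2 R).
Proof. by split=> [m m' _ _ _|m _]; [exact: lexx|exact: cvg_cst]. Qed.

Lemma monotone_coneD X Y :
  monotone_cone X -> monotone_cone Y -> monotone_cone (X + Y).
Proof.
move=> [Xm Xr] [Ym Yr]; split=> [m m' mI m'I mm'|m mI].
  by rewrite /= lerD ?Xm ?Ym.
exact: (cvgD (Xr m mI) (Yr m mI)).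
Qed.

(** The cone is stable under addition, so the competitors [0], [X + X] and
    [X + U] are enough. *)
Lemma normal_coneP X W : monotone_cone X ->
  normal_cone X W <->
  (forall U, monotone_cone U -> L2_inner W U <= 0) /\ L2_inner W X = 0.
Proof.
move=> KX; split=> [NW|[W0 WX] U KU]; last first.
  by rewrite L2_innerBr WX subr0 W0.
have W0 U : monotone_cone U -> L2_inner W U <= 0.
  move=> KU; have := NW _ (monotone_coneD KX KU).
  by rewrite addrAC subrr add0r.
split=> //; apply/eqP; rewrite eq_le W0//=.
by have := NW _ monotone_cone0; rewrite L2_innerBr L2_inner0r sub0r oppr_le0.
Qed.

(** An enlargement of the normal cone at [X] that is still convex and contains
    the elements of bounded norm of the normal cones at the points close to [X]. *)
Definition relaxed_normal_cone X e : set (L2 R) := [set W |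
  (forall U, monotone_cone U -> L2_inner W U <= e * Lp_norm U) /\
  - e <= L2_inner W X].

Lemma relaxed_normal_coneS X e e' : e <= e' ->
  relaxed_normal_cone X e `<=` relaxed_normal_cone X e'.
Proof.
move=> ee' W [W1 W2]; split=> [U KU|]; last by rewrite (le_trans _ W2)// lerN2.
by rewrite (le_trans (W1 U KU))// ler_wpM2r ?L2_norm_ge0.
Qed.

Lemma normal_cone_relaxed X e W : monotone_cone X -> 0 <= e ->
  normal_cone X W -> relaxed_normal_cone X e W.
Proof.
move=> KX e0 /(normal_coneP _ KX)[W0 WX]; split=> [U KU|].
  by rewrite (le_trans (W0 U KU))// mulr_ge0 ?L2_norm_ge0.
by rewrite WX oppr_le0.
Qed.

Lemma relaxed_normal_cone_mid X e Y Z Z' :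
  relaxed_normal_cone X e (Y - Z) -> relaxed_normal_cone X e (Y - Z') ->
  relaxed_normal_cone X e (Y - 2^-1 *: (Z + Z')).
Proof.
move=> [h1 h2] [h3 h4]; split=> [U KU|].
  have := h1 U KU; have := h3 U KU.
  by rewrite !L2_innerBl L2_innerZl L2_innerDl; real_lra.
by move: h2 h4; rewrite !L2_innerBl L2_innerZl L2_innerDl; real_lra.
Qed.

Lemma L2_parallelogram U V : Lp_norm (U - V) ^+ 2 =
  2 * Lp_norm U ^+ 2 + 2 * Lp_norm V ^+ 2 - 4 * Lp_norm (2^-1 *: (U + V)) ^+ 2.
Proof.
rewrite L2_norm_sq_sub L2_normZ exprMn L2_norm_sq_add ger0_norm//; real_lra.
Qed.

Lemma L2_inner_cvg {T : Type} (F : set_system T) {FF : Filter F}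
    (u : T -> L2 R) U W :
  u @ F --> U -> L2_inner (u s) W @[s --> F] --> L2_inner U W.
Proof.
move=> /L2_cvgP uU; apply/cvgrPdist_le => e e0.
have W1 : 0 < Lp_norm W + 1 by rewrite ltr_wpDl ?L2_norm_ge0.
apply: filterS (uU _ (divr_gt0 e0 W1)) => s; rewrite ltr_pdivlMr// => h.
rewrite distrC -L2_innerBl (le_trans (L2_cauchy_schwarz_abs _ _))//.
by rewrite (le_trans _ (ltW h))// ler_wpM2l ?L2_norm_ge0// lerDl.
Qed.

(** Minimizing the norm over the relaxed cones gives, by the parallelogram
    identity, a Cauchy family: its limit is the element of minimal norm of
    [Y - normal_cone X], and every almost minimizer over a slightly relaxed
    cone is close to it: the convergence is strong, not only weak. *)
Lemma minimal_selection X Y : monotone_cone X -> exists V,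
  [/\ normal_cone X (Y - V),
      forall W, normal_cone X W -> Lp_norm V <= Lp_norm (Y - W) &
      forall eta, 0 < eta -> exists2 e, 0 < e &
        forall Z, relaxed_normal_cone X e (Y - Z) ->
          Lp_norm Z <= Lp_norm V + e -> Lp_norm (Z - V) <= eta].
Proof.
move=> KX.
(* [m] is the limit, as [e] decreases to 0, of the infimum [I e] of the norm over
   the relaxed set. *)
pose A e := [set Lp_norm Z | Z in [set Z | relaxed_normal_cone X e (Y - Z)]].
pose I e := inf (A e).
have AY e : 0 <= e -> A e (Lp_norm Y).
  move=> e0; exists Y => //=; rewrite subrr; split=> [U _|].
    by rewrite L2_inner0l mulr_ge0 ?L2_norm_ge0.
  by rewrite L2_inner0l oppr_le0.
have Alb e : lbound (A e) 0 by move=> _ [Z _ <-]; exact: L2_norm_ge0.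
have hA e : 0 <= e -> has_inf (A e).
  by move=> e0; split; [exists (Lp_norm Y); exact: AY|exists 0].
have Ile e Z : 0 <= e -> relaxed_normal_cone X e (Y - Z) -> I e <= Lp_norm Z.
  by move=> e0 CZ; apply: ge_inf; [exists 0|exists Z].
have I0 e : 0 <= e -> 0 <= I e.
  by move=> e0; apply: lb_le_inf; [exists (Lp_norm Y); exact: AY|].
pose S := [set I e | e in [set e | 0 < e]].
have hS : has_sup S.
  split; first by exists (I 1), 1 => /=.
  exists (Lp_norm Y) => _ [e /= e0 <-].
  by apply: ge_inf; [exists 0|exact: AY (ltW e0)].
pose m := sup S.
have Im e : 0 < e -> I e <= m.
  by move=> e0; apply: (sup_upper_bound hS); exists e.
have m0 : 0 <= m by rewrite (le_trans (I0 1 _) (Im 1 _)).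
(* Midpoints stay in the relaxed set, so their norm is at least almost [m]. *)
have close eta : 0 < eta -> exists2 e, 0 < e & forall Z Z',
    relaxed_normal_cone X e (Y - Z) -> relaxed_normal_cone X e (Y - Z') ->
    Lp_norm Z <= m + e -> Lp_norm Z' <= m + e -> Lp_norm (Z - Z') <= eta.
  move=> eta0.
  pose d := Num.min 1 (eta ^+ 2 / (16 * m + 4)).
  have m4 : 0 < 16 * m + 4 by rewrite ltr_wpDl// mulr_ge0.
  have d0 : 0 < d by rewrite lt_min ltr01 divr_gt0// exprn_gt0.
  have [_ [e1 /= e10 <-] Ie1] := sup_adherent d0 hS.
  exists (Num.min e1 d); first by rewrite lt_min e10.
  set e := Num.min e1 d => Z Z' CZ CZ' Zm Z'm.
  have ed : e <= d by rewrite ge_min lexx orbT.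
  have ee1 : e <= e1 by rewrite ge_min lexx.
  have mid : m - d <= Lp_norm (2^-1 *: (Z + Z')).
    apply: le_trans (ltW Ie1) _; apply: Ile (ltW e10) _.
    by apply: relaxed_normal_coneS ee1 _ _; exact: relaxed_normal_cone_mid.
  rewrite -(@ler_pXn2r _ 2)// ?nnegrE ?L2_norm_ge0 ?(ltW eta0)//.
  have mid2 : m ^+ 2 - 2 * (m * d) <= Lp_norm (2^-1 *: (Z + Z')) ^+ 2.
    have [dm|md] := leP d m.
      apply: (@le_trans _ _ ((m - d) ^+ 2)).
        by rewrite sqrrB mulr_natl lerDl sqr_ge0.
      by rewrite ler_pXn2r ?nnegrE ?L2_norm_ge0 ?subr_ge0.
    apply: le_trans (sqr_ge0 _).
    have : m * m <= m * d by rewrite ler_wpM2l// ltW.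
    by rewrite expr2; have := mulr_ge0 m0 (ltW d0); real_lra.
  have sq W : Lp_norm W <= m + e -> Lp_norm W ^+ 2 <= (m + d) ^+ 2.
    move=> Wm; rewrite ler_pXn2r ?nnegrE ?L2_norm_ge0 ?addr_ge0 ?(ltW d0)//.
    by rewrite (le_trans Wm)// lerD2l.
  have := sq _ Zm; have := sq _ Z'm; rewrite L2_parallelogram sqrrD => h1 h2.
  have d1 : d <= 1 by rewrite ge_min lexx.
  have dd : d ^+ 2 <= d by rewrite expr2 ler_piMl// ltW.
  have : d * (16 * m + 4) <= eta ^+ 2.
    by rewrite -ler_pdivlMr// ge_min lexx orbT.
  real_lra.
have inv0 n : 0 < n.+1%:R^-1 :> R by rewrite invr_gt0 ltr0n.
have /choice[Z ZP] : forall n : nat, exists Z, 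
    relaxed_normal_cone X n.+1%:R^-1 (Y - Z) /\ Lp_norm Z <= m + n.+1%:R^-1.
  move=> n; have [_ [Z CZ <-] ZI] := inf_adherent (inv0 n) (hA _ (ltW (inv0 n))).
  exists Z; split=> //; apply: le_trans (ltW ZI) _.
  by rewrite lerD2r; exact: Im.
have near_inv e : 0 < e -> exists N, forall n, (N <= n)%N -> n.+1%:R^-1 <= e.
  move=> e0; exists (Num.bound e^-1) => n Nn.
  rewrite -[leRHS]invrK lef_pV2 ?posrE ?ltr0n// ?invr_gt0//.
  have := archi_boundP (ltW (_ : 0 < e^-1)); rewrite invr_gt0 => /(_ e0) h.
  by rewrite (le_trans (ltW h))// ler_nat (leq_trans Nn).
have ZeP e : 0 < e -> exists N, forall n, (N <= n)%N ->
    relaxed_normal_cone X e (Y - Z n) /\ Lp_norm (Z n) <= m + e.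
  move=> e0; have [N NP] := near_inv e e0; exists N => n Nn.
  have [CZ Zm] := ZP n; split; first exact: relaxed_normal_coneS (NP n Nn) _ CZ.
  by rewrite (le_trans Zm)// lerD2l NP.
have [V ZV] : exists V, Z n @[n --> \oo] --> V.
  apply: L2_complete => e e0.
  have [d d0 dP] := close _ (half_gt0 e0).
  have [N NP] := ZeP d d0; exists N => n p Nn Np.
  have [Cn Zn] := NP n Nn; have [Cp Zp] := NP p Np.
  by apply: le_lt_trans (dP _ _ Cn Cp Zn Zp) _; rewrite gtr_pMr// invf_lt1// ltr1n.
have ZVl U : L2_inner (Y - Z n) U @[n --> \oo] --> L2_inner (Y - V) U.
  rewrite L2_innerBl; under eq_fun do rewrite L2_innerBl.
  by apply: cvgB; [exact: cvg_cst|exact: L2_inner_cvg].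
have CV e : 0 < e -> relaxed_normal_cone X e (Y - V).
  move=> e0; have [N NP] := ZeP e e0; split=> [U KU|].
    rewrite -(cvg_lim _ (ZVl U))//; apply: limr_le; first exact: cvgP (ZVl U).
    by exists N => // n /= Nn; have [[h _] _] := NP n Nn; exact: h.
  rewrite -(cvg_lim _ (ZVl X))//; apply: limr_ge; first exact: cvgP (ZVl X).
  by exists N => // n /= Nn; have [[_ h] _] := NP n Nn.
have NV : normal_cone X (Y - V).
  have h U : monotone_cone U -> L2_inner (Y - V) U <= 0.
    move=> KU; apply/ler_addgt0Pl => e e0; rewrite addr0.
    have U1 : 0 < Lp_norm U + 1 by rewrite ltr_wpDl ?L2_norm_ge0.
    have [+ _] := CV _ (divr_gt0 e0 U1) => /(_ U KU) /le_trans; apply.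
    by rewrite mulrAC ler_pdivrMr// ler_pM2l// lerDl.
  apply/normal_coneP => //; split=> //; apply/eqP; rewrite eq_le h//=.
  apply/ler_addgt0Pl => e e0; rewrite -lerBlDl sub0r.
  by have [_] := CV e e0.
have Vm : Lp_norm V <= m.
  apply/ler_addgt0Pl => e e0.
  have [N NP] := ZeP _ (half_gt0 e0).
  have [M _ MP] := (L2_cvgP _ _).1 ZV _ (half_gt0 e0).
  pose n := maxn N M.
  have [_ Zn] := NP n (leq_maxl _ _).
  have := MP n (leq_maxr _ _); rewrite Lp_norm_subC => ZVn.
  have := L2_norm_triangle (V - Z n) (Z n); rewrite subrK.
  by move: Zn ZVn => /=; real_lra.
exists V; split=> // [W NW|eta eta0].
  apply: le_trans Vm _; apply: ge_sup; first by exists (I 1), 1 => /=.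
  move=> _ [e /= e0 <-]; apply: Ile (ltW e0) _.
  by rewrite opprB addrC subrK; exact: normal_cone_relaxed (ltW e0) NW.
have [e e0 eP] := close eta eta0; exists e => // W CW WV.
apply: eP => //; first exact: CV.
  by rewrite (le_trans WV)// lerD2r.
by rewrite (le_trans Vm)// lerDl ltW.
Qed.

End cone.

(** * Right derivatives of curves in L2 *)

Section curves.
Context {R : realType}.
Implicit Types (X Y : R -> L2 R) (V W U : L2 R).

Lemma near_rightP (t : R) (P : R -> Prop) :
  (\forall s \near t^'+, P s) <->
  exists2 d : R, 0 < d & forall s, t < s -> s < t + d -> P s.
Proof.
rewrite /at_right near_withinE; split.
  move=> [d /= d0 dP]; exists d => // s ts std; apply: dP => //=.
  by rewrite ltr0_norm; real_lra.
move=> [d d0 dP]; exists d => //= s /=; rewrite ltr_norml => /andP[s1 s2] ts.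
by apply: dP => //; real_lra.
Qed.

Lemma near_nbhsP (t : R) (P : R -> Prop) :
  (\forall s \near t, P s) <->
  exists2 d : R, 0 < d & forall s, `|s - t| < d -> P s.
Proof.
split.
  by move=> [d /= d0 dP]; exists d => // s ts; apply: dP; rewrite /= distrC.
by move=> [d d0 dP]; exists d => //= s /=; rewrite distrC => /dP.
Qed.

Lemma lipschitz_continuous (f : R -> R) (K : R) :
  (forall x y, `|f x - f y| <= K * `|x - y|) -> continuous f.
Proof.
move=> fK x; apply/cvgrPdist_lt => e e0; have K1 : 0 < `|K| + 1 by rewrite ltr_wpDl.
apply/near_nbhsP; exists (e / (`|K| + 1)); first by rewrite divr_gt0.
move=> y; rewrite ltr_pdivlMr// => h; apply: le_lt_trans (fK _ _) _.
rewrite distrC mulrC (le_lt_trans _ h)// ler_wpM2l//.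
by rewrite (le_trans (ler_norm K))// lerDl.
Qed.

Lemma near_dnbhsP (t : R) (P : R -> Prop) :
  (\forall s \near t^', P s) <->
  exists2 d : R, 0 < d & forall s, s != t -> `|s - t| < d -> P s.
Proof.
rewrite /dnbhs near_withinE; split.
  move=> [d /= d0 dP]; exists d => // s st ts.
  by apply: dP => //=; rewrite distrC.
by move=> [d d0 dP]; exists d => //= s /= + st; rewrite distrC => /(dP s st).
Qed.

Let quotient_dist X (t h : R) V : h != 0 ->
  Lp_norm (h^-1 *: (X (t + h) - X t) - V) =
  `|h|^-1 * Lp_norm (X (t + h) - X t - h *: V).
Proof.
move=> h0; rewrite -normfV -L2_normZ; congr Lp_norm.
by rewrite [RHS]scalerBr scalerA mulVf// scale1r.
Qed.

Lemma has_right_derivP X (t : R) V : has_right_deriv X t V <->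
  forall e : R, 0 < e ->
    \forall s \near t^'+, Lp_norm (X s - X t - (s - t) *: V) <= e * (s - t).
Proof.
rewrite /has_right_deriv L2_cvgP; split=> XV e e0.
  have /near_rightP[d d0 dP] := XV e e0.
  apply/near_rightP; exists d => // s ts std.
  have st0 : 0 < s - t by rewrite subr_gt0.
  have := dP (s - t); rewrite add0r => /(_ st0).
  rewrite quotient_dist ?gt_eqF// subrKC gtr0_norm//.
  move=> /(_ _)/ltW; rewrite ler_pdivrMl// mulrC; apply; real_lra.
have /near_rightP[d d0 dP] := XV _ (half_gt0 e0).
apply/near_rightP; exists d => // h h0; rewrite add0r => hd.
rewrite quotient_dist ?gt_eqF// gtr0_norm// ltr_pdivrMl//.
have hE : t + h - t = h by rewrite addrAC subrr add0r.
have := dP (t + h); rewrite hE ltrDl ltrD2l => /(_ h0 hd)/le_lt_trans -> //.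
by rewrite [ltRHS]mulrC ltr_pM2r// gtr_pMr// invf_lt1// ltr1n.
Qed.

Lemma has_derivP X (t : R) V : has_deriv X t V <->
  forall e : R, 0 < e -> exists2 d : R, 0 < d & forall s, `|s - t| < d ->
    Lp_norm (X s - X t - (s - t) *: V) <= e * `|s - t|.
Proof.
rewrite /has_deriv L2_cvgP; split=> XV e e0.
  have /near_dnbhsP[d d0 dP] := XV e e0.
  exists d => // s std; have [->|st] := eqVneq s t.
    by rewrite !subrr normr0 mulr0 scale0r subrr Lp_norm0.
  have st0 : s - t != 0 by rewrite subr_eq0.
  have := dP (s - t) st0; rewrite subr0 => /(_ std).
  rewrite quotient_dist// subrKC => /ltW.
  by rewrite ler_pdivrMl ?normr_gt0// mulrC.
have [d d0 dP] := XV _ (half_gt0 e0).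
apply/near_dnbhsP; exists d => // h h0; rewrite subr0 => hd.
rewrite quotient_dist// ltr_pdivrMl ?normr_gt0//.
have hE : t + h - t = h by rewrite addrAC subrr add0r.
have := dP (t + h); rewrite hE => /(_ hd)/le_lt_trans -> //.
by rewrite [ltRHS]mulrC ltr_pM2r ?normr_gt0// gtr_pMr// invf_lt1// ltr1n.
Qed.

Lemma has_deriv_right X (t : R) V : has_deriv X t V -> has_right_deriv X t V.
Proof.
move=> /has_derivP XV; apply/has_right_derivP => e /XV[d d0 dP].
apply/near_rightP; exists d => // s ts std.
have st0 : 0 < s - t by rewrite subr_gt0.
by have := dP s; rewrite gtr0_norm//; apply; real_lra.
Qed.

Lemma has_right_deriv_inner X (t : R) V U (e : R) : has_right_deriv X t V ->
  0 < e -> \forall s \near t^'+,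
    `|L2_inner (X s - X t) U - (s - t) * L2_inner V U| <= e * (s - t).
Proof.
move=> /has_right_derivP XV e0.
have U1 : 0 < Lp_norm U + 1 by rewrite ltr_wpDl ?L2_norm_ge0.
have := XV _ (divr_gt0 e0 U1); apply: filter_app; near=> s => h.
have st : 0 <= s - t by rewrite subr_ge0; near: s; exact: nbhs_right_ge.
rewrite -L2_innerZl -L2_innerBl (le_trans (L2_cauchy_schwarz_abs _ _))//.
apply: le_trans (ler_wpM2r (L2_norm_ge0 _) h) _.
rewrite -mulrA (mulrC (s - t)) mulrA ler_wpM2r// mulrAC ler_pdivrMr//.
by rewrite ler_pM2l// lerDl.
Unshelve. all: by end_near. Qed.

Lemma has_right_deriv_norm_le X (t : R) V (L : R) : has_right_deriv X t V ->
  (\forall s \near t^'+, Lp_norm (X s - X t) <= L * (s - t)) -> Lp_norm V <= L.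
Proof.
move=> /has_right_derivP XV XL; apply/ler_addgt0Pl => e e0.
have := XV e e0 => XVe; near t^'+ => s.
have st : 0 < s - t by rewrite subr_gt0; near: s; exact: nbhs_right_gt.
rewrite -(ler_pM2r st) mulrDl -{1}(gtr0_norm st) mulrC -L2_normZ.
have -> : (s - t) *: V = - (X s - X t - (s - t) *: V) + (X s - X t).
  by rewrite opprB subrK.
apply: le_trans (L2_norm_triangle _ _) _; rewrite L2_normN lerD//.
  by near: s.
by near: s.
Unshelve. all: by end_near. Qed.

(** Half of the square of the distance to [U] has the derivative
    [L2_inner V (X t - U)]; the Lipschitz bound absorbs the quadratic remainder. *)
Lemma near_sqr_growth X (t c L e : R) V U : has_right_deriv X t V -> 0 < e ->
  0 <= L ->
  (\forall s \near t^'+, Lp_norm (X s - X t) <= L * (s - t)) ->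
  L2_inner V (X t - U) <= c ->
  \forall s \near t^'+, Lp_norm (X s - U) ^+ 2 - Lp_norm (X t - U) ^+ 2 <=
    2 * (c + e) * (s - t).
Proof.
move=> XV e0 L0 XL Vc.
have := has_right_deriv_inner (X t - U) XV (half_gt0 e0) => XV'.
have L1 : 0 < L ^+ 2 + 1 by rewrite ltr_wpDl ?sqr_ge0.
near=> s.
have st : 0 < s - t by rewrite subr_gt0; near: s; exact: nbhs_right_gt.
have : `|L2_inner (X s - X t) (X t - U) - (s - t) * L2_inner V (X t - U)| <=
  e / 2 * (s - t) by near: s.
rewrite ler_norml => /andP[_ h1].
have h2 : Lp_norm (X s - X t) <= L * (s - t) by near: s.
have h3 : (s - t) * L2_inner V (X t - U) <= (s - t) * c by rewrite ler_pM2l.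
have -> : X s - U = (X s - X t) + (X t - U) by rewrite addrA subrK.
rewrite L2_norm_sq_add.
have h4 : Lp_norm (X s - X t) ^+ 2 <= e * (s - t).
  apply: (@le_trans _ _ ((L * (s - t)) ^+ 2)).
    by rewrite ler_pXn2r ?nnegrE ?L2_norm_ge0// mulr_ge0// ltW.
  rewrite exprMn expr2 (expr2 (s - t)) mulrA ler_pM2r// -expr2.
  have : s - t < e / (L ^+ 2 + 1).
    by near: s; apply: nbhs_right_ltDr; exact: divr_gt0.
  rewrite ltr_pdivlMr// => /ltW; apply: le_trans.
  by rewrite mulrC ler_pM2l// lerDl.
move: h1 h3 h4; real_lra.
Unshelve. all: by end_near. Qed.

End curves.

(** * The evolution driven by a Lipschitz curve *)

Section evolution.
Context {R : realType}.
Implicit Types (X Y V : R -> L2 R) (t : R).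

Definition lipschitz_evolution X Y : Prop :=
  [/\ forall t, 0 <= t -> monotone_cone (X t),
      locally_lipschitz_curve X & locally_lipschitz_curve Y].

Definition derivative_inclusion X Y : Prop :=
  \forall t \ae (@lebesgue_measure R), 0 < t ->
    exists2 D : L2 R, has_right_deriv X t D & normal_cone (X t) (Y t - D).

(** The last clause is the strong stability of the element of minimal norm when
    the normal cone is relaxed. *)
Definition minimal_velocity X Y V : Prop := forall t, 0 <= t ->
  [/\ has_right_deriv X t (V t), normal_cone (X t) (Y t - V t),
      forall W, normal_cone (X t) W -> Lp_norm (V t) <= Lp_norm (Y t - W) &
      forall eta : R, 0 < eta -> exists2 e : R, 0 < e &
        forall Z, relaxed_normal_cone (X t) e (Y t - Z) ->
          Lp_norm Z <= Lp_norm (V t) + e -> Lp_norm (Z - V t) <= eta].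

Lemma lipschitz_bounds X Y (T : R) : lipschitz_evolution X Y ->
  exists2 L : R, 0 <= L & forall s t : R, 0 <= s -> s <= t -> t <= T ->
  Lp_norm (X t - X s) <= L * (t - s) /\ Lp_norm (Y t - Y s) <= L * (t - s).
Proof.
move=> [_ XL YL]; have T1 : 0 < `|T| + 1 by rewrite ltr_wpDl.
have [L1 L1P] := XL _ T1; have [L2 L2P] := YL _ T1.
exists (`|L1| + `|L2|) => [|s t s0 st tT]; first by rewrite addr_ge0.
have TT : t <= `|T| + 1.
  by rewrite (le_trans tT)// (le_trans (ler_norm _))// lerDl.
have sI : s \in `[0, `|T| + 1] by rewrite in_itv/= s0 (le_trans st).
have tI : t \in `[0, `|T| + 1] by rewrite in_itv/= TT (le_trans s0).
have st0 : 0 <= t - s by rewrite subr_ge0.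
have h1 := L1P s t sI tI; have h2 := L2P s t sI tI.
rewrite (ger0_norm st0) in h1 h2; split.
  by rewrite (le_trans h1)// ler_wpM2r// (le_trans (ler_norm _))// lerDl.
by rewrite (le_trans h2)// ler_wpM2r// (le_trans (ler_norm _))// lerDr.
Qed.

Lemma inclusion_right X Y t : derivative_inclusion X Y -> 0 <= t ->
  exists2 N : set R, (@lebesgue_measure R).-negligible N & forall s, t <= s -> ~ N s ->
    exists2 D : L2 R, has_right_deriv X s D & normal_cone (X s) (Y s - D).
Proof.
(* The time 0, where the inclusion says nothing, is among the exceptional ones. *)
move=> [N [mN N0 NP]] t0; exists (N `|` [set t]).
  apply: negligibleU; first by exists N; split.
  by apply/negligibleP => //; exact: lebesgue_measure_set1.
move=> s ts /not_orP[Ns st]; apply: contrapT => h; apply: Ns; apply: NP => /= H.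
apply: h; apply: H; rewrite lt_neqAle (le_trans t0 ts) andbT; apply/eqP => s0.
by apply: st; apply/eqP; rewrite eq_le ts -s0 t0.
Qed.

(** Average of the inclusion on [[t, t + h]]: the averages of the elements of
    the normal cones at the points [X s] lie in a relaxed normal cone at [X t]. *)
Lemma difference_quotient_relaxed X Y t : lipschitz_evolution X Y ->
  derivative_inclusion X Y -> 0 <= t -> exists2 C : R, 0 <= C &
  forall h : R, 0 < h -> h <= 1 ->
    relaxed_normal_cone (X t) (C * h) (Y t - h^-1 *: (X (t + h) - X t)).
Proof.
move=> XY incl t0; have [KX _ _] := XY.
have [L L0 LP] := lipschitz_bounds (t + 1) XY.
have [N NN good'] := inclusion_right incl t0.
pose B := Lp_norm (Y t) + L + L.
have B0 : 0 <= B by rewrite !addr_ge0// L2_norm_ge0.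
pose C := L + L * Lp_norm (X t) + B * L.
exists C => [|h h0 h1].
  by rewrite !addr_ge0// mulr_ge0// L2_norm_ge0.
have good s : t <= s -> s < t + h -> ~ N s ->
    exists D, [/\ has_right_deriv X s D, normal_cone (X s) (Y s - D) &
      Lp_norm (Y s - D) <= B].
  move=> ts sth Ns.
  have [D XD ND] := good' s ts Ns; exists D; split=> //.
  have DL : Lp_norm D <= L.
    apply: (has_right_deriv_norm_le XD); near=> r.
    have sr : s <= r by near: r; exact: nbhs_right_ge.
    have rt : r <= t + 1.
      by near: r; apply: nbhs_right_ltW; rewrite (lt_le_trans sth)// lerD2l.
    by have [] := LP s r (le_trans t0 ts) sr rt.
  have [|_ YLs] := LP t s t0 ts; first by rewrite (le_trans (ltW sth))// lerD2l.
  have := L2_norm_triangle (Y s - Y t) (Y t - D); rewrite addrA subrK.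
  have := L2_norm_triangle (Y t) (- D); rewrite L2_normN.
  have : L * (s - t) <= L by rewrite ler_piMr//; real_lra.
  rewrite /B; real_lra.
have th : t <= t + h by rewrite lerDl ltW.
have XLs U s r : t <= s -> s <= r -> r <= t + h ->
    `|L2_inner (X r) U - L2_inner (X s) U| <= L * Lp_norm U * (r - s).
  move=> ts sr rh; rewrite -L2_innerBl (le_trans (L2_cauchy_schwarz_abs _ _))//.
  rewrite mulrAC ler_wpM2r ?L2_norm_ge0//.
  by have [] // := LP s r (le_trans t0 ts) sr; rewrite (le_trans rh)// lerD2l.
have hlip U s r : t <= s -> s <= r -> r <= t + h ->
   `|L2_inner (X r) U - r * L2_inner (Y t) U -
   (L2_inner (X s) U - s * L2_inner (Y t) U)| <=
   (Lp_norm (Y t) + L) * Lp_norm U * (r - s).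
  move=> ts sr rh; have := XLs U s r ts sr rh.
  have := L2_cauchy_schwarz_abs (Y t) U.
  have sr0 : 0 <= r - s by rewrite subr_ge0.
  move=> /(ler_wpM2r sr0).
  rewrite -[X in `|_| * X]ger0_norm// -normrM !ler_norml.
  by move=> /andP[a1 a2] /andP[b1 b2]; apply/andP; split; real_lra.
(* Both bounds are obtained by integrating a bound on the right derivative, for
   the times outside [N], of a Lipschitz function of time. *)
split=> [U KU|].
  have H := @dini_growth_ae R
    (fun s => s * L2_inner (Y t) U - L2_inner (X s) U) t (t + h)
    (L * h * Lp_norm U) ((Lp_norm (Y t) + L) * Lp_norm U) _ th NN _ _.
  have fE : t + h - t = h by rewrite addrAC subrr add0r.
  rewrite L2_innerBl L2_innerZl L2_innerBl.
  suff : (t + h) * L2_inner (Y t) U - L2_inner (X (t + h)) U -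
    (t * L2_inner (Y t) U - L2_inner (X t) U) <= L * h * Lp_norm U * h.
    move=> hh; rewrite -(ler_pM2l h0) mulrBr mulVKf ?gt_eqF//.
    have : L * h * Lp_norm U * h <= C * h * Lp_norm U * h.
      rewrite !ler_wpM2r ?L2_norm_ge0 ?(ltW h0)// /C -addrA lerDl.
      by rewrite addr_ge0// mulr_ge0// L2_norm_ge0.
    real_lra.
  rewrite -[X in _ <= _ * X]fE; apply: H => [s r ts sr rh|s ts sh Ns e e0].
    rewrite -normrN (le_trans _ (hlip U s r ts sr rh))// le_eqVlt.
    by apply/orP; left; apply/eqP; congr `|_|; ring.
  have [D [XD /(normal_coneP _ (KX _ (le_trans t0 ts)))[ND _] _]] := good s ts sh Ns.
  have := has_right_deriv_inner U XD e0; apply: filter_app; near=> r.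
  rewrite ler_norml => /andP[h2 _].
  have sr : 0 <= r - s by rewrite subr_ge0; near: r; exact: nbhs_right_ge.
  have : L2_inner (Y t - D) U <= L * h * Lp_norm U.
    rewrite -(subrKA (Y s)) L2_innerDl -[leRHS]addr0; apply: lerD; last exact: ND.
    rewrite (le_trans (L2_cauchy_schwarz _ _))// ler_wpM2r ?L2_norm_ge0//.
    rewrite Lp_norm_subC; have [|_ h3] := LP t s t0 ts; first by rewrite (le_trans (ltW sh))// lerD2l.
    by rewrite (le_trans h3)// ler_wpM2l// lerBlDl ltW.
  move=> /(ler_wpM2r sr); rewrite L2_innerBl.
  move: h2; rewrite L2_innerBl; real_lra.
have := @dini_growth_ae R
  (fun s => L2_inner (X s) (X t) - s * L2_inner (Y t) (X t)) t (t + h)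
  (C * h) ((Lp_norm (Y t) + L) * Lp_norm (X t)) _ th NN.
move=> /(_ (hlip (X t))) H.
have fE : t + h - t = h by rewrite addrAC subrr add0r.
rewrite L2_innerBl L2_innerZl L2_innerBl.
suff : L2_inner (X (t + h)) (X t) - (t + h) * L2_inner (Y t) (X t) -
  (L2_inner (X t) (X t) - t * L2_inner (Y t) (X t)) <= C * h * h.
  by move=> hh; rewrite -(ler_pM2l h0) mulrBr mulVKf ?gt_eqF//; real_lra.
rewrite -[X in _ <= _ * X]fE; apply: H => s ts sh Ns e e0.
have [D [XD ND YDB]] := good s ts sh Ns.
have := has_right_deriv_inner (X t) XD e0; apply: filter_app; near=> r.
rewrite ler_norml => /andP[_ h2].
have sr : 0 <= r - s by rewrite subr_ge0; near: r; exact: nbhs_right_ge.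
have [|XLts YLts] := LP t s t0 ts; first by rewrite (le_trans (ltW sh))// lerD2l.
have Lts : L * (s - t) <= L * h by rewrite ler_wpM2l// lerBlDl ltW.
have : L2_inner (D - Y t) (X t) <= C * h.
  rewrite -(subrKA (Y s)) L2_innerDl.
  have h3 : L2_inner (Y s - Y t) (X t) <= L * h * Lp_norm (X t).
    rewrite (le_trans (L2_cauchy_schwarz _ _))// ler_wpM2r ?L2_norm_ge0//.
    exact: le_trans YLts Lts.
  have [_ YDX] := (normal_coneP _ (KX _ (le_trans t0 ts))).1 ND.
  (* [Y s - D] is orthogonal to [X s], which is close to [X t]. *)
  have h4 : L2_inner (D - Y s) (X t) <= B * (L * h).
    rewrite -opprB L2_innerNl -[leLHS]addr0 -YDX addrC -L2_innerBr.
    rewrite (le_trans (L2_cauchy_schwarz _ _))//.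
    by apply: ler_pM; rewrite ?L2_norm_ge0// (le_trans XLts).
  have : 0 <= L * h by rewrite mulr_ge0// ltW.
  move=> Lh0; apply: le_trans (lerD h4 h3) _.
  rewrite [leRHS](_ : _ = L * h + (B * (L * h) + L * h * Lp_norm (X t))).
    by rewrite lerDr.
  by rewrite /C; ring.
move=> /(ler_wpM2r sr); rewrite L2_innerBl.
move: h2; rewrite L2_innerBl; real_lra.
Unshelve. all: by end_near. Qed.

Lemma normal_cone_ge0 (Z Z' W : L2 R) :
  monotone_cone Z' -> normal_cone Z W -> 0 <= L2_inner W (Z - Z').
Proof. by move=> KZ' /(_ _ KZ'); rewrite !L2_innerBr; real_lra. Qed.

(** Comparing [X] with the stationary curve [X t] by monotonicity bounds the
    difference quotients by the norm of any element of [Y t - normal_cone (X t)]. *)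
Lemma difference_quotient_le X Y t (V : L2 R) : lipschitz_evolution X Y ->
  derivative_inclusion X Y -> 0 <= t ->
  normal_cone (X t) (Y t - V) -> exists2 M : R, 0 <= M &
  forall h : R, 0 < h -> h <= 1 ->
    Lp_norm (X (t + h) - X t) <= (Lp_norm V + M * h) * h.
Proof.
move=> XY incl t0 NV; have [KX _ _] := XY.
have [L L0 LP] := lipschitz_bounds (t + 1) XY.
exists L => // h h0 h1.
have [N NN good] := inclusion_right incl t0.
have th : t <= t + h by rewrite lerDl ltW.
have c0 : 0 <= Lp_norm V + L * h by rewrite addr_ge0 ?L2_norm_ge0// mulr_ge0// ltW.
have := @sqr_growth R (fun s => Lp_norm (X s - X t)) t (t + h)
  (Lp_norm V + L * h) L _ th c0 (fun=> L2_norm_ge0 _) NN.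
rewrite subrr Lp_norm0 add0r addrAC subrr add0r; apply.
  move=> s r ts sr rh.
  have [|||XLsr _] := LP s r; [real_lra|done|real_lra|].
  apply: le_trans (L2_dist_dist _ _) _; rewrite opprB subrKA.
  exact: XLsr.
move=> s ts sh Ns e e0.
have [D XD ND] := good s ts Ns; have s0 := le_trans t0 ts.
apply: (near_sqr_growth XD e0 L0).
  near=> r.
  have sr : s <= r by near: r; exact: nbhs_right_ge.
  have rt : r <= t + 1.
    by near: r; apply: nbhs_right_ltW; rewrite (lt_le_trans sh)// lerD2l.
  by have [] := LP s r s0 sr rt.
have KXt := KX t t0.
have NsX : 0 <= L2_inner (Y s - D) (X s - X t).
  exact: normal_cone_ge0 KXt ND.
have NtX : L2_inner (Y t - V) (X s - X t) <= 0 by exact: NV (KX _ s0).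
have -> : L2_inner D (X s - X t) = L2_inner (Y s - Y t) (X s - X t)
    - L2_inner (Y s - D) (X s - X t) + L2_inner (Y t - V) (X s - X t)
    + L2_inner V (X s - X t).
  by rewrite !(L2_innerBl _ _ (X s - X t)); generalize_norms; ring.
have := L2_cauchy_schwarz V (X s - X t).
have := L2_cauchy_schwarz (Y s - Y t) (X s - X t).
have [|_ YLts] := LP t s t0 ts; first real_lra.
have : Lp_norm (Y s - Y t) <= L * h.
  by rewrite (le_trans YLts)// ler_wpM2l//; real_lra.
move=> /(ler_wpM2r (L2_norm_ge0 (X s - X t))).
real_lra.
Unshelve. all: by end_near. Qed.

(** The difference quotients are almost minimizers of the norm over [Y t] minus
    relaxed normal cones, so they converge to the minimal selection. *)
Lemma minimal_velocity_exists X Y : lipschitz_evolution X Y ->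
  derivative_inclusion X Y -> exists V, minimal_velocity X Y V.
Proof.
move=> XY incl; have [KX _ _] := XY.
suff /choice[V VP] : forall t, exists V : L2 R, 0 <= t ->
    [/\ has_right_deriv X t V, normal_cone (X t) (Y t - V),
      forall W, normal_cone (X t) W -> Lp_norm V <= Lp_norm (Y t - W) &
      forall eta : R, 0 < eta -> exists2 e : R, 0 < e &
        forall Z, relaxed_normal_cone (X t) e (Y t - Z) ->
          Lp_norm Z <= Lp_norm V + e -> Lp_norm (Z - V) <= eta].
  by exists V.
move=> t; have [t0|t0] := leP 0 t; last by exists 0.
have [V [NV Vmin Vclose]] := minimal_selection (Y t) (KX t t0).
exists V => _; split=> //; apply/has_right_derivP => eta eta0.
have [e e0 eP] := Vclose eta eta0.
have [C C0 CP] := difference_quotient_relaxed XY incl t0.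
have [M M0 MP] := difference_quotient_le XY incl t0 NV.
have CM : 0 < C + M + 1 by rewrite ltr_wpDl// addr_ge0.
apply/near_rightP; exists (Num.min 1 (e / (C + M + 1))).
  by rewrite lt_min ltr01 divr_gt0.
move=> s ts sd; have h0 : 0 < s - t by rewrite subr_gt0.
have : s - t < Num.min 1 (e / (C + M + 1)) by rewrite ltrBlDl.
rewrite lt_min => /andP[/ltW h1]; rewrite ltr_pdivlMr// mulrC => /ltW he.
have Ceh : C * (s - t) <= e.
  by apply: le_trans he; rewrite ler_pM2r// -addrA lerDl addr_ge0.
have Meh : M * (s - t) <= e.
  by apply: le_trans he; rewrite ler_pM2r// -addrA addrCA lerDl addr_ge0.
have := CP (s - t) h0 h1; have := MP (s - t) h0 h1; rewrite subrKC => hM hC.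
have := eP _ (relaxed_normal_coneS Ceh hC).
rewrite L2_normZ gtr0_norm ?invr_gt0// ler_pdivrMl// mulrC => h.
have {}h := h (le_trans hM (ler_wpM2r (ltW h0) (lerD (lexx _) Meh))).
have -> : X s - X t - (s - t) *: V =
    (s - t) *: ((s - t)^-1 *: (X s - X t) - V).
  by rewrite scalerBr scalerA mulfV ?gt_eqF// scale1r.
by rewrite L2_normZ gtr0_norm// mulrC ler_pM2r.
Qed.

(** Two time translates of the solution approach each other up to the variation
    of [Y]; dividing by the translation gives the bound on the speed. *)
Lemma velocity_norm_growth X Y V (T : R) : lipschitz_evolution X Y ->
  minimal_velocity X Y V -> exists2 M : R, 0 <= M &
  forall s t : R, 0 <= s -> s <= t -> t <= T ->
    Lp_norm (V t) <= Lp_norm (V s) + M * (t - s).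
Proof.
move=> XY XYV; have [KX _ _] := XY.
have XV t (t0 : 0 <= t) : has_right_deriv X t (V t) by case: (XYV t t0).
have NV t (t0 : 0 <= t) : normal_cone (X t) (Y t - V t) by case: (XYV t t0).
have [L L0 LP] := lipschitz_bounds (T + 1) XY.
exists L => // s t s0 st tT.
have st0 : 0 <= t - s by rewrite subr_ge0.
have dist h : 0 < h -> h < 1 -> Lp_norm (X (t + h) - X t) <=
    Lp_norm (X (s + h) - X s) + L * h * (t - s).
  move=> h0 h1.
  pose Z r := X (r + h) - X r.
  have ZL r r' : s <= r -> r <= r' -> r' <= t ->
      Lp_norm (Z r' - Z r) <= (L + L) * (r' - r).
    move=> sr rr' r't; rewrite /Z.
    have -> : X (r' + h) - X r' - (X (r + h) - X r) =
      (X (r' + h) - X (r + h)) - (X r' - X r).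
      by apply/LfuneqP => m; rewrite !L2E;
        move: (X (r' + h) m) (X r' m) (X (r + h) m) (X r m) => *; ring.
    rewrite (le_trans (L2_norm_triangle _ _))// L2_normN mulrDl lerD//.
      have [|||h2 _] := LP (r + h) (r' + h); [real_lra|real_lra|real_lra|].
      by rewrite (le_trans h2)//; real_lra.
    by have [|||h2 _] := LP r r'; real_lra.
  have := @sqr_growth R (fun r => Lp_norm (Z r)) s t (L * h) (L + L) set0 st
    (mulr_ge0 L0 (ltW h0)) (fun=> L2_norm_ge0 _) (negligible_set0 _).
  apply; first by move=> r r' sr rr' r't; rewrite (le_trans (L2_dist_dist _ _))// ZL.
  move=> r sr rt _ e e0.
  have r0 : 0 <= r by real_lra.
  have rh0 : 0 <= r + h by real_lra.
  have ZV : has_right_deriv Z r (V (r + h) - V r).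
    apply/has_right_derivP => d d0.
    have /near_rightP[d1 d10 dP1] := (has_right_derivP _ _ _).1 (XV _ r0) _ (half_gt0 d0).
    have /near_rightP[d2 d20 dP2] := (has_right_derivP _ _ _).1 (XV _ rh0) _ (half_gt0 d0).
    apply/near_rightP; exists (Num.min d1 d2); first by rewrite lt_min d10.
    move=> r' rr'; rewrite -ltrBlDl lt_min => /andP[rd1 rd2].
    have := dP1 r' rr' _; have := dP2 (r' + h); rewrite ltrD2r => /(_ rr').
    rewrite (_ : r' + h - (r + h) = r' - r) /Z; last by ring.
    have -> : X (r' + h) - X r' - (X (r + h) - X r) - (r' - r) *: (V (r + h) - V r)
      = (X (r' + h) - X (r + h) - (r' - r) *: V (r + h))
        - (X r' - X r - (r' - r) *: V r).
      by apply/LfuneqP => m; rewrite !L2E;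
        move: (X (r' + h) m) (X r' m) (X (r + h) m) (X r m) (V (r + h) m) (V r m) => *; ring.
    move=> h2 h3; rewrite (le_trans (L2_norm_triangle _ _))// L2_normN.
    have {}h2 := h2 _; have {}h3 := h3 _.
    have := lerD (h2 _) (h3 _); rewrite -mulrDl -splitr; apply; real_lra.
  have := near_sqr_growth (U := 0) (c := L * h * Lp_norm (Z r)) ZV e0 (addr_ge0 L0 L0).
  rewrite subr0 => H.
  under eq_near do rewrite -(subr0 (Z _)).
  apply: H.
    apply/near_rightP; exists (t - r) => [|r' rr' r't]; first real_lra.
    by apply: ZL; real_lra.
  have N1 : L2_inner (Y r - V r) (Z r) <= 0 by apply: NV => //; exact: KX.
  have N2 : 0 <= L2_inner (Y (r + h) - V (r + h)) (Z r).
    exact: normal_cone_ge0 (KX _ r0) (NV _ rh0).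
  have -> : L2_inner (V (r + h) - V r) (Z r) = L2_inner (Y (r + h) - Y r) (Z r)
      - L2_inner (Y (r + h) - V (r + h)) (Z r) + L2_inner (Y r - V r) (Z r).
    by rewrite !(L2_innerBl _ _ (Z r)); generalize_norms; ring.
  have := L2_cauchy_schwarz (Y (r + h) - Y r) (Z r).
  have [|||_] := LP r (r + h); [real_lra|real_lra|real_lra|].
  rewrite addrAC subrr add0r => /(ler_wpM2r (L2_norm_ge0 (Z r))).
  real_lra.
apply/ler_addgt0Pl => e e0.
have /near_rightP[d1 d10 dP1] := (has_right_derivP _ _ _).1 (XV _ s0) _ (half_gt0 e0).
have t0 : 0 <= t by real_lra.
have /near_rightP[d2 d20 dP2] := (has_right_derivP _ _ _).1 (XV _ t0) _ (half_gt0 e0).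
pose h := Num.min (2^-1) (Num.min d1 d2) / 2.
have h00 : 0 < Num.min (2^-1) (Num.min d1 d2) by rewrite !lt_min d10 d20 invr_gt0 ltr0n.
have h0 : 0 < h by rewrite divr_gt0.
have : h < Num.min (2^-1) (Num.min d1 d2) by rewrite /h gtr_pMr// invf_lt1// ltr1n.
rewrite !lt_min => /and3P[h1 hd1 hd2].
have {}h1 : h < 1 by real_lra.
have hE (x : R) : x + h - x = h by rewrite addrAC subrr add0r.
have := dP1 (s + h); rewrite hE ltrDl ltrD2l => /(_ h0 hd1) V1.
have := dP2 (t + h); rewrite hE ltrDl ltrD2l => /(_ h0 hd2) V2.
rewrite -(ler_pM2l h0).
have := L2_norm_triangle (X (t + h) - X t) (- (X (t + h) - X t - h *: V t)).
rewrite L2_normN opprB addrCA subrr addr0 L2_normZ gtr0_norm//.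
have := L2_norm_triangle (X (s + h) - X s - h *: V s) (h *: V s).
rewrite subrK L2_normZ gtr0_norm//.
have := dist h h0 h1; real_lra.
Unshelve. all: by end_near. Qed.

(** [Y t - V s] lies in a relaxed normal cone at [X t], so the strong stability of
    [V t] applies to [V s] as soon as the speed is bounded from above. *)
Lemma velocity_close X Y V t (eta : R) : lipschitz_evolution X Y ->
  minimal_velocity X Y V -> 0 <= t -> 0 < eta -> exists2 d : R, 0 < d &
  forall s : R, 0 <= s -> `|s - t| < d -> Lp_norm (V s) <= Lp_norm (V t) + d ->
    Lp_norm (V s - V t) <= eta.
Proof.
move=> XY XYV t0 eta0; have [KX _ _] := XY.
have NV s (s0 : 0 <= s) : normal_cone (X s) (Y s - V s) by case: (XYV s s0).
have [_ _ _ /(_ _ eta0)[e e0 eP]] := XYV t t0.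
have [L L0 LP] := lipschitz_bounds (t + 1) XY.
pose B := Lp_norm (Y t) + L + Lp_norm (V t) + 1.
have B0 : 0 <= B by rewrite !addr_ge0 ?L2_norm_ge0.
pose C := L + L * Lp_norm (X t) + B * L + 1.
have C0 : 0 < C by rewrite ltr_wpDl// !addr_ge0 ?mulr_ge0 ?L2_norm_ge0.
exists (Num.min 1 (Num.min e (e / C))).
  by rewrite !lt_min ltr01 e0 divr_gt0.
move=> s s0; rewrite lt_min => /andP[st1]; rewrite lt_min => /andP[ste].
rewrite ltr_pdivlMr// mulrC => /ltW stC Vs.
have {}Vs : Lp_norm (V s) <= Lp_norm (V t) + 1 /\ Lp_norm (V s) <= Lp_norm (V t) + e.
  by split; apply: le_trans Vs _; rewrite lerD2l !ge_min lexx ?orbT.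
have [Vs1 Vse] := Vs.
have [XLst YLst] : Lp_norm (X s - X t) <= L * `|s - t| /\
    Lp_norm (Y s - Y t) <= L * `|s - t|.
  move: st1; rewrite ltr_norml => /andP[st2 st3].
  have [ts|st] := leP t s.
    by rewrite ger0_norm ?subr_ge0//; apply: LP; real_lra.
  rewrite ltr0_norm ?subr_lt0// opprB Lp_norm_subC (Lp_norm_subC (Y s)).
  by apply: LP; real_lra.
have st0 : 0 <= `|s - t| by [].
apply: eP Vse; apply: relaxed_normal_coneS stC _ _.
have /(normal_coneP _ (KX _ s0))[N1 N2] := NV _ s0.
have CE : C * `|s - t| = L * `|s - t| + L * `|s - t| * Lp_norm (X t)
  + B * (L * `|s - t|) + `|s - t| by rewrite /C; ring.
have p1 : 0 <= L * `|s - t| by rewrite mulr_ge0.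
have p2 : 0 <= L * `|s - t| * Lp_norm (X t) by rewrite mulr_ge0 ?L2_norm_ge0.
have p3 : 0 <= B * (L * `|s - t|) by rewrite mulr_ge0.
have Ybound U : `|L2_inner (Y t - Y s) U| <= L * `|s - t| * Lp_norm U.
  rewrite (le_trans (L2_cauchy_schwarz_abs _ _))// ler_wpM2r ?L2_norm_ge0//.
  by rewrite Lp_norm_subC.
split=> [U KU|].
  rewrite -(subrKA (Y s)) L2_innerDl.
  apply: (@le_trans _ _ (L * `|s - t| * Lp_norm U + 0)).
    by apply: lerD; [exact: le_trans (ler_norm _) (Ybound U)|exact: N1].
  by rewrite addr0 ler_wpM2r ?L2_norm_ge0//; move: CE; real_lra.
rewrite -(subrKA (Y s)) L2_innerDl.
have := Ybound (X t); rewrite ler_norml => /andP[h1 _].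
have h2 : - (B * (L * `|s - t|)) <= L2_inner (Y s - V s) (X t).
  rewrite -[leRHS]subr0 -N2 -L2_innerBr -[leRHS]opprK lerN2 -L2_innerNr opprB.
  rewrite (le_trans (L2_cauchy_schwarz _ _))// ler_pM ?L2_norm_ge0//.
  have := L2_norm_triangle (Y s - Y t) (Y t - V s); rewrite addrA subrK.
  have := L2_norm_triangle (Y t) (- V s); rewrite L2_normN.
  have : L * `|s - t| <= L by rewrite ler_piMr// ltW.
  rewrite /B; real_lra.
move: CE; real_lra.
Qed.

(** The growth of the speed is bounded from above to the right of [t] only. *)
Lemma velocity_right_continuous X Y V t : lipschitz_evolution X Y ->
  minimal_velocity X Y V -> 0 <= t -> V s @[s --> t^'+] --> V t.
Proof.
move=> XY XYV t0; apply/L2_cvgP => eta eta0.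
have [d d0 dP] := velocity_close XY XYV t0 (half_gt0 eta0).
have [M M0 MP] := velocity_norm_growth (t + 1) XY XYV.
have M1 : 0 < M + 1 by rewrite ltr_wpDl.
apply/near_rightP; exists (Num.min 1 (Num.min d (d / (M + 1)))).
  by rewrite !lt_min ltr01 d0 divr_gt0.
move=> s ts; rewrite -ltrBlDl !lt_min => /and3P[st1 std].
rewrite ltr_pdivlMr// mulrC => /ltW stM.
have st0 : 0 < s - t by rewrite subr_gt0.
apply: (@le_lt_trans _ _ (eta / 2)); last by rewrite gtr_pMr// invf_lt1// ltr1n.
apply: dP; [real_lra|by rewrite gtr0_norm|].
have := MP t s t0 (ltW ts); move=> /(_ _)/le_trans; apply; first real_lra.
by rewrite lerD2l (le_trans _ stM)// ler_pM2r// lerDl.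
Qed.

Lemma velocity_continuous X Y V t : lipschitz_evolution X Y ->
  minimal_velocity X Y V -> 0 < t ->
  Lp_norm (V s) @[s --> t] --> Lp_norm (V t) -> V s @[s --> t] --> V t.
Proof.
move=> XY XYV t0 nV; apply/L2_cvgP => eta eta0.
have [d d0 dP] := velocity_close XY XYV (ltW t0) (half_gt0 eta0).
have [d' d'0 d'P] := (near_nbhsP t _).1 ((cvgrPdist_lt _ _).1 nV d d0).
apply/(near_nbhsP t); exists (Num.min t (Num.min d d')).
  by rewrite !lt_min t0 d0.
move=> s; rewrite !lt_min => /and3P[st std std'].
apply: (@le_lt_trans _ _ (eta / 2)); last by rewrite gtr_pMr// invf_lt1// ltr1n.
apply: dP => //; first by move: st; rewrite ltr_norml => /andP[]; real_lra.
by have := d'P s std'; rewrite ltr_norml => /andP[]; real_lra.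
Qed.

(** On the left of a continuity point of [V] the right derivatives are close to
    [V t], hence so are the left difference quotients. *)
Lemma velocity_continuous_deriv X Y V t : lipschitz_evolution X Y ->
  minimal_velocity X Y V -> 0 < t ->
  V s @[s --> t] --> V t -> has_deriv X t (V t).
Proof.
move=> XY XYV t0 /L2_cvgP cV.
have XV s (s0 : 0 <= s) : has_right_deriv X s (V s) by case: (XYV s s0).
apply/has_derivP => e e0.
have /near_rightP[d1 d10 d1P] := (has_right_derivP _ _ _).1 (XV _ (ltW t0)) e e0.
have [d2 d20 d2P] := (near_nbhsP t _).1 (cV e e0).
exists (Num.min t (Num.min d1 d2)); first by rewrite !lt_min t0 d10.
move=> s; rewrite !lt_min => /and3P[st std1 std2].
have [ts|st'|->] := ltgtP t s.
- have st0 : 0 < s - t by rewrite subr_gt0.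
  by rewrite (gtr0_norm st0) in std1 *; apply: d1P => //; real_lra.
- have st0 : 0 < t - s by rewrite subr_gt0.
  have stE : `|s - t| = t - s by rewrite distrC gtr0_norm.
  rewrite stE in st std1 std2 *.
  have [L L0 LP] := lipschitz_bounds t XY.
  have [f fE] : exists f : R -> R,
      forall r, f r = Lp_norm (X r - X s - (r - s) *: V t).
    by exists (fun r => Lp_norm (X r - X s - (r - s) *: V t)).
  have fL (r r' : R) : s <= r -> r <= r' -> r' <= t ->
      `|f r' - f r| <= (L + Lp_norm (V t)) * (r' - r).
    move=> sr rr' r't; rewrite !fE (le_trans (L2_dist_dist _ _))//.
    have -> : X r' - X s - (r' - s) *: V t - (X r - X s - (r - s) *: V t) =
      (X r' - X r) - (r' - r) *: V t
      by apply/LfuneqP => m; rewrite !L2E;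
        move: (X r' m) (X s m) (X r m) (V t m) => *; ring.
    rewrite (le_trans (L2_norm_triangle _ _))// L2_normN L2_normZ.
    rewrite ger0_norm ?subr_ge0// [leRHS]mulrDl (mulrC (r' - r)) lerD//.
    by have [|||h _] := LP r r'; [real_lra|real_lra|real_lra|exact: h].
  have fs : f s = 0 by rewrite fE subrr (subrr s) scale0r subr0 Lp_norm0.
  have := dini_growth (c := e) (ltW st') (lipschitz_cvg_left fL).
  rewrite fs (subr0 (f t)) fE => H.
  have -> : X s - X t - (s - t) *: V t = - (X t - X s - (t - s) *: V t).
    by apply/LfuneqP => m; rewrite !L2E;
      move: (X s m) (X t m) (V t m) => *; ring.
  rewrite L2_normN; apply: H => r sr rt e' e'0.
  have r0 : 0 <= r by real_lra.
  have := (has_right_derivP _ _ _).1 (XV _ r0) e' e'0.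
  apply: filter_app; near=> r'.
  have rr' : 0 <= r' - r by rewrite subr_ge0; near: r'; exact: nbhs_right_ge.
  move=> h1; rewrite !fE; apply: le_trans (ler_norm _) _; apply: le_trans (L2_dist_dist _ _) _.
  have -> : X r' - X s - (r' - s) *: V t - (X r - X s - (r - s) *: V t) =
    (X r' - X r - (r' - r) *: V r) + (r' - r) *: (V r - V t).
    by apply/LfuneqP => m; rewrite !L2E;
      move: (X r' m) (X s m) (X r m) (V t m) (V r m) => *; ring.
  rewrite (le_trans (L2_norm_triangle _ _))// addrC [leRHS]mulrDl lerD//.
  rewrite L2_normZ ger0_norm// mulrC ler_wpM2r// ltW// d2P//.
  by rewrite ltr0_norm; real_lra.
- by rewrite !subrr scale0r subrr Lp_norm0 normr0 mulr0.
Unshelve. all: by end_near. Qed.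

(** Up to a linear term the speed is nonincreasing, so it has countably many
    discontinuities. *)
Lemma speed_continuous_cocountable X Y V : lipschitz_evolution X Y ->
  minimal_velocity X Y V -> countable [set t : R | 0 < t /\
  ~ (Lp_norm (V s) @[s --> t] --> Lp_norm (V t))].
Proof.
move=> XY XYV; have Vr (t : R) : 0 <= t -> Lp_norm (V s) @[s --> t^'+] --> Lp_norm (V t).
  move=> t0; apply/cvgrPdist_lt => e e0.
  have /L2_cvgP/(_ e e0) := velocity_right_continuous XY XYV t0.
  apply: filterS => s; apply: le_lt_trans; rewrite Lp_norm_subC.
  exact: L2_dist_dist.
pose D (n : nat) := [set t : R | 0 < t < n%:R /\
  ~ (Lp_norm (V s) @[s --> t] --> Lp_norm (V t))].
apply: (@sub_countable _ _ _ (\bigcup_n D n)).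
  apply: subset_card_le => t [t0 Vt]; exists (Num.bound t) => //; split=> //.
  by rewrite t0/=; exact: archi_boundP (ltW t0).
apply: bigcup_countable => // n _.
have [M M0 MP] := velocity_norm_growth n%:R XY XYV.
pose G (t : R) := M * t - Lp_norm (V t).
have ndG : {in `[0, n%:R] &, nondecreasing_fun G}.
  move=> s t; rewrite !in_itv/= => /andP[s0 sn] /andP[t0 tn] st.
  by have := MP s t s0 st tn; rewrite /G; real_lra.
apply: sub_countable (discontinuity_countable ndG).
apply: subset_card_le => t [/andP[t0 tn] Vt]; split; first by rewrite in_itv/= t0.
have Gr : G s @[s --> t^'+] --> G t.
  apply: cvgB; last exact: (Vr _ (ltW t0)).
  by apply: cvgMr; exact: cvg_at_right_filter cvg_id.
have Gl : cvg (G s @[s --> t^'-]).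
  have ndG' : {in `]0, t[ &, {homo G : n m / n <= m}}.
    move=> r r'; rewrite !in_itv/= => /andP[r0 rt] /andP[r'0 r't].
    by apply: ndG; rewrite in_itv/=; apply/andP; split; real_lra.
  apply: (nondecreasing_at_left_is_cvgr (a := t)).
    near=> r => x y; rewrite !in_itv/= => /andP[rx xt] /andP[ry yt].
    have r0 : 0 < r by near: r; exact: nbhs_left_gt.
    by apply: ndG'; rewrite in_itv/=; apply/andP; split; real_lra.
  near=> r; exists (G t) => _ [x /= xI <-].
  have r0 : 0 < r by near: r; exact: nbhs_left_gt.
  by move: xI; rewrite in_itv/= => /andP[rx xt]; apply: ndG; rewrite ?in_itv/=; real_lra.
split=> //; first by apply/cvg_ex; exists (G t).
apply/eqP => GE; apply: Vt.
have Gt : G s @[s --> t] --> G t.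
  apply/left_right_continuousP; split=> //.
  by move: GE; rewrite (cvg_lim _ Gr)// => <-; exact: Gl.
have -> : (fun s => Lp_norm (V s)) = (fun s => M * s - G s).
  by apply/funext => s; rewrite /G subKr.
rewrite (_ : Lp_norm (V t) = M * t - G t); last by rewrite /G subKr.
by apply: cvgB => //; apply: cvgMr; exact: cvg_id.
Unshelve. all: by end_near. Qed.

End evolution.

(** * Bochner primitives *)

Section bochner.
Context {R : realType}.
Implicit Types (U V W : L2 R).

Local Notation lebR := (@lebesgue_measure R).

Lemma L2_inner_suml n (c : 'I_n -> L2 R) (a : 'I_n -> R) U :
  L2_inner (\sum_(i < n) a i *: c i) U = \sum_(i < n) a i * L2_inner (c i) U.
Proof.
elim: n c a => [|n IH] c a; first by rewrite !big_ord0 L2_inner0l.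
by rewrite !big_ord_recr /= L2_innerDl IH L2_innerZl.
Qed.

(** The identity holds for simple functions, and passes to the limit by the
    Cauchy-Schwarz inequality. *)
Lemma bochner_inner (a b : R) (g : R -> L2 R) I U :
  is_bochner_integral a b g I ->
  lebR.-integrable `[a, b] (EFin \o (fun s => L2_inner (g s) U)) ->
  L2_inner I U = \int[lebR]_(s in `[a, b]) L2_inner (g s) U.
Proof.
move=> [k [A [c [mA _ cvN cvS]]]] ig.
set simple := (fun n (s : R) => \sum_(i < k n) \1_(A n i) s *: c n i : L2 R) in cvN.
have mab : measurable (`[a, b]%classic : set (measurableTypeR R)) by [].
have finI (B : set (measurableTypeR R)) : measurable B -> (lebR (B `&` `[a, b]) < +oo)%E.
  move=> mB; apply: (@le_lt_trans _ _ (lebR `[a, b]%classic)).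
    by apply: le_measure; rewrite ?inE//; exact: measurableI.
  by rewrite lebesgue_measure_itv; case: ifP => _; rewrite ltry.
have iind n i : lebR.-integrable `[a, b] (EFin \o \1_(A n i)).
  apply: measurable_bounded_integrable => //.
  - by have := finI setT measurableT; rewrite setTI.
  - exists 1; split=> // M M1 x _ /=; rewrite indicE.
    by case: (x \in A n i); rewrite ?normr1 ?normr0 ?(ltW M1)// (le_trans _ (ltW M1)).
have isimple n : lebR.-integrable `[a, b]
    (EFin \o (fun s => L2_inner (simple n s) U)).
  rewrite (_ : _ \o _ = (fun s =>
      \sum_(i < k n) (L2_inner (c n i) U)%:E * (\1_(A n i) s)%:E)%E).
    by apply: integrable_sum => // i _; apply: (integrableZl mab); exact: iind.
  apply/funext => s /=; rewrite /simple L2_inner_suml sumEFin; congr EFin.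
  by apply: eq_bigr => i _; rewrite mulrC.
have Ssimple n : L2_inner
    (\sum_(i < k n) fine (lebR (A n i `&` `[a, b])) *: c n i) U =
    \int[lebR]_(s in `[a, b]) L2_inner (simple n s) U.
  rewrite L2_inner_suml /Rintegral.
  under eq_integral do rewrite /simple L2_inner_suml -sumEFin.
  rewrite integral_sum//; last first.
    move=> i; apply: (eq_integrable mab (fun s =>
      (L2_inner (c n i) U)%:E * (\1_(A n i) s)%:E)%E) => //.
      by move=> s _; rewrite -EFinM mulrC.
    by apply: (integrableZl mab); exact: iind.
  rewrite [X in fine X](_ : _ =
    (\sum_(i < k n) fine (lebR (A n i `&` `[a, b])) * L2_inner (c n i) U)%:E)//.
  rewrite -sumEFin; apply: eq_bigr => i _.
  under eq_integral do rewrite mulrC EFinM.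
  rewrite (integralZl mab (iind n i)).
  rewrite (_ : (\int[lebR]_(x in `[a, b]) _)%E = lebR (A n i `&` `[a, b])).
    rewrite EFinM muleC; congr (_ * _)%E; apply/esym/fineK.
    by rewrite ge0_fin_numE//; exact: finI.
  exact: integral_indic.
apply/eqP; rewrite -subr_eq0 -normr_le0; apply/ler_addgt0Pl => e e0.
rewrite addr0.
have U1 : 0 < Lp_norm U + 1 by rewrite ltr_wpDl ?L2_norm_ge0.
have d0 : 0 < e / 2 / (Lp_norm U + 1) by rewrite !divr_gt0.
have nearN : \forall n \near \oo, (\int[lebR]_(s in `[a, b])
    (Lp_norm (g s - simple n s))%:E < (e / 2 / (Lp_norm U + 1))%:E)%E.
  have /fine_cvgP[finN /cvgr0Pnorm_lt/(_ _ d0)] := cvN.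
  apply: filterS2 finN => n finN /=; rewrite -lte_fin => h.
  by rewrite -(fineK finN); apply: le_lt_trans h; rewrite lee_fin ler_norm.
have /L2_cvgP/(_ _ d0) nearS := cvS.
near \oo => n.
have hN : (\int[lebR]_(s in `[a, b]) (Lp_norm (g s - simple n s))%:E <
  (e / 2 / (Lp_norm U + 1))%:E)%E by near: n.
have hS : Lp_norm (\sum_(i < k n) fine (lebR (A n i `&` `[a, b])) *: c n i - I) <
  e / 2 / (Lp_norm U + 1) by near: n.
have idiff : lebR.-integrable `[a, b]
    (EFin \o (fun s => L2_inner (g s) U - L2_inner (simple n s) U)).
  apply: (eq_integrable mab ((EFin \o (fun s => L2_inner (g s) U)) \-
    (EFin \o (fun s => L2_inner (simple n s) U)))%E) => //.
  exact: integrableB.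
have h1 : `|\int[lebR]_(s in `[a, b]) L2_inner (g s) U -
    \int[lebR]_(s in `[a, b]) L2_inner (simple n s) U| <= e / 2.
  rewrite -RintegralB//; apply: le_trans (le_normr_Rintegral mab idiff) _.
  pose f s : R := `|L2_inner (g s) U - L2_inner (simple n s) U|.
  have f0 s : 0 <= f s by exact: normr_ge0.
  have i0 : 0 <= (Lp_norm U + 1)^-1 by rewrite invr_ge0 ltW.
  have fi : lebR.-integrable `[a, b] (EFin \o f).
    by have := integrable_norm idiff.
  have : (\int[lebR]_(s in `[a, b]) ((Lp_norm U + 1)^-1%:E * (f s)%:E) <=
      (e / 2 / (Lp_norm U + 1))%:E)%E.
    (* The norm of [g s - simple n s] may fail to be measurable in [s]. *)
    apply: le_trans (ltW hN); apply: ge0_integral_le_nomeas => s _.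
      by rewrite -EFinM lee_fin; exact: mulr_ge0.
    rewrite -EFinM lee_fin ler_pdivrMl// /f -L2_innerBl.
    rewrite (le_trans (L2_cauchy_schwarz_abs _ _))// mulrC.
    by rewrite ler_wpM2r ?L2_norm_ge0// lerDl.
  rewrite integralZl//= -/f => h.
  have fE : (\int[lebR]_(s in `[a, b]) (f s)%:E)%E =
      (\int[lebR]_(s in `[a, b]) f s)%:E.
    by rewrite /Rintegral fineK//; exact: integrable_fin_num fi.
  move: h; rewrite fE -EFinM lee_fin [leRHS]mulrC ler_pM2l// ?invr_gt0//.
have h2 : `|L2_inner I U - \int[lebR]_(s in `[a, b]) L2_inner (simple n s) U| <= e / 2.
  rewrite -Ssimple -L2_innerBl (le_trans (L2_cauchy_schwarz_abs _ _))//.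
  rewrite Lp_norm_subC (le_trans (ler_wpM2r (L2_norm_ge0 U) (ltW hS)))//.
  by rewrite mulrAC ler_pdivrMr// ler_pM2l ?divr_gt0// lerDl.
rewrite distrC in h1.
apply: le_trans (ler_distD (\int[lebR]_(s in `[a, b]) L2_inner (simple n s) U) _ _) _.
by rewrite (le_trans (lerD h2 h1))// -splitr.
Unshelve. all: by end_near. Qed.

Section primitive.
Variables (G Y : R -> L2 R) (Vbar : L2 R).
Hypothesis Gcont : forall t : R, 0 <= t -> forall e : R, 0 < e ->
  exists2 d : R, 0 < d & forall s : R, 0 <= s -> `|s - t| < d ->
    Lp_norm (G s - G t) < e.
Hypothesis YG : forall t : R, 0 <= t -> is_bochner_integral 0 t G (Y t - Vbar).

Lemma primitive_integrable (t : R) U : 0 <= t ->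
  lebR.-integrable `[0, t] (EFin \o (fun s => L2_inner (G s) U)).
Proof.
move=> t0; apply: continuous_compact_integrable; first exact: segment_compact.
apply/subspace_continuousP => s; rewrite /= in_itv/= => /andP[s0 st].
apply/cvgrPdist_lt => e e0.
have U1 : 0 < Lp_norm U + 1 by rewrite ltr_wpDl ?L2_norm_ge0.
have [d d0 dP] := Gcont s0 (divr_gt0 e0 U1).
rewrite near_withinE; apply/(near_nbhsP s); exists d => // r rd.
rewrite /= in_itv/= => /andP[r0 _].
have := dP r r0 rd; rewrite ltr_pdivlMr// => h.
rewrite distrC -L2_innerBl (le_lt_trans (L2_cauchy_schwarz_abs _ _))//.
by rewrite (le_lt_trans _ h)// ler_wpM2l ?L2_norm_ge0// lerDl.
Qed.

Lemma primitive_inner (t : R) U : 0 <= t ->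
  L2_inner (Y t - Vbar) U = \int[lebR]_(s in `[0, t]) L2_inner (G s) U.
Proof. by move=> t0; apply: bochner_inner (YG t0) _; exact: primitive_integrable. Qed.

Lemma primitive_initial : Y 0 = Vbar %[ae leb01 R].
Proof.
apply/L2_dist_eq0P/eqP; rewrite -sqrf_eq0 L2_norm_sq primitive_inner//.
by rewrite set_itv1 Rintegral_set1.
Qed.

(** Duality: the vector to be bounded is tested against itself. *)
Lemma primitive_increment (s t e : R) W : 0 <= s -> s <= t ->
  (forall r, s < r -> r <= t -> Lp_norm (G r - W) <= e) ->
  Lp_norm (Y t - Y s - (t - s) *: W) <= e * (t - s).
Proof.
move=> s0 st Ge; have t0 : 0 <= t by exact: le_trans st.
have ts0 : 0 <= t - s by rewrite subr_ge0.
pose Z := Y t - Y s - (t - s) *: W.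
move: (st); rewrite le_eqVlt => /predU1P[<-|slt].
  by rewrite (subrr (Y s)) !(subrr s) scale0r subrr mulr0 Lp_norm0.
have e0 : 0 <= e := le_trans (L2_norm_ge0 _) (Ge t slt (lexx _)).
have [Z0|Z0] := eqVneq (Lp_norm Z) 0; first by rewrite -/Z Z0 mulr_ge0.
have {}Z0 : 0 < Lp_norm Z by rewrite lt_neqAle eq_sym Z0 L2_norm_ge0.
rewrite -/Z -(ler_pM2r Z0) -expr2 L2_norm_sq {1}/Z.
rewrite L2_innerBl L2_innerZl.
have -> : L2_inner (Y t - Y s) Z =
    \int[lebR]_(r in `]s, t]) L2_inner (G r) Z.
  rewrite (_ : L2_inner _ Z =
    L2_inner (Y t - Vbar) Z - L2_inner (Y s - Vbar) Z); last first.
    by rewrite !(L2_innerBl _ _ Z); ring.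
  rewrite !primitive_inner//.
  by apply: Rintegral_itvB; [exact: primitive_integrable|rewrite bnd_simp..].
have ist : lebR.-integrable `]s, t] (EFin \o (fun r => L2_inner (G r) Z)).
  apply: integrableS (primitive_integrable Z t0) => // r /=.
  by rewrite !in_itv/= => /andP[sr ->]; rewrite (le_trans s0)// ltW.
have : \int[lebR]_(r in `]s, t]) L2_inner (G r) Z <=
    \int[lebR]_(r in `]s, t]) (L2_inner W Z + e * Lp_norm Z).
  apply: le_Rintegral => //; first exact: integrable_cst_itvoc.
  move=> r /=; rewrite in_itv/= => /andP[sr rt].
  rewrite -lerBlDl -L2_innerBl (le_trans (L2_cauchy_schwarz _ _))//.
  by rewrite ler_wpM2r ?L2_norm_ge0// Ge.
rewrite Rintegral_cst//= (_ : fine _ = t - s); last by rewrite [X in fine X](lebesgue_itvoc st).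
rewrite mulrDl; lra.
Qed.

End primitive.

End bochner.

(** * Functions of a monotone map are orthogonal to its normal cone *)

Section normal_cone_orthogonality.
Context {R : realType}.
Implicit Types (U V W X Z : L2 R).

Lemma bounded_mul_L2 U (b : measurableTypeR R -> R) (C : R) :
  measurable_fun setT b -> (forall m, `|b m| <= C) ->
  exists2 Z : L2 R, Z =1 (fun m => b m * U m) & Lp_norm Z <= C * Lp_norm U.
Proof.
move=> mb bC; have C0 : 0 <= C by rewrite (le_trans _ (bC 0)).
have mbU : measurable_fun setT (fun m : measurableTypeR R => b m * U m).
  exact: measurable_funM.
have bU : (fun m => b m * U m : R) \in Lfun (leb01 R) 2%:E.
  apply: Lfun2P => //.
  apply: (le_integrable measurableT (g := fun m => (C ^+ 2)%:E * (U m ^+ 2)%:E)%E).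
  - by apply/measurable_EFinP; exact: measurable_funX.
  - move=> m _; rewrite -EFinM /= lee_fin exprMn.
    have h1 := mulr_ge0 (sqr_ge0 (b m)) (sqr_ge0 (U m)).
    have h2 := mulr_ge0 (sqr_ge0 C) (sqr_ge0 (U m)).
    rewrite (ger0_norm h1) (ger0_norm h2) ler_wpM2r ?sqr_ge0// -[leLHS]real_normK ?num_real//.
    by rewrite ler_pXn2r ?nnegrE.
  - by apply: integrableZl => //; exact: (Lfun2_integrable_sqr (LfunP U)).
exists (Lfun_Sub (lee1n 2) bU) => //.
rewrite -(@ler_pXn2r _ 2)// ?nnegrE ?mulr_ge0 ?L2_norm_ge0//.
rewrite exprMn -lee_fin [leRHS]EFinM -!L2_norm_sqE -ge0_integralZl//; last 3 first.
- by apply/measurable_EFinP; exact: measurable_funX.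
- by move=> m _; rewrite lee_fin sqr_ge0.
- by rewrite lee_fin sqr_ge0.
apply: ge0_integral_le_nomeas => m _; first by rewrite lee_fin sqr_ge0.
rewrite -EFinM lee_fin /= exprMn ler_wpM2r ?sqr_ge0//.
by rewrite -[leLHS]real_normK ?num_real// ler_pXn2r ?nnegrE.
Qed.

Lemma bounded_L2 (b : measurableTypeR R -> R) (C : R) :
  measurable_fun setT b -> (forall m, `|b m| <= C) -> exists Z : L2 R, Z =1 b.
Proof.
move=> mb bC.
have [Z ZE _] := @bounded_mul_L2 unit_L2 b C mb bC.
by exists Z => m; rewrite ZE/= mulr1.
Qed.

Lemma L2_inner_dominated W (u : nat -> L2 R) U Z :
  (\forall m \ae leb01 R, forall n, `|u n m : R| <= `|Z m : R|) ->
  (\forall m \ae leb01 R, u n m @[n --> \oo] --> U m) ->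
  L2_inner W (u n) @[n --> \oo] --> L2_inner W U.
Proof.
move=> uZ uU.
have [|||||_ _] := @dominated_convergence _ _ _ (leb01 R) setT measurableT
  (fun n m => (W m * u n m)%:E) (fun m => (W m * U m)%:E)
  (fun m => `|W m * Z m|%:E).
- by move=> n; exact: (measurable_int (leb01 R) (L2_integrableM _ _)).
- exact: (measurable_int (leb01 R) (L2_integrableM _ _)).
- apply: filterS uU => m um _; apply: cvg_EFin; first exact: nearW.
  exact: cvgMr.
- exact: integrable_norm (L2_integrableM _ _).
- apply: filterS uZ => m um n _; rewrite lee_fin !normrM ler_wpM2l//.
rewrite -(fineK (integrable_fin_num measurableT (L2_integrableM W U))).
by move=> /fine_cvgP[].
Qed.

(** For a small [e], both [X + e psi(X)] and [X - e psi(X)] are monotone, so the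
    inequality that defines the normal cone holds in both directions. *)
Lemma normal_cone_lipschitz_comp X W U (psi : R -> R) (L : R) :
  monotone_cone X -> normal_cone X W ->
  (forall x y, `|psi x - psi y| <= L * `|x - y|) -> U =1 psi \o X ->
  L2_inner W U = 0.
Proof.
move=> KX /(normal_coneP _ KX)[W0 WX] psiL UE.
have L0 : 0 <= L.
  by have := psiL 1 0; rewrite subr0 normr1 mulr1; exact: le_trans.
have L1 : 0 < L + 1 by rewrite ltr_wpDl.
pose a := (L + 1)^-1.
have a0 : 0 < a by rewrite invr_gt0.
have psic := lipschitz_continuous psiL.
have KXU (s : R) : `|s| <= a -> monotone_cone (X + s *: U).
  move=> sa; case: KX => Xm Xr; split=> [m m' mI m'I mm'|m mI].
    have {}mm' := Xm _ _ mI m'I mm'.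
    rewrite !L2E !UE /=.
    have : `|s * (psi (X m) - psi (X m'))| <= `|X m - X m'|.
      rewrite normrM; apply: le_trans (ler_pM _ _ sa (psiL _ _)) _ => //.
      rewrite mulrA ler_piMl// /a ler_pdivrMl// mulr1 lerDl//.
    rewrite (distrC (X m)) (ger0_norm (_ : 0 <= X m' - X m)) ?subr_ge0//.
    by rewrite ler_norml => /andP[_]; real_lra.
  rewrite [X in _ --> X](_ : _ = X m + s * psi (X m)); last by rewrite !L2E UE.
  rewrite (_ : (X + s *: U : R -> R) = (fun r => X r + s * psi (X r))); last first.
    by apply/funext => r; rewrite !L2E UE.
  apply: cvgD; first exact: Xr.
  have psiX : psi (X m') @[m' --> m^'+] --> psi (X m).
    by apply: continuous_cvg; [exact: psic|exact: Xr].
  exact: (cvgMr psiX).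
have aa : `|a| <= a by rewrite gtr0_norm.
have aaN : `|- a| <= a by rewrite normrN gtr0_norm.
have := W0 _ (KXU _ aa); have := W0 _ (KXU _ aaN).
rewrite !L2_innerDr !L2_innerZr WX !add0r mulNr oppr_le0.
rewrite pmulr_rge0// pmulr_rle0// => h1 h2.
by apply/eqP; rewrite eq_le h1 h2.
Qed.

Let ramp (c : R) (n : nat) (x : R) : R :=
  Num.max 0 (Num.min 1 (1 + n%:R * (x - c))).

Let ramp_bound c n x : 0 <= ramp c n x <= 1.
Proof. by rewrite /ramp le_max lexx ge_max ler01 ge_min lexx. Qed.

Let ramp_lipschitz c n x y : `|ramp c n x - ramp c n y| <= n%:R * `|x - y|.
Proof.
rewrite /ramp; have n0 : 0 <= n%:R :> R by exact: ler0n.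
wlog xy : x y / x <= y.
  move=> H; have [xy|/ltW yx] := leP x y; first exact: H.
  by rewrite distrC (distrC x); exact: H.
rewrite (ler0_norm (_ : x - y <= 0)) ?subr_le0// opprB.
have : n%:R * (x - c) <= n%:R * (y - c) by rewrite ler_wpM2l// lerD2r.
have -> : n%:R * (y - x) = n%:R * (y - c) - n%:R * (x - c) by ring.
move: (n%:R * (x - c)) (n%:R * (y - c)) => u v uv.
rewrite ler_norml /Num.max /Num.min; do ![case: ifP] => *; apply/andP; split; lra.
Qed.

Let ramp_cvg c x : ramp c n x @[n --> \oo] --> (\1_(`[c, +oo[%classic) x : R).
Proof.
rewrite indicE; have [cx|xc] := leP c x.
  rewrite mem_set /= ?in_itv/= ?cx//.
  rewrite (_ : (fun n => _) = cst 1); first exact: cvg_cst.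
  apply/funext => n; rewrite /ramp min_l ?max_r// lerDl mulr_ge0//.
  by rewrite subr_ge0.
rewrite memNset; last by rewrite /= in_itv/= leNgt xc.
apply/cvgrPdist_lt => e e0; near=> n.
suff -> : ramp c n x = 0 by rewrite subrr normr0.
rewrite /ramp max_l// ge_min; apply/orP; right.
have cx0 : 0 < c - x by rewrite subr_gt0.
have : 1 <= n%:R * (c - x).
  by rewrite -ler_pdivrMr// div1r; near: n; exact: nbhs_infty_ger.
lra.
Unshelve. all: by end_near. Qed.

Let ramp_comp X c n : exists U : L2 R, U =1 ramp c n \o X.
Proof.
apply: (@bounded_L2 _ 1) => [|m /=].
  apply: measurableT_comp => //; apply: continuous_measurable_fun.
  exact: lipschitz_continuous (ramp_lipschitz c n).
by have /andP[h1 h2] := ramp_bound c n (X m); rewrite ger0_norm.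
Qed.

Let indic_comp X (A : set R) : measurable (A : set (measurableTypeR R)) ->
  exists U : L2 R, U =1 \1_A \o X.
Proof.
move=> mA; apply: (@bounded_L2 _ 1) => [|m /=].
  by apply: (measurableT_comp (f := \1_A : R -> R)).
by rewrite indicE; case: (_ \in _); rewrite ?normr1 ?normr0.
Qed.

Let normal_cone_unit X W : monotone_cone X -> normal_cone X W ->
  L2_inner W unit_L2 = 0.
Proof.
move=> KX NW; apply: (normal_cone_lipschitz_comp (psi := cst 1) (L := 0) KX NW).
  by move=> x y; rewrite subrr normr0 mul0r.
by [].
Qed.

(** The sets [A] such that [W] is orthogonal to [1_A(X)] form a Dynkin system,
    which contains the half lines because ramps are Lipschitz. *)
Lemma normal_cone_indic_comp X W (A : set R) U : monotone_cone X ->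
  normal_cone X W -> measurable (A : set (measurableTypeR R)) ->
  U =1 \1_A \o X -> L2_inner W U = 0.
Proof.
move=> KX NW; have W1 := normal_cone_unit KX NW.
pose P (A : set R) := forall U, U =1 \1_A \o X -> L2_inner W U = 0.
move=> mA; move: U; rewrite -/(P A).
have mE := @RGenCInfty.measurableE R.
move: (mA); rewrite [X in X _ -> _]mE; apply: dynkin_induction => //.
- move=> _ _ [x ->] [y ->]; exists (Num.max x y).
  by apply/seteqP; split=> z /=; rewrite !in_itv/= !andbT ge_max; [case=> -> ->|move=> /andP[]].
- move=> U UE; rewrite -W1; congr L2_inner; apply/LfuneqP => m.
  by rewrite UE /= indicE in_setT.
- move=> _ [c ->] U UE.
  have /choice[u uE] := ramp_comp X c.
  have /cvg_lim <- // : L2_inner W (u n) @[n --> \oo] --> L2_inner W U.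
    apply: (@L2_inner_dominated _ _ _ unit_L2).
      apply/aeW => m n; rewrite uE normr1 /=.
      by have /andP[h1 h2] := ramp_bound c n (X m); rewrite ger0_norm.
    apply/aeW => m; rewrite UE; under eq_fun do rewrite uE.
    exact: ramp_cvg.
  rewrite (_ : (fun n => _) = cst 0) ?lim_cst//.
  by apply/funext => n; exact: normal_cone_lipschitz_comp (ramp_lipschitz c n) (uE n).
- move=> B mB PB U UE.
  have -> : U = unit_L2 - (unit_L2 - U) by rewrite subKr.
  rewrite L2_innerBr W1 sub0r PB ?oppr0// => m.
  rewrite !L2E UE /= !indicE in_setC; case: (_ \in _); rewrite ?subr0 ?subrr//.
- move=> F mF tF PF U UE.
  pose S n := \big[setU/set0]_(i < n) F i.
  have mS n : measurable (S n : set (measurableTypeR R)).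
    by apply: bigsetU_measurable => i _; exact: mF.
  have /choice[u uE] := fun n => indic_comp X (mS n).
  have uP n : L2_inner W (u n) = 0.
    elim: n (u n) (uE n) => [|n IH] v vE.
      rewrite (_ : v = 0) ?L2_inner0r//; apply/LfuneqP => m.
      by rewrite vE /= /S big_ord0 indicE in_set0.
    have [v1 v1E] := indic_comp X (mS n); have [v2 v2E] := indic_comp X (mF n).
    rewrite (_ : v = v1 + v2) ?L2_innerDr ?(IH _ v1E) ?(PF n _ v2E) ?addr0//.
    apply/LfuneqP => m; rewrite L2E vE v1E v2E /= /S big_ord_recr/= !indicE in_setU.
    have [x1|//] := boolP (X m \in _); last by rewrite add0r.
    have [x2|//] := boolP (X m \in F n); last by rewrite addr0.
    move: x1 x2; rewrite !inE -bigcup_mkord => -[i /= iN Fi] Fn.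
    have := tF i n I I (ex_intro _ _ (conj Fi Fn)) => iE.
    by rewrite iE ltnn in iN.
  have /cvg_lim <- // : L2_inner W (u n) @[n --> \oo] --> L2_inner W U.
    apply: (@L2_inner_dominated _ _ _ unit_L2).
      apply/aeW => m n; rewrite uE normr1 /= indicE.
      by case: (_ \in _); rewrite ?normr1 ?normr0.
    apply/aeW => m; rewrite UE; under eq_fun do rewrite uE.
    rewrite /= !indicE; have [|FX] := boolP (X m \in \bigcup_k F k).
      rewrite inE => -[k _ Fk]; apply/cvgrPdist_lt => e e0.
      exists k.+1 => // n /= kn; rewrite indicE mem_set ?subrr ?normr0//.
      by rewrite /S -bigcup_mkord; exists k.
    rewrite (_ : (fun n => _) = cst 0); first exact: cvg_cst.
    apply/funext => n; rewrite indicE memNset//.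
    rewrite /S -bigcup_mkord => -[k _ Fk]; move: FX.
    by rewrite notin_setE; apply; exists k.
  rewrite (_ : (fun n => _) = cst 0) ?lim_cst//.
  by apply/funext => n; exact: uP.
Qed.

(** Subtracting half of the sign of [w] halves the bound on [w] and does not
    change the pairing, the sign being a combination of 1 and an indicator:
    hence the pairing is bounded by every [Lp_norm W * 2^-n]. *)
Lemma normal_cone_bounded_comp X W (w : R -> R) U : monotone_cone X ->
  normal_cone X W -> measurable_fun setT (w : R -> R) ->
  (forall x, `|w x| <= 1) -> U =1 w \o X -> L2_inner W U = 0.
Proof.
move=> KX NW mw w1 UE.
have key n : forall (w : R -> R) U,
    measurable_fun setT (w : R -> R) ->
    (forall x, `|w x| <= 1) -> U =1 w \o X ->
    `|L2_inner W U| <= Lp_norm W * 2^-1 ^+ n.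
  elim: n => [|n IH] {}w {}U {}mw {}w1 {}UE.
    rewrite expr0 mulr1 (le_trans (L2_cauchy_schwarz_abs _ _))//.
    rewrite ler_piMr ?L2_norm_ge0//.
    have mwX : measurable_fun setT (fun m : measurableTypeR R => w (X m)).
      exact: measurableT_comp.
    have [V VE] := bounded_mul_L2 unit_L2 mwX (fun m => w1 (X m)).
    rewrite mul1r unit_L2_norm; congr (Lp_norm _ <= _); apply/LfuneqP => m.
    by rewrite VE UE /= mulr1.
  pose A := w @^-1` `[0, +oo[.
  have mA : measurable (A : set (measurableTypeR R)).
    by rewrite -[A]setTI; apply: mw => //; exact: measurable_itv.
  have [UA UAE] := indic_comp X mA.
  have WA := normal_cone_indic_comp KX NW mA UAE.
  have W1 := normal_cone_unit KX NW.
  have w0 (x : R) : \1_A x = ((0 <= w x)%R)%:R :> R.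
    have [x0|x0] := boolP (0 <= w x)%R.
      by rewrite indicE mem_set// /A /= in_itv/= x0.
    by rewrite indicE memNset// /A /= in_itv/= andbT; exact/negP.
  pose w' (x : R) : R := 2 * w x - (2 * \1_A x - 1).
  have := IH w' (2 *: U - (2 *: UA - unit_L2)).
  rewrite !(L2_innerBr, L2_innerZr) WA W1 mulr0 subr0 subr0.
  rewrite normrM ger0_norm// exprS => h.
  have {}h := h _ _ _; rewrite mulrCA ler_pdivlMl//; apply: h.
  - apply: measurable_funB; first exact: measurable_funM.
    by apply: measurable_funB => //; apply: measurable_funM.
  - move=> x; have := w1 x; rewrite /w' w0 !ler_norml; move: (w x) => y /andP[? ?].
    by case: (leP 0 y) => ? /=; apply/andP; split; lra.
  - by move=> m; rewrite !L2E UE UAE.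
apply/eqP; rewrite -normr_le0; apply/ler_addgt0Pl => e e0; rewrite addr0.
have W1 : 0 < Lp_norm W + 1 by rewrite ltr_wpDl ?L2_norm_ge0.
have small := near_geometric (divr_gt0 e0 W1).
near \oo => n.
apply: le_trans (key n w U mw w1 UE) _.
have : 2 * 2^-1 ^+ n < e / (Lp_norm W + 1) by near: n.
rewrite ltr_pdivlMr// => h; apply: le_trans (ltW h).
have n0 : 0 <= 2^-1 ^+ n :> R by rewrite exprn_ge0.
have := mulr_ge0 n0 (L2_norm_ge0 W); lra.
Unshelve. all: by end_near. Qed.

(** Truncation of the values of [w]. *)
Lemma normal_cone_orthogonal_comp X W (w : R -> R) U : monotone_cone X ->
  normal_cone X W -> measurable_fun setT (w : R -> R) ->
  U = w \o X %[ae leb01 R] -> L2_inner W U = 0.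
Proof.
move=> KX NW mw UE.
pose wn (n : nat) (x : R) : R := \1_(w @^-1` `[- n%:R, n%:R]) x * w x.
have mI n : measurable (w @^-1` `[- n%:R, n%:R] : set R).
  by rewrite -[_ @^-1` _]setTI; apply: mw => //; exact: measurable_itv.
have mwn n : measurable_fun setT (wn n : R -> R).
  by apply: measurable_funM => //; exact: measurable_indic.
have wnE n (x : R) : `|w x| <= n%:R -> wn n x = w x.
  by rewrite ler_norml => h; rewrite /wn indicE mem_set ?mul1r//= in_itv.
have wn0 n (x : R) : ~ (`|w x| <= n%:R) -> wn n x = 0.
  by rewrite ler_norml => h; rewrite /wn indicE memNset ?mul0r//= in_itv.
have wnn n (x : R) : `|wn n x| <= n%:R.
  by have [h|h] := pselect (`|w x| <= n%:R); [rewrite wnE|rewrite wn0// normr0].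
have /choice[u uE] : forall n, exists u : L2 R, u =1 wn n \o X.
  move=> n; apply: (@bounded_L2 _ n%:R) => [|m]; last exact: wnn.
  by apply: measurableT_comp => //; exact: mwn.
have uW n : L2_inner W (u n) = 0.
  have n1 : 0 < n.+1%:R :> R by rewrite ltr0n.
  suff : L2_inner W (n.+1%:R^-1 *: u n) = 0.
    by rewrite L2_innerZr => /eqP; rewrite mulf_eq0 invr_eq0 gt_eqF//= => /eqP.
  apply: (normal_cone_bounded_comp (w := fun x => n.+1%:R^-1 * wn n x) KX NW).
  - exact: measurable_funM.
  - move=> x; rewrite normrM ger0_norm ?invr_ge0// ler_pdivrMl// mulr1.
    by rewrite (le_trans (wnn n x))// ler_nat.
  - by move=> m; rewrite L2E uE.
have /cvg_lim <- // : L2_inner W (u n) @[n --> \oo] --> L2_inner W U.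
  apply: (@L2_inner_dominated _ _ _ U).
    apply: filterS UE => m /(_ I) -> n; rewrite uE /=.
    by have [h|h] := pselect (`|w (X m)| <= n%:R); [rewrite wnE|rewrite wn0// normr0].
  apply: filterS UE => m /(_ I) ->; apply/cvgrPdist_lt => e e0.
  near=> n; rewrite uE /= wnE ?subrr ?normr0//.
  by near: n; exact: nbhs_infty_ger.
rewrite (_ : (fun n => _) = cst 0) ?lim_cst//.
by apply/funext => n; exact: uW.
Unshelve. all: by end_near. Qed.

End normal_cone_orthogonality.

(** * Functions that are constant where a monotone map is constant *)

Section const_on_constancy.
Context {R : realType}.
Implicit Types (U V W X Z : L2 R).

Lemma negligible_countable_bigcup d (T : measurableType d) (I : choiceType)
    (mu : {measure set T -> \bar R}) (D : set I) (F : I -> set T) :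
  countable D -> (forall i, D i -> mu.-negligible (F i)) ->
  mu.-negligible (\bigcup_(i in D) F i).
Proof.
move=> /countable_injP[f fD] FN.
apply: (@negligibleS _ _ _ _ (\bigcup_n \bigcup_(i in [set i | D i /\ f i = n]) F i)).
  by move=> x [i Di Fi]; exists (f i) => //; exists i.
apply: negligible_bigcup => n.
have [[i [Di fi]]|noi] := pselect (exists i, D i /\ f i = n).
  apply: negligibleS (FN i Di) => x [j [Dj fj] Fj].
  by rewrite (_ : i = j)//; apply: fD; rewrite ?inE// fi.
apply: negligibleS (negligible_set0 _) => x [i [Di fi] _].
by apply: noi; exists i.
Qed.

Lemma unit_measureE (A : set R) :
  leb01 R A = @lebesgue_measure R (A `&` `]0, 1[).
Proof. by []. Qed.

Lemma unit_measure_itvoo (a b : R) : 0 <= a -> a <= b -> b <= 1 ->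
  leb01 R `]a, b[%classic = (b - a)%:E.
Proof.
move=> a0 ab b1; rewrite unit_measureE.
rewrite setIidl; last first.
  by move=> x /=; rewrite !in_itv/= => /andP[ax xb]; apply/andP; split; lra.
move: ab; rewrite le_eqVlt => /predU1P[->|ab].
  by rewrite set_itvoo0 measure0 subrr.
by rewrite lebesgue_measure_itv/= lte_fin ab.
Qed.

Lemma unit_measure_set1 (x : R) : leb01 R [set x] = 0%E.
Proof.
apply/eqP; rewrite eq_le measure_ge0 andbT.
apply: (@le_trans _ _ (@lebesgue_measure R [set x])).
  rewrite unit_measureE; apply: le_measure; rewrite ?inE//.
  exact: measurableI.
by rewrite lebesgue_measure_set1.
Qed.

Lemma ae_unit_interval : \forall m \ae leb01 R, (0 < m < 1 :> bool).
Proof.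
exists (~` `]0, 1[%classic); split; first exact: measurableC.
- by rewrite unit_measureE setICl measure0.
- by move=> m /= h; rewrite in_itv.
Qed.

Lemma unit_measure_le_sub (A B : set R) :
  measurable (A : set (measurableTypeR R)) ->
  measurable (B : set (measurableTypeR R)) ->
  (forall m : R, 0 < m -> m < 1 -> A m -> B m) ->
  (leb01 R A <= leb01 R B)%E.
Proof.
move=> mA mB AB; rewrite !unit_measureE; apply: le_measure.
- by rewrite inE; exact: measurableI.
- by rewrite inE; exact: measurableI.
- by move=> m /= [Am]; rewrite in_itv/= => /andP[m0 m1]; split; [exact: AB|rewrite m0].
Qed.

(** The level set of [X] at the height [x] is, up to its endpoints, the interval
    between the values at [x] of the two distribution functions of [X]. *)
Definition cdf_open X (x : R) : R := fine (law X `]-oo, x[%classic).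
Definition cdf_closed X (x : R) : R := fine (law X `]-oo, x]%classic).

Section level_sets.
Variable X : L2 R.
Hypothesis KX : monotone_cone X.

Let mpre (A : set R) : measurable (A : set (measurableTypeR R)) ->
  measurable (X @^-1` A : set (measurableTypeR R)).
Proof. by move=> mA; rewrite -[_ @^-1` _]setTI; exact: measurable_funPT. Qed.

Let cdf_openE x : (cdf_open X x)%:E = leb01 R (X @^-1` `]-oo, x[%classic).
Proof. by rewrite fineK// fin_num_measure//; exact: mpre. Qed.

Let cdf_closedE x : (cdf_closed X x)%:E = leb01 R (X @^-1` `]-oo, x]%classic).
Proof. by rewrite fineK// fin_num_measure//; exact: mpre. Qed.

Let cdf01 : (forall x, 0 <= cdf_open X x) * (forall x, cdf_closed X x <= 1).
Proof.
split=> x; first by rewrite fine_ge0.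
by rewrite -lee_fin cdf_closedE probability_le1//; exact: mpre.
Qed.

Lemma cdf_open_nondecreasing : {homo cdf_open X : x y / x <= y}.
Proof.
move=> x y xy; rewrite -lee_fin !cdf_openE.
apply: le_measure; rewrite ?inE//; [exact: mpre|exact: mpre|].
by move=> m /=; rewrite !in_itv/= => /lt_le_trans -> //.
Qed.

Let lt_of_value (r m : R) : 0 < r -> r < 1 -> 0 < m -> m < 1 -> X r < X m ->
  r < m.
Proof.
move=> r0 r1 m0 m1; rewrite !ltNge; apply: contra => mr.
by apply: KX.1 mr; rewrite in_itv/= ?m0 ?r0.
Qed.

Let measure_le (A : set R) (m : R) : measurable (A : set (measurableTypeR R)) ->
  0 < m -> m < 1 -> (forall r : R, 0 < r -> r < 1 -> A (X r) -> r < m) ->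
  (leb01 R (X @^-1` A) <= m%:E)%E.
Proof.
move=> mA m0 m1 Am.
rewrite -[leRHS](_ : leb01 R `]0, m[%classic = _); last first.
  by rewrite unit_measure_itvoo ?subr0// ltW.
apply: unit_measure_le_sub => //; first exact: mpre.
by move=> r r0 r1 /=; rewrite in_itv/= r0; exact: Am.
Qed.

Let measure_ge (A : set R) (m : R) : measurable (A : set (measurableTypeR R)) ->
  0 < m -> m < 1 -> (forall r : R, X r <= X m -> A (X r)) ->
  (m%:E <= leb01 R (X @^-1` A))%E.
Proof.
move=> mA m0 m1 Am.
rewrite -[leLHS](_ : leb01 R `]0, m[%classic = _); last first.
  by rewrite unit_measure_itvoo ?subr0// ltW.
apply: unit_measure_le_sub => //; first exact: mpre.
move=> r r0 r1 /=; rewrite in_itv/= r0/= => rm; apply: Am.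
by apply: KX.1 (ltW rm); rewrite in_itv/= ?m0 ?r0.
Qed.

Lemma cdf_open_le (m : R) x : 0 < m -> m < 1 -> x <= X m -> cdf_open X x <= m.
Proof.
move=> m0 m1 xXm; rewrite -lee_fin cdf_openE; apply: measure_le => // r r0 r1.
by rewrite /= in_itv/= => Xr; apply: lt_of_value => //; exact: lt_le_trans xXm.
Qed.

Lemma cdf_closed_ge (m : R) x : 0 < m -> m < 1 -> X m <= x -> m <= cdf_closed X x.
Proof.
move=> m0 m1 xXm; rewrite -lee_fin cdf_closedE; apply: measure_ge => // r rm.
by rewrite /= in_itv/= (le_trans rm).
Qed.

Lemma cdf_open_ge (m : R) x : 0 < m -> m < 1 -> X m < x -> m <= cdf_open X x.
Proof.
move=> m0 m1 xXm; rewrite -lee_fin cdf_openE; apply: measure_ge => // r rm.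
by rewrite /= in_itv/= (le_lt_trans rm).
Qed.

Lemma cdf_closed_le (m : R) x : 0 < m -> m < 1 -> x < X m -> cdf_closed X x <= m.
Proof.
move=> m0 m1 xXm; rewrite -lee_fin cdf_closedE; apply: measure_le => // r r0 r1.
by rewrite /= in_itv/= => Xr; apply: lt_of_value => //; exact: le_lt_trans xXm.
Qed.

Lemma level_set_itv (x m : R) : m \in `]cdf_open X x, cdf_closed X x[ ->
  [/\ 0 < m, m < 1 & X m = x].
Proof.
rewrite in_itv/= => /andP[mo mc].
have m0 : 0 < m by exact: le_lt_trans (cdf01.1 x) mo.
have m1 : m < 1 by exact: lt_le_trans mc (cdf01.2 x).
split=> //; apply/eqP; rewrite eq_le; apply/andP; split.
  by rewrite leNgt; apply/negP => /(cdf_closed_le m0 m1); lra.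
by rewrite leNgt; apply/negP => /(cdf_open_ge m0 m1); lra.
Qed.

Lemma level_set_constancy (x : R) :
  `]cdf_open X x, cdf_closed X x[ `<=` constancy_set X.
Proof.
move=> m mI; have [m0 m1 Xm] := level_set_itv mI; split; first by rewrite m0.
have : nbhs m `]cdf_open X x, cdf_closed X x[%classic.
  by apply: open_nbhs_nbhs; split => //; exact: interval_open.
by apply: filterS => r /level_set_itv[_ _ ->].
Qed.

Let atoms := [set x : R | cdf_open X x < cdf_closed X x].

(** The level sets of positive measure contain disjoint open intervals. *)
Let countable_atoms : countable atoms.
Proof.
apply: (@separated_open_countable _ _
  (fun x => if cdf_open X x < cdf_closed X x
            then `]cdf_open X x, cdf_closed X x[%classic else setT)).
- by move=> x; case: ifP => _; [exact: interval_open|exact: openT].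
- move=> x; case: ifPn => [xx|_]; last by exists 0.
  by exists ((cdf_open X x + cdf_closed X x) / 2); rewrite /= in_itv/=; apply/andP; split; lra.
- move=> x y xx yy [m []]; rewrite !ifT//.
  by move=> /level_set_itv[_ _ <-] /level_set_itv[_ _ ->].
Qed.

(** On a level set of positive measure take the constant value of [U]; elsewhere
    the distribution function inverts [X]. *)
Lemma const_on_constancy_factor U : const_on_constancy X U ->
  exists2 w : R -> R, measurable_fun setT w & U = w \o X %[ae leb01 R].
Proof.
move=> HU.
have /choice[c cP] : forall x, exists c : R, \forall m \ae leb01 R,
    `]cdf_open X x, cdf_closed X x[%classic m -> U m = c.
  by move=> x; apply: HU; exact: level_set_constancy.
pose w x := if cdf_open X x < cdf_closed X x then c x else U (cdf_open X x).
have matoms : measurable (atoms : set R) by exact: countable_measurable.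
have mU : measurable_fun setT (fun x : R => U (cdf_open X x)).
  have mU : measurable_fun setT (U : R -> R) := measurable_funPT U.
  apply: (measurableT_comp mU).
  by apply: nondecreasing_measurable => //; exact: cdf_open_nondecreasing.
exists w.
  move=> _ B mB; rewrite setTI.
  rewrite (_ : w @^-1` B = ((fun x : R => U (cdf_open X x)) @^-1` B `\` atoms)
      `|` (w @^-1` B `&` atoms)).
    apply: measurableU.
      by apply: measurableD => //; rewrite -[_ @^-1` _]setTI; exact: mU.
    apply: countable_measurable => //.
    by apply: sub_countable countable_atoms; apply: subset_card_le => x [].
  apply/seteqP; split => x /=; rewrite /w /atoms /=.
    by case: ifPn => xx h; [right|left]; split=> //; exact/negP.
  by case=> [[h /negP/negbTE ->]|[]].
pose N x := [set m | ~ (`]cdf_open X x, cdf_closed X x[%classic m -> U m = c x)]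
  `|` [set cdf_open X x; cdf_closed X x].
have N0 : (leb01 R).-negligible (\bigcup_(x in atoms) N x).
  apply: negligible_countable_bigcup => // x _; apply: negligibleU; first exact: cP.
  apply: negligibleU; apply/negligibleP => //; exact: unit_measure_set1.
have [M [mM M0 NM]] := N0.
move: ae_unit_interval => [M' [mM' M'0 M'P]].
exists (M `|` M'); split; first exact: measurableU.
  by apply: null_set_setU.
move=> m /= UwX; apply: contrapT => /not_orP[MnN M'n]; apply: UwX => _.
have /andP[m0 m1] : 0 < m < 1 by apply: contrapT => h; apply: M'n; exact: M'P.
have xo : cdf_open X (X m) <= m by exact: cdf_open_le.
have xc : m <= cdf_closed X (X m) by exact: cdf_closed_ge.
rewrite /w /=; case: ifPn => [xx|]; last first.
  by rewrite -leNgt => cx; congr (U _); apply/eqP; rewrite eq_le xo (le_trans xc).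
have Nm : ~ N (X m) m by move=> h; apply: MnN; apply: NM; exists (X m).
move/not_orP : Nm => [/contrapT h /not_orP[mo mc]]; apply: h.
rewrite /= in_itv/= !lt_neqAle xo xc !andbT; apply/andP; split; apply/eqP.
  by move=> h; apply: mo.
by move=> h; apply: mc.
Qed.

End level_sets.

End const_on_constancy.

Section velocity_const_on_constancy.
Context {R : realType}.
Implicit Types (U V W : L2 R).

(** A locally constant function has zero right Dini derivatives. *)
Lemma constancy_const (X : L2 R) (a b r s : R) :
  monotone_cone X -> `]a, b[ `<=` constancy_set X ->
  a < r -> r <= s -> s < b -> X r = X s.
Proof.
move=> [Xm _] ab ar rs sb.
have loc t : r <= t -> t <= s -> \forall t' \near t, X t' = X t.
  by move=> rt ts; have [|//] := ab t; rewrite /= in_itv/=; apply/andP; split; real_lra.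
have [|r01 _] := ab r; first by rewrite /= in_itv/=; apply/andP; split; real_lra.
have [|s01 _] := ab s; first by rewrite /= in_itv/=; apply/andP; split; real_lra.
apply/eqP; rewrite eq_le Xm ?in_itv//=.
have := @dini_growth R X r s 0 rs; rewrite mul0r subr_le0; apply.
  move=> t rt ts; apply/cvgrPdist_lt => e e0.
  rewrite /at_left near_withinE; apply: filterS (loc t (ltW rt) ts) => t' -> _.
  by rewrite subrr normr0.
move=> t rt ts e e0; rewrite /at_right near_withinE.
apply: filterS (loc t rt (ltW ts)) => t' -> tt'.
by rewrite subrr add0r mulr_ge0// ?ltW// subr_gt0.
Qed.

(** Where [X t] is constant the difference quotients are nondecreasing on the
    right of [t] and nonincreasing on the left. *)
Lemma deriv_const_on_constancy (X : R -> L2 R) (t : R) V : 0 < t ->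
  (forall s : R, 0 <= s -> monotone_cone (X s)) -> has_deriv X t V ->
  const_on_constancy (X t) V.
Proof.
move=> t0 KX XV a b abX.
(* Increments for which [t - h n] remains nonnegative. *)
pose h (n : nat) : R := Num.min 1 t * n.+1%:R^-1.
have t1 : 0 < Num.min 1 t by rewrite lt_min ltr01.
have h0 n : 0 < h n by rewrite mulr_gt0.
have ht n : h n <= t.
  have n1 : n.+1%:R^-1 <= 1 :> R by rewrite invf_le1 ?ltr0n// ler1n.
  apply: (@le_trans _ _ (Num.min 1 t)); last by rewrite ge_min lexx orbT.
  by rewrite /h ler_piMr// ltW.
have hcvg (sgn : R) : sgn != 0 -> `|sgn| <= 1 ->
    (sgn * h n)^-1 *: (X (t + sgn * h n) - X t) @[n --> \oo] --> V.
  move=> sgn0 sgn1; apply/L2_cvgP => e e0.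
  move: XV => /L2_cvgP/(_ e e0)/near_dnbhsP[d d0 dP].
  have hsmall : h n @[n --> \oo] --> (Num.min 1 t * 0 : R).
    by apply: cvgMr; exact: cvg_harmonic.
  move: hsmall; rewrite mulr0 => /cvgr0Pnorm_lt/(_ d d0); apply: filterS => n hn.
  apply: dP; first by rewrite mulf_neq0// gt_eqF.
  by rewrite subr0 normrM (le_lt_trans _ hn)// ler_piMl.
have [|phi phin Vr] := L2_cvg_ae_subseq (hcvg 1 (oner_neq0 _) _).
  by rewrite normr1.
have [||psi psin Vl] := L2_cvg_ae_subseq (hcvg (-1) _ _).
- by rewrite oppr_eq0 oner_neq0.
- by rewrite normrN1.
(* Almost all the points of the interval: those where the quotients of both
   sides converge along the chosen subsequences. *)
pose E := [set m : R | `]a, b[%classic m /\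
  (1 * h (phi n))^-1 * (X (t + 1 * h (phi n)) m - X t m) @[n --> \oo] --> (V m : R) /\
  (-1 * h (psi n))^-1 * (X (t + -1 * h (psi n)) m - X t m) @[n --> \oo] --> (V m : R)].
have VE m m' : E m -> E m' -> m <= m' -> V m = V m'.
  move=> [+ [mr ml]] [+ [m'r m'l]] mm'.
  rewrite /= !in_itv/= => /andP[am mb] /andP[am' m'b].
  have XE := constancy_const (KX t (ltW t0)) abX am mm' m'b.
  have [|m01 _] := abX m; first by rewrite /= in_itv/= am.
  have [|m'01 _] := abX m'; first by rewrite /= in_itv/= am'.
  have mono s : 0 <= s -> X s m <= X s m'.
    by move=> s0; apply: (KX s s0).1; rewrite ?in_itv.
  apply/eqP; rewrite eq_le; apply/andP; split.
    rewrite -(cvg_lim _ mr)// -(cvg_lim _ m'r)//; apply: ler_lim.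
    - exact: cvgP mr.
    - exact: cvgP m'r.
    - apply: nearW => n; rewrite mul1r ler_pM2l ?invr_gt0// XE lerD2r mono//.
      by rewrite addr_ge0// ltW.
  rewrite -(cvg_lim _ ml)// -(cvg_lim _ m'l)//; apply: ler_lim.
  - exact: cvgP m'l.
  - exact: cvgP ml.
  - apply: nearW => n; rewrite mulN1r invrN !mulNr lerN2.
    by rewrite ler_pM2l ?invr_gt0// XE lerD2r mono// subr_ge0.
have [[m0 Em0]|noE] := pselect (exists m, E m).
  exists (V m0); apply: filterS2 Vr Vl => m mr ml mI.
  have Em : E m by [].
  by have [mm0|m0m] := leP m m0; [exact: VE|apply/esym/VE => //; exact: ltW].
exists 0; apply: filterS2 Vr Vl => m mr ml mI.
by exfalso; apply: noE; exists m.
Qed.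

Lemma normal_cone_orthogonal (X W U : L2 R) : monotone_cone X ->
  normal_cone X W -> const_on_constancy X U -> L2_inner W U = 0.
Proof.
move=> KX NW /(const_on_constancy_factor KX)[w mw UE].
exact: (normal_cone_orthogonal_comp KX NW mw UE).
Qed.

Lemma const_on_constancy_velocity (X V : L2 R) : monotone_cone X ->
  const_on_constancy X V -> exists w, is_velocity X V w.
Proof.
move=> KX /(const_on_constancy_factor KX)[w mw VE]; exists w; split=> //.
have mwX2 : measurable_fun setT (fun m : measurableTypeR R => w (X m) ^+ 2).
  by apply: measurable_funX; exact: measurableT_comp.
apply: Lfun2P => //; apply: (integrable_pushforward (phi := X)) => //.
  by apply/measurable_EFinP; exact: measurable_funX.
rewrite preimage_setT; apply/integrableP; split; first exact/measurable_EFinP.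
have /integrableP[_] := Lfun2_integrable_sqr (LfunP V).
rewrite (ae_eq_integral (fun m => `|(w (X m) ^+ 2)%:E|%E)) //.
- apply: measurableT_comp => //; apply/measurable_EFinP.
  exact: measurable_funX.
- by apply: measurableT_comp => //; exact/measurable_EFinP.
- by apply: filterS VE => m /(_ I) /= -> _.
Qed.

Lemma velocity_measurable (X V : L2 R) (w : R -> R) : is_velocity X V w ->
  measurable_fun setT (w : R -> R).
Proof. by move=> [+ _]; rewrite inE => /andP[+ _]; rewrite inE. Qed.

Lemma velocity_unique (X V : L2 R) (w w' : R -> R) :
  is_velocity X V w -> is_velocity X V w' -> w = w' %[ae law X].
Proof.
move=> wV w'V; have mw := velocity_measurable wV.
have mw' := velocity_measurable w'V; have [_ Vw] := wV; have [_ Vw'] := w'V.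
pose A := [set x | w x <> w' x].
have mA : measurable (A : set R).
  rewrite (_ : A = ((w \- w') @^-1` (~` [set 0]))).
    rewrite -[_ @^-1` _]setTI; apply: measurable_funB => //.
    exact: measurableC.
  apply/seteqP; split=> x /=; rewrite /A/= => h; first by move/eqP; rewrite subr_eq0 => /eqP.
  by move=> ww; apply: h; rewrite ww subrr.
exists A; split=> //; last by move=> x /= h ww; apply: h.
apply: (@measure_negligible _ _ _ (leb01 R) (X @^-1` A)).
  by rewrite -[_ @^-1` _]setTI; exact: measurable_funPT.
have [N1 [mN1 N10 N1P]] := Vw; have [N2 [mN2 N20 N2P]] := Vw'.
exists (N1 `|` N2); split; [exact: measurableU|exact: null_set_setU|].
move=> m /= Am; apply: contrapT => /not_orP[n1 n2]; apply: Am.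
have h1 : V m = w (X m) by apply: contrapT => h; apply: n1; apply: N1P => /= /(_ I).
have h2 : V m = w' (X m) by apply: contrapT => h; apply: n2; apply: N2P => /= /(_ I).
by rewrite -h1.
Qed.

(** The residual is normal, hence orthogonal to the whole subspace. *)
Lemma projection_const_on_constancy (X Y V : L2 R) : monotone_cone X ->
  normal_cone X (Y - V) -> const_on_constancy X V ->
  is_projection (const_on_constancy X) Y V.
Proof.
move=> KX NV HV; split=> // W HW.
rewrite -(@ler_pXn2r _ 2)// ?nnegrE ?L2_norm_ge0//.
rewrite -[Y - W](subrKA V) [leRHS]L2_norm_sq_add L2_innerBr.
by rewrite !(normal_cone_orthogonal KX NV)// subrr mulr0 addr0 lerDl sqr_ge0.
Qed.

Lemma tangent_coneP (X V : L2 R) : tangent_cone X V <-> forall e : R, 0 < e ->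
  exists theta X', [/\ 0 <= theta, monotone_cone X' &
    Lp_norm (V - theta *: (X' - X)) < e].
Proof.
split=> [TV e e0|h B].
  have : nbhs V (ball V e) by exact: nbhsx_ballx.
  by move=> /TV[_ [[theta /= th0 [X' KX' <-]]]] h; exists theta, X'.
rewrite -nbhs_ballE => -[e /= e0 eB].
have [theta [X' [th0 KX' XV]]] := h e e0.
by exists (theta *: (X' - X)); split; [exists theta => //; exists X'|exact: eB].
Qed.

(** Moreau's decomposition: the residual is polar to the tangent cone and, by
    minimality, orthogonal to [V]. *)
Lemma projection_tangent_cone (X Y V : L2 R) : monotone_cone X ->
  tangent_cone X V -> normal_cone X (Y - V) ->
  (forall W, normal_cone X W -> Lp_norm V <= Lp_norm (Y - W)) ->
  is_projection (tangent_cone X) Y V.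
Proof.
move=> KX TV NV Vmin; split=> // W TW.
have polar Z : tangent_cone X Z -> L2_inner (Y - V) Z <= 0.
  move=> /tangent_coneP TZ; apply/ler_addgt0Pl => e e0; rewrite addr0.
  have P1 : 0 < Lp_norm (Y - V) + 1 by rewrite ltr_wpDl ?L2_norm_ge0.
  have [theta [X' [th0 KX']]] := TZ _ (divr_gt0 e0 P1).
  rewrite ltr_pdivlMr// => h.
  rewrite -(subrK (theta *: (X' - X)) Z) L2_innerDr L2_innerZr.
  rewrite -[leRHS]addr0 lerD//.
    rewrite (le_trans (L2_cauchy_schwarz _ _))// mulrC.
    by rewrite (le_trans _ (ltW h))// ler_wpM2l ?L2_norm_ge0// lerDl.
  by rewrite mulr_ge0_le0// NV.
(* A slightly shorter multiple of the residual would improve on [V] if the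
   inner product were negative. *)
have YVV : L2_inner (Y - V) V = 0.
  apply/eqP; rewrite eq_le polar//=; rewrite leNgt; apply/negP => neg.
  pose a := L2_inner (Y - V) V.
  have q0 : 0 <= Lp_norm (Y - V) ^+ 2 by exact: sqr_ge0.
  have q1 : 0 < Lp_norm (Y - V) ^+ 2 + 1 by rewrite ltr_wpDl.
  pose s := Num.min 1 (- a / (Lp_norm (Y - V) ^+ 2 + 1)).
  have s0 : 0 < s by rewrite lt_min ltr01 divr_gt0// oppr_gt0.
  have s1 : s <= 1 by rewrite ge_min lexx.
  have sP : s * Lp_norm (Y - V) ^+ 2 <= - a.
    apply: (@le_trans _ _ (s * (Lp_norm (Y - V) ^+ 2 + 1))).
      by rewrite ler_pM2l// lerDl.
    by rewrite -ler_pdivlMr// ge_min lexx orbT.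
  have : normal_cone X ((1 - s) *: (Y - V)).
    by move=> X' KX'; rewrite L2_innerZl mulr_ge0_le0 ?subr_ge0// NV.
  move=> /Vmin.
  have -> : Y - (1 - s) *: (Y - V) = V + s *: (Y - V).
    by apply/LfuneqP => m; rewrite !L2E;
      move: (Y m) (V m) => *; ring.
  rewrite -(@ler_pXn2r _ 2)// ?nnegrE ?L2_norm_ge0//.
  rewrite L2_norm_sq_add L2_innerZr (L2_innerC V) -/a L2_normZ exprMn.
  rewrite (gtr0_norm s0) expr2 -mulrA -addrA lerDl mulrCA -mulrDr pmulr_rge0//.
  move: neg; rewrite -/a; real_lra.
rewrite -(@ler_pXn2r _ 2)// ?nnegrE ?L2_norm_ge0//.
rewrite -[Y - W](subrKA V) [leRHS]L2_norm_sq_add L2_innerBr YVV sub0r.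
have := polar W TW; have := sqr_ge0 (Lp_norm (V - W)); real_lra.
Qed.

End velocity_const_on_constancy.

(** * Dominated multipliers, primitives and null modifications *)

Section multipliers.
Context {R : realType}.
Implicit Types (U V W X Z P : L2 R).

Lemma L2_dominated_null (u : nat -> L2 R) U (C : R) :
  (forall n m, `|u n m| <= C * `|U m|) ->
  (\forall m \ae leb01 R, u n m @[n --> \oo] --> (0 : R)) ->
  Lp_norm (u n) @[n --> \oo] --> (0 : R).
Proof.
move=> uU u0.
have uP m : `|U m| ^+ 2 = U m ^+ 2 by rewrite real_normK ?num_real.
have [|||||_ _] := @dominated_convergence _ _ _ (leb01 R) setT measurableT
  (fun n m => (u n m ^+ 2)%:E) (cst 0%E) (fun m => (C ^+ 2)%:E * (U m ^+ 2)%:E)%E.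
- by move=> n; apply/measurable_EFinP; exact: measurable_funX.
- exact: measurable_cst.
- apply: filterS u0 => m um _; apply: cvg_EFin; first exact: nearW.
  by rewrite /= -[X in _ --> X](mul0r (0 : R)); exact: cvgM.
- by apply: integrableZl => //; exact: Lfun2_integrable_sqr (LfunP U).
- apply: aeW => m n _; rewrite -EFinM /= lee_fin ger0_norm ?sqr_ge0//.
  rewrite -uP -exprMn -[leLHS]real_normK ?num_real//.
  by rewrite ler_pXn2r ?nnegrE// (le_trans _ (uU n m)).
rewrite integral_cst// mul0e => /fine_cvgP[_] u2.
have {}u2 : Lp_norm (u n) ^+ 2 @[n --> \oo] --> (0 : R).
  apply: cvg_trans u2; apply: near_eq_cvg; apply: nearW => n /=.
  by rewrite L2_norm_sqE.
apply/cvgr0Pnorm_lt => e e0.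
have e20 : 0 < e ^+ 2 by rewrite exprn_gt0.
move/cvgr0Pnorm_lt/(_ _ e20) : u2; apply: filterS => n.
rewrite ger0_norm ?sqr_ge0// ger0_norm ?L2_norm_ge0// => h.
by rewrite -(@ltr_pXn2r _ 2)// ?nnegrE ?L2_norm_ge0// ltW.
Qed.

(** A bounded multiplier of [U] that vanishes as [Z m] tends to [X m] is small
    in L2 when [Z] is close to [X]: otherwise dominated convergence along an
    almost everywhere convergent subsequence gives a contradiction. *)
Lemma small_multiplier (beta : R -> R -> R) (C : R) U X (e : R) :
  (forall x z, 0 <= beta x z <= C) ->
  (forall x, beta x z @[z --> x] --> (0 : R)) -> 0 < e ->
  exists2 d : R, 0 < d & forall Z P, Lp_norm (Z - X) < d ->
    (forall m, `|P m| <= beta (X m) (Z m) * `|U m|) -> Lp_norm P < e.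
Proof.
move=> bC b0 e0; apply: contrapT => noD.
have /choice[ZP ZPP] : forall n : nat, exists ZP : L2 R * L2 R,
    [/\ Lp_norm (ZP.1 - X) < n.+1%:R^-1,
        forall m, `|ZP.2 m| <= beta (X m) (ZP.1 m) * `|U m| & e <= Lp_norm ZP.2].
  move=> n; apply: contrapT => noZP; apply: noD; exists n.+1%:R^-1.
    by rewrite invr_gt0 ltr0n.
  move=> Z P ZX PU; rewrite ltNge; apply/negP => eP; apply: noZP.
  by exists (Z, P).
have ZX : (ZP n).1 @[n --> \oo] --> X.
  apply/L2_cvgP => d d0; have := @cvg_harmonic R.
  move=> /cvgr0Pnorm_lt/(_ _ d0); apply: filterS => n /=.
  rewrite ger0_norm ?invr_ge0//; apply: lt_trans.
  by have [] := ZPP n.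
have [phi _ Zae] := L2_cvg_ae_subseq ZX.
have C0 : 0 <= C by have /andP[h1 h2] := bC 0 0; exact: le_trans h2.
have : Lp_norm (ZP (phi n)).2 @[n --> \oo] --> (0 : R).
  apply: (@L2_dominated_null _ U C).
    move=> n m; have [_ + _] := ZPP (phi n) => /(_ m) /le_trans; apply.
    by rewrite ler_wpM2r//; have /andP[] := bC (X m) ((ZP (phi n)).1 m).
  apply: filterS Zae => m Zm.
  have bm : beta (X m) ((ZP (phi n)).1 m) * `|U m| @[n --> \oo] --> (0 : R).
    rewrite -(mul0r `|U m|); apply: cvgMl.
    exact: cvg_comp Zm (b0 (X m)).
  apply/norm_cvg0P; apply: (squeeze_cvgr _ (cvg_cst 0) bm).
  by apply: nearW => n; rewrite normr_ge0 /=; have [_ + _] := ZPP (phi n); apply.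
move=> /cvgr0Pnorm_lt/(_ _ e0)[N _ /(_ N (leqnn _))].
rewrite /= ger0_norm ?L2_norm_ge0// ltNge.
by have [_ _ ->] := ZPP (phi N).
Qed.

End multipliers.

Section primitives.
Context {R : realType}.
Local Notation lebR := (@lebesgue_measure R).

Lemma measurable_fun_countable d (Y : measurableType d) (E D : set R)
    (f : R -> Y) : measurable (E : set (measurableTypeR R)) -> countable D ->
  measurable_fun (E `\` D : set (measurableTypeR R)) f ->
  measurable_fun (E : set (measurableTypeR R)) f.
Proof.
move=> mE cD mf _ B mB.
have mD (D' : set R) : D' `<=` D -> measurable (D' : set (measurableTypeR R)).
  move=> D'D; apply: countable_measurable; first exact: measurable_set1.
  by apply: sub_countable cD; exact: subset_card_le.
rewrite (_ : E `&` f @^-1` B = ((E `\` D) `&` f @^-1` B) `|` (E `&` f @^-1` B `&` D)).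
  apply: measurableU; first by apply: mf => //; apply: measurableD => //; exact: mD.
  by apply: mD => x [].
apply/seteqP; split=> x /=.
  by move=> [Ex Bx]; have [Dx|Dx] := pselect (D x); [right|left].
by case=> [[[Ex _] Bx]|[[Ex Bx] _]].
Qed.

Lemma countable_negligible (D : set R) : countable D -> lebR.-negligible D.
Proof.
move=> cD; apply/negligibleP; last exact: countable_lebesgue_measure0.
by apply: countable_measurable; first exact: measurable_set1.
Qed.

Lemma continuous_off_countable_measurable (E D : set R) (f : R -> R) :
  measurable (E : set (measurableTypeR R)) -> countable D ->
  (forall t, E t -> ~ D t -> f s @[s --> t] --> f t) ->
  measurable_fun (E : set (measurableTypeR R)) f.
Proof.
move=> mE cD fc; apply: (measurable_fun_countable mE cD).
have mED : measurable (E `\` D : set (measurableTypeR R)).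
  by apply: measurableD => //; apply: countable_measurable => //; exact: measurable_set1.
apply: subspace_continuous_measurable_fun => //.
apply/subspace_continuousP => t [Et Dt].
by apply: cvg_within_filter; exact: fc.
Qed.

(** Changing an integrand on a countable set changes neither its measurability
    for the Borel sets nor its integral. *)
Lemma integrable_countable (E D : set R) (f g : R -> \bar R) :
  measurable (E : set (measurableTypeR R)) -> countable D ->
  (forall t, E t -> ~ D t -> f t = g t) -> lebR.-integrable E f ->
  lebR.-integrable E g /\ (\int[lebR]_(t in E) f t = \int[lebR]_(t in E) g t)%E.
Proof.
move=> mE cD fg fi.
have mf := measurable_int lebR fi.
have mg : measurable_fun (E : set (measurableTypeR R)) g.
  apply: (measurable_fun_countable mE cD).
  apply: (eq_measurable_fun f).
    by move=> t; rewrite inE => -[Et Dt]; exact: fg.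
  by apply: measurable_funS mf => //; apply: subDsetl.
have aefg : ae_eq lebR E f g.
  have [N [mN N0 DN]] := countable_negligible cD.
  exists N; split=> // t /= h; apply: DN; apply: contrapT => Dt; apply: h => Et.
  exact: fg.
split; last exact: ae_eq_integral.
have /integrableP[_ fy] := fi; apply/integrableP; split=> //.
rewrite (_ : (\int[_]_(_ in _) _)%E = (\int[lebR]_(t in E) `|f t|)%E)//.
apply: ae_eq_integral => //.
- exact: measurableT_comp.
- exact: measurableT_comp.
- by apply: filterS aefg => t h /h ->.
Qed.

Lemma bounded_integrable (a b C : R) (p : R -> R) :
  measurable_fun (`[a, b]%classic : set (measurableTypeR R)) p ->
  (forall t : R, a <= t -> t <= b -> `|p t| <= C) ->
  lebR.-integrable `[a, b] (EFin \o p).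
Proof.
move=> mp pC; apply: measurable_bounded_integrable => //.
  by rewrite [X in (X < _)%E]lebesgue_measure_itv; case: ifP => _; rewrite ltry.
exists C; split; first exact: num_real.
move=> M CM t /=; rewrite in_itv/= => /andP[at_ tb].
by rewrite (le_trans (pC t at_ tb))// ltW.
Qed.

(** The difference between [g] and the integral of [p] has zero right Dini
    derivatives. *)
Lemma right_primitive (a b C : R) (g p : R -> R) : a <= b ->
  (forall t, a < t -> t <= b -> g s @[s --> t^'-] --> g t) ->
  (forall t, a <= t -> t < b -> forall e, 0 < e ->
     \forall s \near t^'+, `|g s - g t - p t * (s - t)| <= e * (s - t)) ->
  (forall t, a <= t -> t < b -> p s @[s --> t^'+] --> p t) ->
  (forall t, a <= t -> t <= b -> `|p t| <= C) ->
  measurable_fun (`[a, b]%classic : set (measurableTypeR R)) p ->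
  lebR.-integrable `[a, b] (EFin \o p) /\
  g b - g a = \int[lebR]_(t in `[a, b]) p t.
Proof.
move=> ab gl gD pr pC mp.
have ip := bounded_integrable mp pC; split=> //.
pose I t := \int[lebR]_(r in `[a, t]) p r.
have ipt t : t <= b -> lebR.-integrable `[a, t] (EFin \o p).
  move=> tb; apply: integrableS ip => // r /=; rewrite !in_itv/= => /andP[-> rt].
  by rewrite (le_trans rt).
have ipst s t : a <= s -> t <= b -> lebR.-integrable `]s, t] (EFin \o p).
  move=> as_ tb; apply: integrableS ip => // r /=; rewrite !in_itv/= => /andP[sr rt].
  by rewrite (le_trans rt)// andbT (le_trans as_)// ltW.
have ID s t : a <= s -> s <= t -> t <= b ->
    I t - I s = \int[lebR]_(r in `]s, t]) p r.
  by move=> as_ st tb; apply: Rintegral_itvB; [exact: ipt|rewrite bnd_simp..].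
have Ibound s t c e : a <= s -> s <= t -> t <= b ->
    (forall r, s < r -> r <= t -> `|p r - c| <= e) ->
    `|I t - I s - c * (t - s)| <= e * (t - s).
  move=> as_ st tb pe; rewrite ID//.
  have cE k : \int[lebR]_(r in `]s, t]) (cst k) r = k * (t - s).
    by rewrite Rintegral_cst// (_ : fine _ = t - s)// [X in fine X](lebesgue_itvoc st).
  have mst : measurable (`]s, t]%classic : set (measurableTypeR R)) by [].
  rewrite ler_norml; apply/andP; split.
    rewrite lerBrDr addrC -mulrBl -(cE (c - e)).
    apply: le_Rintegral => //; [exact: integrable_cst_itvoc|exact: ipst|].
    move=> r /=; rewrite in_itv/= => /andP[sr rt].
    by have := pe r sr rt; rewrite ler_norml => /andP[]; real_lra.
  rewrite lerBlDr -mulrDl -(cE (e + c)).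
  apply: le_Rintegral => //; [exact: ipst|exact: integrable_cst_itvoc|].
  move=> r /=; rewrite in_itv/= => /andP[sr rt].
  by have := pe r sr rt; rewrite ler_norml => /andP[]; real_lra.
have Il t : a < t -> t <= b -> I s @[s --> t^'-] --> I t.
  apply: (@lipschitz_cvg_left R I a b C) => s r as_ sr rb.
  have := @Ibound s r 0 C as_ sr rb; rewrite mul0r subr0; apply.
  by move=> x sx xr; rewrite subr0 pC//; real_lra.
have IDr t : a <= t -> t < b -> forall e, 0 < e ->
    \forall s \near t^'+, `|I s - I t - p t * (s - t)| <= e * (s - t).
  move=> at_ tb e e0; have /cvgrPdist_lt/(_ _ e0)/near_rightP[d d0 dP] := pr t at_ tb.
  apply/near_rightP; exists (Num.min d (b - t)).
    by rewrite lt_min d0 subr_gt0.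
  move=> s ts; rewrite -ltrBlDl lt_min => /andP[sd sb].
  apply: Ibound; [exact: at_|exact: ltW|real_lra|].
  by move=> r tr rs; rewrite distrC ltW// dP//; real_lra.
have Ia : I a = 0 by rewrite /I set_itv1 Rintegral_set1.
have half t : a <= t -> t < b -> forall e, 0 < e -> \forall s \near t^'+,
    `|(g s - I s) - (g t - I t)| <= e * (s - t).
  move=> at_ tb e e0; have h1 := gD t at_ tb _ (half_gt0 e0).
  have h2 := IDr t at_ tb _ (half_gt0 e0).
  apply: filterS2 h1 h2 => s h1 h2.
  rewrite (_ : _ - _ = (g s - g t - p t * (s - t)) - (I s - I t - p t * (s - t))).
    rewrite (le_trans (ler_normB _ _))// (le_trans (lerD h1 h2))//.
    by rewrite -mulrDl -splitr.
  ring.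
have u1 : (g b - I b) - (g a - I a) <= 0 * (b - a).
  apply: (@dini_growth R (fun s => g s - I s) a b 0 ab).
    by move=> t at_ tb; apply: cvgB; [exact: gl|exact: Il].
  move=> t at_ tb e e0; rewrite add0r; apply: filterS (half t at_ tb e e0) => s.
  exact: le_trans (ler_norm _).
have u2 : (I b - g b) - (I a - g a) <= 0 * (b - a).
  apply: (@dini_growth R (fun s => I s - g s) a b 0 ab).
    by move=> t at_ tb; apply: cvgB; [exact: Il|exact: gl].
  move=> t at_ tb e e0; rewrite add0r; apply: filterS (half t at_ tb e e0) => s.
  apply: le_trans; rewrite (_ : _ - _ = - ((g s - I s) - (g t - I t))); last by ring.
  by rewrite -normrN; exact: ler_norm.
move: u1 u2; rewrite Ia mul0r -/(I b); real_lra.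
Qed.

End primitives.

(** * Test functions along a curve *)

Section test_curve.
Context {R : realType}.
Implicit Types (U V W X Z P Q : L2 R).

Variables (phi phit phix : R -> R -> R) (C K : R).
Hypothesis K0 : 0 <= K.
Hypothesis phiC : forall t x, `|phi t x| <= C.
Hypothesis phitC : forall t x, `|phit t x| <= C.
Hypothesis phixC : forall t x, `|phix t x| <= C.
Hypothesis phiK : forall s t x y, `|phi s x - phi t y| <= K * (`|s - t| + `|x - y|).
Hypothesis phitK : forall s t x y, `|phit s x - phit t y| <= K * (`|s - t| + `|x - y|).
Hypothesis phixK : forall s t x y, `|phix s x - phix t y| <= K * (`|s - t| + `|x - y|).
Hypothesis dphit : forall s t x,
  `|phi s x - phi t x - (s - t) * phit t x| <= K * (s - t) ^+ 2.
Hypothesis dphix : forall t x y,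
  `|phi t x - phi t y - (x - y) * phix t y| <= K * (x - y) ^+ 2.

Let C0 : 0 <= C. Proof. exact: le_trans (phiC 0 0). Qed.

Variables (X V A B : R -> L2 R).
Hypothesis AE : forall t, A t =1 (fun m => phi t (X t m)).
Hypothesis BE : forall t, B t =1 (fun m => phit t (X t m) + V t m * phix t (X t m)).

Lemma test_curve_dist s t :
  Lp_norm (A s - A t) <= K * (`|s - t| + Lp_norm (X s - X t)).
Proof.
have -> : K * (`|s - t| + Lp_norm (X s - X t)) =
    Lp_norm ((K * `|s - t|) *: unit_L2) + Lp_norm (K *: (X s - X t)).
  by rewrite !L2_normZ unit_L2_norm mulr1 (ger0_norm (mulr_ge0 K0 (normr_ge0 _))) (ger0_norm K0) mulrDr.
apply: L2_norm_le_add => m; rewrite !L2E !AE /= mulr1.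
apply: le_trans (phiK _ _ _ _) _.
by rewrite mulrDr lerD// ?normrM ?normr_id !(ger0_norm K0).
Qed.

Lemma test_curve_velocity_norm t : Lp_norm (B t) <= C + C * Lp_norm (V t).
Proof.
have -> : C + C * Lp_norm (V t) = Lp_norm (C *: unit_L2) + Lp_norm (C *: V t).
  by rewrite !L2_normZ unit_L2_norm mulr1 !ger0_norm.
apply: L2_norm_le_add => m; rewrite !L2E BE /= mulr1 (ger0_norm C0) normrM.
rewrite (ger0_norm C0) (le_trans (ler_normD _ _))// lerD// normrM mulrC.
by rewrite ler_wpM2r.
Qed.

(** Bound for the variation of [phix] between [x] and [z]. *)
Let beta (x z : R) : R := Num.min (K * `|z - x|) (K + 2 * C).

Let betaC x z : 0 <= beta x z <= K + 2 * C.
Proof.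
rewrite /beta le_min mulr_ge0//= ge_min lexx orbT andbT.
by rewrite addr_ge0// mulr_ge0.
Qed.

Let beta0 (x : R) : beta x z @[z --> x] --> (0 : R).
Proof.
have h1 : (z - x) @[z --> x] --> (x - x : R).
  by apply: cvgB; [exact: cvg_id|exact: cvg_cst].
have h : K * `|z - x| @[z --> x] --> (0 : R).
  have h2 : `|z - x| @[z --> x] --> (`|x - x| : R) by exact: cvg_norm h1.
  have h3 : K * `|z - x| @[z --> x] --> (K * `|x - x| : R) by exact: cvgMr h2.
  by move: h3; rewrite subrr normr0 mulr0.
apply: (squeeze_cvgr _ (cvg_cst 0) h); apply: nearW => z.
by have /andP[-> _] := betaC x z; rewrite /beta ge_min lexx.
Qed.

Let beta_mul X0 Z0 V0 : exists P, P =1 (fun m => beta (X0 m) (Z0 m) * V0 m).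
Proof.
have mb : measurable_fun setT (fun m : measurableTypeR R => beta (X0 m) (Z0 m)).
  apply: measurable_minr => //; apply: measurable_funM => //.
  by apply: measurableT_comp => //; exact: measurable_funB.
have [m|P PE _] := bounded_mul_L2 V0 mb (C := K + 2 * C); last by exists P.
by have /andP[h1 h2] := betaC (X0 m) (Z0 m); rewrite ger0_norm.
Qed.

Let dphix_beta t x y : `|phi t x - phi t y - (x - y) * phix t y| <= `|x - y| * beta y x.
Proof.
rewrite /beta minEle; case: ifP => _.
  by rewrite (le_trans (dphix _ _ _))// -[(x - y) ^+ 2]real_normK ?num_real// expr2 mulrCA.
rewrite mulrDr (le_trans (ler_normB _ _))// lerD//.
  by have := phiK t t x y; rewrite subrr normr0 add0r mulrC.
by rewrite normrM ler_wpM2l// (le_trans (phixC _ _))// mulr_natl mulr2n lerDl.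
Qed.

(** The chain rule in L2. The quadratic remainder of the expansion in space is
    only integrable, so it is split into a part controlled by the difference
    quotient of [X] and a small multiple of [V t]. *)
Lemma test_curve_right_deriv t :
  has_right_deriv X t (V t) -> has_right_deriv A t (B t).
Proof.
move=> /has_right_derivP XV; apply/has_right_derivP => e e0.
have e4 : 0 < e / 4 by rewrite divr_gt0.
have [d1 d10 d1P] := small_multiplier (V t) (X t) betaC beta0 e4.
have CK1 : 0 < K + 3 * C + 1 by rewrite ltr_wpDl// addr_ge0// mulr_ge0.
have K1 : 0 < K + 1 by rewrite ltr_wpDl.
have V1 : 0 < Lp_norm (V t) + 1 by rewrite ltr_wpDl ?L2_norm_ge0.
have [d2 [d20 d2P d2Q]] : exists d2 : R, [/\ 0 < d2, d2 <= d1 & d2 <= e / 4 / (K + 1)].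
  exists (Num.min d1 (e / 4 / (K + 1))).
  by rewrite lt_min d10 divr_gt0// !ge_min !lexx orbT.
have [d3 [d30 d3P d3Q]] : exists d3 : R,
    [/\ 0 < d3, d3 <= e / 4 / (K + 1) & d3 <= d2 / (Lp_norm (V t) + 1)].
  exists (Num.min (e / 4 / (K + 1)) (d2 / (Lp_norm (V t) + 1))).
  by rewrite lt_min !divr_gt0// !ge_min !lexx orbT.
have XV1 := XV _ ltr01; have XVe := XV _ (divr_gt0 e4 CK1).
have tail s : t < s -> s < t + d3 ->
    Lp_norm (X s - X t - (s - t) *: V t) <= 1 * (s - t) ->
    Lp_norm (X s - X t - (s - t) *: V t) <= e / 4 / (K + 3 * C + 1) * (s - t) ->
    Lp_norm (A s - A t - (s - t) *: B t) <= e * (s - t).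
  move=> ts sd; have h0 : 0 < s - t by rewrite subr_gt0.
  have hd3 : s - t < d3 by rewrite ltrBlDl.
  move hE : (s - t) h0 hd3 => h h0 hd3 V1s Ves.
  have Xs : Lp_norm (X s - X t) < d2.
    have := L2_norm_triangle (X s - X t - h *: V t) (h *: V t).
    rewrite subrK L2_normZ (gtr0_norm h0) => /le_lt_trans; apply.
    have : h < d2 / (Lp_norm (V t) + 1) by exact: lt_le_trans d3Q.
    rewrite ltr_pdivlMr// mulrDr mulr1 addrC; apply: le_lt_trans.
    by rewrite lerD2r (le_trans V1s)// mul1r.
  have [P PE] := beta_mul (X t) (X s) (V t).
  have Pe : Lp_norm P < e / 4.
    apply: (d1P (X s)) => [|m]; first exact: lt_le_trans d2P.
    rewrite PE normrM ger0_norm//.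
    by have /andP[] := betaC (X t m) (X s m).
  have [D DE Dn] := L2_abs (X s - X t).
  have [E EE En] := L2_abs (X s - X t - h *: V t).
  have [P' P'E P'n] := L2_abs P.
  apply: (@le_trans _ _ (K * h ^+ 2 + K * h * Lp_norm D + (K + 3 * C) * Lp_norm E +
      h * Lp_norm P')); last first.
    rewrite Dn En P'n.
    have b1 : K * h <= e / 4.
      apply: (@le_trans _ _ ((K + 1) * h)); first by rewrite ler_wpM2r ?ltW// ltrDl.
      by rewrite mulrC -ler_pdivlMr// (le_trans (ltW hd3)).
    have b2 : K * Lp_norm (X s - X t) <= e / 4.
      apply: (@le_trans _ _ ((K + 1) * Lp_norm (X s - X t))).
        by rewrite ler_wpM2r ?L2_norm_ge0// ltW// ltrDl.
      by rewrite mulrC -ler_pdivlMr// (le_trans (ltW Xs)).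
    have b3 : (K + 3 * C) * Lp_norm (X s - X t - h *: V t) <= e / 4 * h.
      apply: (@le_trans _ _ ((K + 3 * C + 1) * Lp_norm (X s - X t - h *: V t))).
        by rewrite ler_wpM2r ?L2_norm_ge0// ltW// ltrDl.
      by rewrite mulrC -ler_pdivlMr// mulrAC.
    have c1 : K * h ^+ 2 <= e / 4 * h by rewrite expr2 mulrA ler_wpM2r// ltW.
    have c2 : K * h * Lp_norm (X s - X t) <= e / 4 * h.
      by rewrite mulrAC ler_wpM2r// ltW.
    have c4 : h * Lp_norm P <= e / 4 * h by rewrite mulrC ler_wpM2r// ltW.
    apply: le_trans (lerD (lerD (lerD c1 c2) b3) c4) _.
    by rewrite le_eqVlt; apply/orP; left; apply/eqP; field.
  have hn : `|h| = h by rewrite gtr0_norm.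
  apply: (@le_trans _ _ (Lp_norm ((K * h ^+ 2) *: unit_L2) + Lp_norm ((K * h) *: D) +
      Lp_norm ((K + 3 * C) *: E) + Lp_norm (h *: P'))); last first.
    rewrite !L2_normZ unit_L2_norm mulr1 hn.
    rewrite (ger0_norm (mulr_ge0 K0 (sqr_ge0 h))) (ger0_norm (mulr_ge0 K0 (ltW h0))).
    by rewrite (ger0_norm (addr_ge0 K0 (mulr_ge0 _ C0))).
  apply: le_trans (lerD (lerD (L2_norm_triangle _ _) (lexx _)) (lexx _)).
  apply: le_trans (lerD (L2_norm_triangle _ _) (lexx _)).
  apply: le_trans (L2_norm_triangle _ _).
  apply: L2_norm_le => m; apply: le_trans (ler_norm _).
  rewrite !L2E DE EE P'E PE !AE BE !L2E /= mulr1.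
  move: (X s m) (X t m) (V t m) => y x v.
  have -> : phi s y - phi t x - h * (phit t x + v * phix t x) =
      (phi s y - phi t y - h * phit t y) + h * (phit t y - phit t x) +
      (phi t y - phi t x - (y - x) * phix t x) + (y - x - h * v) * phix t x by ring.
  have t1 : `|phi s y - phi t y - h * phit t y| <= K * h ^+ 2 by rewrite -hE; exact: dphit.
  have t2 : `|h * (phit t y - phit t x)| <= K * h * `|y - x|.
    rewrite normrM hn -mulrA mulrCA (ler_wpM2l (ltW h0))//.
    by have := phitK t t y x; rewrite subrr normr0 add0r.
  have t3 := dphix_beta t y x.
  have t4 : `|(y - x - h * v) * phix t x| <= C * `|y - x - h * v|.
    by rewrite normrM mulrC ler_wpM2r.
  have /andP[be0 beK] := betaC x y.
  have t5 : `|y - x| * beta x y <= (K + 2 * C) * `|y - x - h * v| + h * `|beta x y * v|.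
    apply: (@le_trans _ _ ((`|y - x - h * v| + `|h * v|) * beta x y)).
      by rewrite ler_wpM2r// -[in leLHS](subrK (h * v) (y - x)) ler_normD.
    rewrite mulrDl lerD//; first by rewrite mulrC ler_wpM2r.
    by rewrite !normrM hn (ger0_norm be0) -mulrA [`|v| * _]mulrC.
  apply: le_trans (ler_normD _ _) _.
  apply: le_trans (lerD (ler_normD _ _) (lexx _)) _.
  apply: le_trans (lerD (lerD (ler_normD _ _) (lexx _)) (lexx _)) _.
  apply: le_trans (lerD (lerD (lerD t1 t2) (le_trans t3 t5)) t4) _.
  by rewrite le_eqVlt; apply/orP; left; apply/eqP; ring.
near=> s.
apply: tail; near: s.
- exact: nbhs_right_gt.
- by apply: nbhs_right_lt; rewrite ltrDl.
- exact: XV1.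
- exact: XVe.
Unshelve. all: by end_near. Qed.

(** The variation of [phix] along the curve is a small multiplier of [V t]; the
    other terms are Lipschitz or bounded multiples of the differences. *)
Lemma test_curve_velocity_cvg (FF : set_system R) (PF : ProperFilter FF) t :
  s @[s --> FF] --> t -> X s @[s --> FF] --> X t -> V s @[s --> FF] --> V t ->
  B s @[s --> FF] --> B t.
Proof.
move=> st /L2_cvgP Xc /L2_cvgP Vc; apply/L2_cvgP => e e0.
have e4 : 0 < e / 4 by rewrite divr_gt0.
have quarters (x y z r p : R) : x + r <= e / 4 -> y <= e / 4 -> z <= e / 4 ->
    p < e / 4 -> x + y + z + r + p < e by lra.
have [d1 d10 d1P] := small_multiplier (V t) (X t) betaC beta0 e4.
have C1 : 0 < C + 1 by rewrite ltr_wpDl.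
have K1 : 0 < K + 1 by rewrite ltr_wpDl.
have V1 : 0 < Lp_norm (V t) + 1 by rewrite ltr_wpDl ?L2_norm_ge0.
have KV : 0 < (K + 1) * (Lp_norm (V t) + 1) by rewrite mulr_gt0.
move/cvgrPdist_lt/(_ _ (divr_gt0 e4 KV)) : st => st.
apply: filterS (filterI st (filterI (Xc _ d10) (filterI (Xc _ (divr_gt0 e4 K1))
  (Vc _ (divr_gt0 e4 C1))))) => s [sts [Xs1 [Xs Vs]]].
have [P PE] := beta_mul (X t) (X s) (V t).
have Pe : Lp_norm P < e / 4.
  apply: (d1P (X s)) => // m; rewrite PE normrM ger0_norm//.
  by have /andP[] := betaC (X t m) (X s m).
have [D DE Dn] := L2_abs (X s - X t).
have [E EE En] := L2_abs (V s - V t).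
have [P' P'E P'n] := L2_abs P.
have [W WE Wn] := L2_abs (V t).
have r0 : 0 <= K * `|s - t| by rewrite mulr_ge0.
have {}sts : `|s - t| < e / 4 / ((K + 1) * (Lp_norm (V t) + 1)) by rewrite distrC.
apply: (@le_lt_trans _ _ (K * `|s - t| + K * Lp_norm D + C * Lp_norm E +
    (K * `|s - t|) * Lp_norm W + Lp_norm P')); last first.
  rewrite Dn En P'n Wn.
  have b1 : K * `|s - t| + K * `|s - t| * Lp_norm (V t) <= e / 4.
    apply: (@le_trans _ _ (`|s - t| * ((K + 1) * (Lp_norm (V t) + 1)))).
      rewrite (_ : _ + _ = `|s - t| * (K * (Lp_norm (V t) + 1))); last by ring.
      by rewrite ler_wpM2l// ler_wpM2r ?(ltW V1)// lerDl.
    by rewrite -ler_pdivlMr// ltW.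
  have b2 : K * Lp_norm (X s - X t) <= e / 4.
    apply: (@le_trans _ _ ((K + 1) * Lp_norm (X s - X t))).
      by rewrite ler_wpM2r ?L2_norm_ge0// lerDl.
    by rewrite mulrC -ler_pdivlMr// (ltW Xs).
  have b3 : C * Lp_norm (V s - V t) <= e / 4.
    apply: (@le_trans _ _ ((C + 1) * Lp_norm (V s - V t))).
      by rewrite ler_wpM2r ?L2_norm_ge0// lerDl.
    by rewrite mulrC -ler_pdivlMr// (ltW Vs).
  exact: quarters b1 b2 b3 Pe.
apply: (@le_trans _ _ (Lp_norm ((K * `|s - t|) *: unit_L2) + Lp_norm (K *: D) +
    Lp_norm (C *: E) + Lp_norm ((K * `|s - t|) *: W) + Lp_norm P')); last first.
  rewrite !L2_normZ unit_L2_norm mulr1.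
  by rewrite (ger0_norm r0) (ger0_norm K0) (ger0_norm C0).
apply: le_trans (lerD (lerD (lerD (L2_norm_triangle _ _) (lexx _)) (lexx _)) (lexx _)).
apply: le_trans (lerD (lerD (L2_norm_triangle _ _) (lexx _)) (lexx _)).
apply: le_trans (lerD (L2_norm_triangle _ _) (lexx _)).
apply: le_trans (L2_norm_triangle _ _).
apply: L2_norm_le => m; apply: le_trans (ler_norm _).
rewrite !L2E DE EE P'E WE PE !BE !L2E /= mulr1.
move: (X s m) (X t m) (V t m) (V s m) => y x v w.
have -> : phit s y + w * phix s y - (phit t x + v * phix t x) =
    (phit s y - phit t x) + (w - v) * phix s y + v * (phix s y - phix t y) +
    v * (phix t y - phix t x) by ring.
have t1 : `|phit s y - phit t x| <= K * `|s - t| + K * `|y - x|.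
  by rewrite -mulrDr; exact: phitK.
have t2 : `|(w - v) * phix s y| <= C * `|w - v| by rewrite normrM mulrC ler_wpM2r.
have t3 : `|v * (phix s y - phix t y)| <= K * `|s - t| * `|v|.
  rewrite normrM mulrC ler_wpM2r//.
  by have := phixK s t y y; rewrite subrr normr0 addr0.
have t4 : `|v * (phix t y - phix t x)| <= `|beta x y * v|.
  have /andP[be0 _] := betaC x y.
  rewrite !normrM mulrC ler_wpM2r// (ger0_norm be0) le_min.
  apply/andP; split; first by have := phixK t t y x; rewrite subrr normr0 add0r.
  rewrite (le_trans (ler_normB _ _))// (le_trans (lerD (phixC _ _) (phixC _ _)))//.
  by rewrite -mulr2n -(mulr_natl C 2) lerDr.
apply: le_trans (ler_normD _ _) _.
apply: le_trans (lerD (ler_normD _ _) (lexx _)) _.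
apply: le_trans (lerD (lerD (ler_normD _ _) (lexx _)) (lexx _)) _.
exact: (lerD (lerD (lerD t1 t2) t3) t4).
Qed.

End test_curve.

Lemma test_curve_ex {R : realType} (phi phit phix : R -> R -> R) (C : R)
    (X V : R -> L2 R) :
  (forall t, measurable_fun setT (phi t : R -> R)) ->
  (forall t, measurable_fun setT (phit t : R -> R)) ->
  (forall t, measurable_fun setT (phix t : R -> R)) ->
  (forall t x, `|phi t x| <= C) -> (forall t x, `|phit t x| <= C) ->
  (forall t x, `|phix t x| <= C) ->
  exists A B : R -> L2 R,
    (forall t, A t =1 (fun m => phi t (X t m))) /\
    (forall t, B t =1 (fun m => phit t (X t m) + V t m * phix t (X t m))).
Proof.
move=> mp mpt mpx phiC phitC phixC.
have mX t : measurable_fun setT (X t : measurableTypeR R -> R) := measurable_funPT (X t).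
have ex1 (f : R -> R -> R) t : measurable_fun setT (f t : R -> R) ->
    (forall t x, `|f t x| <= C) ->
    exists A : L2 R, A =1 (fun m => f t (X t m)).
  move=> mf fC; have [||A AE] := @bounded_L2 R (fun m => f t (X t m)) C.
  - exact: measurableT_comp.
  - by move=> m; exact: fC.
  by exists A.
have /choice[A AE] : forall t, exists A : L2 R, A =1 (fun m => phi t (X t m)).
  by move=> t; exact: ex1.
have /choice[B BE] : forall t, exists B : L2 R,
    B =1 (fun m => phit t (X t m) + V t m * phix t (X t m)).
  move=> t; have [B1 B1E] := ex1 phit t (mpt t) phitC.
  have mb : measurable_fun setT (fun m : measurableTypeR R => phix t (X t m)).
    exact: measurableT_comp.
  have [m|B2 B2E _] := bounded_mul_L2 (V t) mb (C := C); first exact: phixC.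
  by exists (B1 + B2) => m; rewrite L2E B1E B2E mulrC.
by exists A, B.
Qed.

(** * Smooth compactly supported functions of time and space *)

Section smooth_test_functions.
Context {R : realType}.

Lemma derive_support (V W : normedModType R) (phi : V -> W) v z :
  ~ closure [set x | phi x != 0] z -> 'D_v phi z = 0.
Proof.
move=> nz; rewrite (@near_eq_derive _ _ _ _ (cst 0)) ?derive_cst//.
have : nbhs z (~` closure [set x | phi x != 0]).
  by apply: open_nbhs_nbhs; split => //; apply: closed_openC; exact: closed_closure.
apply: filterS => y ny; apply/eqP; apply: contrapT => /negP yz; apply: ny.
exact: subset_closure.
Qed.

Lemma compact_support_bounded (V : normedModType R) (S : set V) (g : V -> R) :
  compact S -> continuous g -> (forall z, ~ S z -> g z = 0) ->
  exists C : R, forall z, `|g z| <= C.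
Proof.
move=> cS cg g0.
have : bounded_set (g @` S).
  apply: compact_bounded; apply: continuous_compact => //.
  by apply: continuous_subspaceT.
move=> [M [_ MP]]; exists (`|M| + 1) => z.
have [Sz|Sz] := pselect (S z); last by rewrite g0// normr0 addr_ge0.
apply: (MP (`|M| + 1)); last by exists z.
by rewrite (le_lt_trans (ler_norm M))// ltrDl.
Qed.

Lemma line_mean_value (V : normedModType R) (g : V -> R) (z v : V) (r : R) :
  continuous g -> (forall x, derivable g x v) ->
  exists2 c : R, `|c| <= `|r| & g (r *: v + z) - g z = r * 'D_v g (c *: v + z).
Proof.
move=> cg dg.
pose h (x : R) := g (x *: v + z).
have hd (x : R) : is_derive x 1 h ('D_v g (x *: v + z)).
  have E : (fun e : R => e^-1 *: ((h \o shift x) (e *: 1) - h x)) =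
      (fun e : R => e^-1 *: ((g \o shift (x *: v + z)) (e *: v) - g (x *: v + z))).
    apply/funext => e /=; rewrite /h /= [e *: 1]mulr1 scalerDl addrA//.
  by apply: DeriveDef; rewrite /derivable /derive E//; exact: dg.
have hc a b : {within `[a, b], continuous h}.
  apply: continuous_subspaceT => x.
  by apply: differentiable_continuous; apply/derivable1_diffP; have [] := hd x.
have h0 : h 0 = g z by rewrite /h scale0r add0r.
have [r0|r0] := leP 0 r.
  have [c /itvP cr] := MVT_segment r0 (fun x _ => hd x) (@hc _ _).
  rewrite h0 subr0 mulrC => E; exists c => //.
  by rewrite !ger0_norm ?cr.
have [c /itvP cr] := MVT_segment (ltW r0) (fun x _ => hd x) (@hc _ _).
rewrite h0 => E; exists c; first by rewrite !ler0_norm ?cr ?(ltW r0)// lerN2 cr.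
by rewrite -/(h r) -opprB E sub0r mulrN opprK mulrC.
Qed.

End smooth_test_functions.
Section space_time_test_functions.
Context {R : realType}.
Implicit Types g phi : R * R -> R.

Local Notation dt := (@pair R R 1 0).
Local Notation dx := (@pair R R 0 1).

Lemma plane_mean_value_time g (s t x : R) :
  continuous g -> (forall z, derivable g z dt) ->
  exists2 c : R, `|c| <= `|s - t| &
    g (s, x) - g (t, x) = (s - t) * 'D_dt g (t + c, x).
Proof.
move=> cg dg; have [c cst E] := line_mean_value (t, x) (s - t) cg dg.
exists c => //; move: E.
rewrite (_ : (s - t) *: (1, 0) + (t, x) = (s, x)).
  rewrite (_ : c *: (1, 0) + (t, x) = (t + c, x))//.
  by congr pair; rewrite /= ?scaler0 ?add0r// [_ *: _]mulr1 addrC.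
by congr pair; rewrite /= ?scaler0 ?add0r// [_ *: _]mulr1 subrK.
Qed.

Lemma plane_mean_value_space g (t x y : R) :
  continuous g -> (forall z, derivable g z dx) ->
  exists2 c : R, `|c| <= `|x - y| &
    g (t, x) - g (t, y) = (x - y) * 'D_dx g (t, y + c).
Proof.
move=> cg dg; have [c cst E] := line_mean_value (t, y) (x - y) cg dg.
exists c => //; move: E.
rewrite (_ : (x - y) *: (0, 1) + (t, y) = (t, x)).
  rewrite (_ : c *: (0, 1) + (t, y) = (t, y + c))//.
  by congr pair; rewrite /= ?scaler0 ?add0r// [_ *: _]mulr1 addrC.
by congr pair; rewrite /= ?scaler0 ?add0r// [_ *: _]mulr1 subrK.
Qed.

Lemma plane_lipschitz g (K : R) : continuous g ->
  (forall z, derivable g z dt) -> (forall z, derivable g z dx) ->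
  (forall z, `|'D_dt g z| <= K) -> (forall z, `|'D_dx g z| <= K) ->
  forall s t x y : R, `|g (s, x) - g (t, y)| <= K * (`|s - t| + `|x - y|).
Proof.
move=> cg gt gx gtK gxK s t x y.
have [c _ E1] := plane_mean_value_time s t x cg gt.
have [c' _ E2] := plane_mean_value_space t x y cg gx.
rewrite (_ : _ - _ = (g (s, x) - g (t, x)) + (g (t, x) - g (t, y))); last by ring.
rewrite E1 E2 (le_trans (ler_normD _ _))// mulrDr !normrM ![K * _]mulrC.
by rewrite lerD// ler_wpM2l.
Qed.

(** All the derivatives of a test function are bounded, by compactness of the
    support, so that Taylor expansions hold uniformly. *)
Lemma space_time_test_bounds phi : space_time_test phi ->
  exists C K : R, [/\ 0 <= K,
    [/\ forall t x : R, `|phi (t, x)| <= C, forall t x : R, `|'D_dt phi (t, x)| <= C &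
        forall t x : R, `|'D_dx phi (t, x)| <= C],
    [/\ forall s t x y : R, `|phi (s, x) - phi (t, y)| <= K * (`|s - t| + `|x - y|),
        forall s t x y : R, `|'D_dt phi (s, x) - 'D_dt phi (t, y)| <=
          K * (`|s - t| + `|x - y|) &
        forall s t x y : R, `|'D_dx phi (s, x) - 'D_dx phi (t, y)| <=
          K * (`|s - t| + `|x - y|)],
    forall s t x : R, `|phi (s, x) - phi (t, x) - (s - t) * 'D_dt phi (t, x)| <=
      K * (s - t) ^+ 2 &
    forall t x y : R, `|phi (t, x) - phi (t, y) - (x - y) * 'D_dx phi (t, y)| <=
      K * (x - y) ^+ 2].
Proof.
move=> [sphi cphi _]; set S := closure _ in cphi.
have bnd g : continuous g -> (forall z, ~ S z -> g z = 0) ->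
    exists C : R, forall z, `|g z| <= C by exact: compact_support_bounded.
have c0 : continuous phi by have [] := sphi [::].
have c1 v : continuous ('D_v phi) by have [] := sphi [:: v].
have c2 v w : continuous ('D_w ('D_v phi)) by have [] := sphi [:: w; v].
have d0 v z : derivable phi z v by have [_] := sphi [::]; exact.
have d1 v w z : derivable ('D_v phi) z w by have [_] := sphi [:: v]; exact.
have z0 z : ~ S z -> phi z = 0.
  by move=> nz; apply/eqP; apply: contrapT => /negP yz; apply: nz; exact: subset_closure.
have z1 v z : ~ S z -> 'D_v phi z = 0 by exact: derive_support.
have z2 v w z : ~ S z -> 'D_w ('D_v phi) z = 0.
  move=> nz; rewrite (@near_eq_derive _ _ _ _ (cst 0)) ?derive_cst//.
  have : nbhs z (~` S).
    by apply: open_nbhs_nbhs; split => //; apply: closed_openC; exact: closed_closure.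
  by apply: filterS => y; exact: z1.
have [C0 C0P] := bnd _ c0 z0.
have [C1 C1P] := bnd _ (c1 dt) (z1 dt).
have [C2 C2P] := bnd _ (c1 dx) (z1 dx).
have [C3 C3P] := bnd _ (c2 dt dt) (z2 dt dt).
have [C4 C4P] := bnd _ (c2 dt dx) (z2 dt dx).
have [C5 C5P] := bnd _ (c2 dx dt) (z2 dx dt).
have [C6 C6P] := bnd _ (c2 dx dx) (z2 dx dx).
have pos (M : R) g : (forall z, `|g z| <= M) -> 0 <= M.
  by move=> h; exact: le_trans (h (0, 0)).
have p0 := pos _ _ C0P; have p1 := pos _ _ C1P; have p2 := pos _ _ C2P.
have p3 := pos _ _ C3P; have p4 := pos _ _ C4P; have p5 := pos _ _ C5P.
have p6 := pos _ _ C6P.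
pose K : R := C1 + C2 + C3 + C4 + C5 + C6.
have le_K (M : R) g : (forall z, `|g z| <= M) -> M <= K -> forall z, `|g z| <= K.
  by move=> h MK z; exact: le_trans MK.
have K1 := le_K _ _ C1P; have K2 := le_K _ _ C2P; have K3 := le_K _ _ C3P.
have K4 := le_K _ _ C4P; have K5 := le_K _ _ C5P; have K6 := le_K _ _ C6P.
have {K1}K1 : forall z, `|'D_dt phi z| <= K by apply: K1; rewrite /K; real_lra.
have {K2}K2 : forall z, `|'D_dx phi z| <= K by apply: K2; rewrite /K; real_lra.
have {K3}K3 : forall z, `|'D_dt ('D_dt phi) z| <= K by apply: K3; rewrite /K; real_lra.
have {K4}K4 : forall z, `|'D_dx ('D_dt phi) z| <= K by apply: K4; rewrite /K; real_lra.
have {K5}K5 : forall z, `|'D_dt ('D_dx phi) z| <= K by apply: K5; rewrite /K; real_lra.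
have {K6}K6 : forall z, `|'D_dx ('D_dx phi) z| <= K by apply: K6; rewrite /K; real_lra.
have K0 : 0 <= K by exact: pos K1.
have L1 := plane_lipschitz (c1 dt) (d1 dt dt) (d1 dt dx) K3 K4.
have L2' := plane_lipschitz (c1 dx) (d1 dx dt) (d1 dx dx) K5 K6.
exists (C0 + C1 + C2), K; split; first exact: K0.
- split=> t x.
  + by rewrite (le_trans (C0P _))// -addrA lerDl addr_ge0.
  + by rewrite (le_trans (C1P _))// -addrA addrCA lerDl addr_ge0.
  + by rewrite (le_trans (C2P _))// lerDr addr_ge0.
- split; [|exact: L1|exact: L2'].
  exact: (plane_lipschitz c0 (d0 dt) (d0 dx) K1 K2).
- move=> s t x; have [c cst ->] := plane_mean_value_time s t x c0 (d0 dt).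
  rewrite -mulrBr normrM -[(s - t) ^+ 2]real_normK ?num_real// expr2 mulrCA.
  rewrite ler_wpM2l// (le_trans (L1 _ _ _ _))// subrr normr0 addr0 addrC addKr.
  by rewrite ler_wpM2l.
- move=> t x y; have [c cst ->] := plane_mean_value_space t x y c0 (d0 dx).
  rewrite -mulrBr normrM -[(x - y) ^+ 2]real_normK ?num_real// expr2 mulrCA.
  rewrite ler_wpM2l// (le_trans (L2' _ _ _ _))// subrr normr0 add0r addrC addKr.
  by rewrite ler_wpM2l.
Qed.

(** On the compact support the time and its inverse are bounded. *)
Lemma space_time_test_support phi : space_time_test phi ->
  exists a b : R, [/\ 0 < a, a < b & forall t x, t <= a \/ b <= t ->
    [/\ phi (t, x) = 0, 'D_dt phi (t, x) = 0 & 'D_dx phi (t, x) = 0]].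
Proof.
move=> [sphi cphi]; set S := closure _ in cphi * => Spos.
have [b bP] : exists b : R, forall z, S z -> `|z.1| < b.
  have : bounded_set (fst @` S).
    apply: compact_bounded; apply: continuous_compact => //.
    by apply: continuous_subspaceT => z; exact: cvg_fst.
  move=> [M [_ MP]]; exists (`|M| + 2) => z Sz.
  rewrite (@le_lt_trans _ _ (`|M| + 1))//; last by rewrite ltrD2l ltr1n.
  apply: (MP (`|M| + 1)); last by exists z.
  by rewrite (le_lt_trans (ler_norm M))// ltrDl.
have [c c0 cP] : exists2 c : R, 0 < c & forall z, S z -> `|z.1^-1| < c.
  have : bounded_set ((fun z : R * R => z.1^-1) @` S).
    apply: compact_bounded; apply: continuous_compact => //.
    apply/subspace_continuousP => z Sz; apply: cvg_within_filter.
    apply: cvgV; last exact: cvg_fst.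
    by have [/=] := Spos _ Sz; rewrite in_itv/= andbT => /gt_eqF ->.
  move=> [M [_ MP]]; exists (`|M| + 2); first by rewrite ltr_wpDl.
  move=> z Sz; rewrite (@le_lt_trans _ _ (`|M| + 1))//; last by rewrite ltrD2l ltr1n.
  apply: (MP (`|M| + 1)); last by exists z.
  by rewrite (le_lt_trans (ler_norm M))// ltrDl.
have ci : 0 < c^-1 by rewrite invr_gt0.
exists c^-1, (`|b| + c^-1 + 1); split => //.
  by rewrite -addrA addrC -addrA ltrDl ltr_wpDr.
move=> t x tab.
have nS : ~ S (t, x).
  move=> Sz; have := bP _ Sz; have := cP _ Sz; have [/=] := Spos _ Sz.
  rewrite in_itv/= andbT => t0 _; rewrite !ger0_norm ?invr_ge0 ?ltW// => ct tb.
  case: tab => tab.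
    by move: ct; rewrite ltNge -(invrK c) lef_pV2 ?posrE// tab.
  move: tb; rewrite ltNge => /negP; apply; apply: le_trans tab.
  by rewrite (le_trans (ler_norm b))// -addrA lerDl addr_ge0// ltW.
split; [|exact: derive_support..].
by apply/eqP; apply: contrapT => /negP yz; apply: nS; exact: subset_closure.
Qed.

Lemma space_time_test_section phi (t : R) : space_time_test phi ->
  @test_function R R R setT (fun x => phi (t, x)).
Proof.
move=> [sphi cphi _]; set S := closure _ in cphi.
have sec g (v x : R) : (fun h : R =>
      h^-1 *: (((fun x : R => g (t, x)) \o shift x) (h *: v) - g (t, x))) =
    (fun h => h^-1 *: ((g \o shift (t, x)) (h *: (0, v)) - g (t, x))).
  apply/funext => h /=; congr (_ *: (g _ - _)).
  by congr pair; rewrite /= scaler0 add0r.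
have secD g (v : R) :
    'D_v (fun x : R => g (t, x)) = (fun x : R => 'D_(0, v) g (t, x)).
  by apply/funext => x; rewrite /derive (sec g v x).
have E (vs : seq R) : foldr (fun (v : R) (g : R -> R) => 'D_v g)
      (fun x : R => phi (t, x)) vs = (fun x : R =>
    foldr (fun (v : R * R) (g : R * R -> R) => 'D_v g) phi
      [seq (0, v) | v <- vs] (t, x)).
  by elim: vs => // v vs /= ->; rewrite secD.
split=> //.
- move=> vs; have [cv dv] := sphi [seq (0, v) | v <- vs].
  cbv zeta; rewrite E; split.
    move=> x; apply: (@continuous_comp _ _ _ (fun x => (t, x)) _ x); last exact: cv.
    exact: (cvg_pair (cvg_cst (t : R)) (@cvg_id _ (nbhs x))).
  move=> x v; have := dv (t, x) (0, v); rewrite /derivable.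
  by move=> h; rewrite (sec _ v x).
- apply: (@subclosed_compact _ _ (snd @` S)); first exact: closed_closure.
    apply: continuous_compact => //.
    by apply: continuous_subspaceT => z; exact: cvg_snd.
  have cS : closed (snd @` S).
    apply: compact_closed; first exact: norm_hausdorff.
    apply: continuous_compact => //.
    by apply: continuous_subspaceT => z; exact: cvg_snd.
  rewrite [X in _ `<=` X](closure_id _).1//; apply: closure_subset => x px.
  by exists (t, x) => //; exact: subset_closure.
Qed.

End space_time_test_functions.

(** * Integrals over the half-line and laws of curves *)

Section half_line.
Context {R : realType}.
Local Notation lebR := (@lebesgue_measure R).

Lemma integrable_half_line (a b : R) (p : R -> R) : 0 < a ->
  (forall t : R, 0 < t -> t < a \/ b < t -> p t = 0) ->
  lebR.-integrable `[a, b] (EFin \o p) ->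
  lebR.-integrable `]0, +oo[ (EFin \o p) /\
  \int[lebR]_(t in `]0, +oo[) p t = \int[lebR]_(t in `[a, b]) p t.
Proof.
move=> a0 p0 ip.
have E : p \_ `]0, +oo[ = p \_ `[a, b].
  apply/funext => t; rewrite !patchE !mem_setE !in_itv /= andbT.
  have [t0|t0] := ltP 0 t.
    have [at_|ta] /= := leP a t; last by rewrite p0//; left.
    by have [|bt] := leP t b; rewrite // p0//; right.
  by have [at_|//] := leP a t; move: (lt_le_trans a0 at_); rewrite ltNge t0.
split; last by rewrite Rintegral_mkcond E -Rintegral_mkcond.
have mab : measurable (`[a, b]%classic : set (measurableTypeR R)) by [].
have moo : measurable (`]0, +oo[%classic : set (measurableTypeR R)) by [].
have /(integrable_mkcond _ mab) ip' := ip.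
apply/(integrable_mkcond _ moo); move: ip'; congr integrable.
by rewrite !restrict_EFin E.
Qed.

End half_line.

Section laws.
Context {R : realType}.
Implicit Types (U V W X Y Z : L2 R).

Lemma integral_law X (h : R -> R) : measurable_fun setT (h : R -> R) ->
  \int[law X]_x h x = \int[leb01 R]_m h (X m).
Proof.
move=> mh; congr fine; have mX := measurable_funPT X.
have mh' : measurable_fun setT (EFin \o h : R -> \bar R) by exact/measurable_EFinP.
rewrite integralE [RHS]integralE; congr (_ - _)%E.
  rewrite (@ge0_integral_distribution _ _ _ _ _ (leb01 R) X)//; last first.
    exact: measurable_funepos.
  by apply: eq_integral => m _; rewrite /= !funeposE.
rewrite (@ge0_integral_distribution _ _ _ _ _ (leb01 R) X)//; last first.
  exact: measurable_funeneg.
by apply: eq_integral => m _; rewrite /= !funenegE.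
Qed.

Lemma integral_law_ae X U (h : R -> R) : measurable_fun setT (h : R -> R) ->
  U = h \o X %[ae leb01 R] -> \int[law X]_x h x = \int[leb01 R]_m U m.
Proof.
move=> mh UE; rewrite integral_law//; congr fine; apply: ae_eq_integral => //.
- apply/measurable_EFinP; apply: measurableT_comp => //; exact: measurable_funPT.
- by apply/measurable_EFinP; exact: measurable_funPT.
- by apply: filterS UE => m /= + mT => -> .
Qed.

Lemma velocity_energy X V (w : R -> R) : is_velocity X V w ->
  (\int[law X]_x (w x ^+ 2)%:E)%E = (Lp_norm V ^+ 2)%:E.
Proof.
move=> wV; have mw := velocity_measurable wV; have [_ VE] := wV.
have mw2 : measurable_fun setT (fun x : R => (w x ^+ 2)%:E).
  by apply/measurable_EFinP; exact: measurable_funX.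
rewrite (@ge0_integral_distribution _ _ _ _ _ (leb01 R) X)//; last first.
  by move=> y; rewrite lee_fin sqr_ge0.
rewrite -L2_norm_sqE; apply: ae_eq_integral => //.
- apply: measurableT_comp => //; exact: measurable_funPT.
- by apply/measurable_EFinP; apply: measurable_funX; exact: measurable_funPT.
- by apply: filterS VE => m /= + mT => ->.
Qed.

Lemma law_second_moment X : finite_second_moment (law X).
Proof.
rewrite /finite_second_moment.
have mw2 : measurable_fun setT (fun x : R => (x ^+ 2)%:E).
  by apply/measurable_EFinP; exact: measurable_funX.
rewrite (@ge0_integral_distribution _ _ _ _ _ (leb01 R) X)//; last first.
  by move=> y; rewrite lee_fin sqr_ge0.
apply: (@le_lt_trans _ _ (Lp_norm X ^+ 2)%:E); last exact: ltry.
by rewrite -L2_norm_sqE.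
Qed.

End laws.
Section pairings.
Context {R : realType}.
Implicit Types (U V : L2 R) (W G A B : R -> L2 R).
Local Notation lebR := (@lebesgue_measure R).

Lemma L2_inner_expand (u w U V : L2 R) : L2_inner u w - L2_inner U V =
  L2_inner (u - U) (w - V) + L2_inner (u - U) V + L2_inner U (w - V).
Proof. by rewrite !L2_innerBl !L2_innerBr; ring. Qed.

Lemma L2_inner_cvg2 {T : Type} (F : set_system T) {FF : Filter F}
    (u w : T -> L2 R) U V : u @ F --> U -> w @ F --> V ->
  L2_inner (u s) (w s) @[s --> F] --> L2_inner U V.
Proof.
move=> uU wV; have uV := @L2_inner_cvg _ _ F FF u U V uU.
have wU := @L2_inner_cvg _ _ F FF w V U wV.
apply/cvgrPdist_lt => e e0; have e3 : 0 < e / 3 by rewrite divr_gt0.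
have /L2_cvgP/(_ 1 ltr01) u1 := uU; have /L2_cvgP/(_ _ e3) we := wV.
have /cvgrPdist_lt/(_ _ e3) uVe := uV; have /cvgrPdist_lt/(_ _ e3) wUe := wU.
apply: filterS (filterI (filterI u1 we) (filterI uVe wUe)) => s [[h1 h2] [h3 h4]].
rewrite distrC L2_inner_expand.
have h5 : `|L2_inner (u s - U) (w s - V)| <= e / 3.
  rewrite (le_trans (L2_cauchy_schwarz_abs _ _))// -[leRHS]mul1r.
  by rewrite ler_pM ?L2_norm_ge0// ltW.
have h6 : `|L2_inner (u s - U) V| < e / 3 by rewrite L2_innerBl distrC.
have h7 : `|L2_inner U (w s - V)| < e / 3 by rewrite L2_innerC L2_innerBl distrC.
apply: le_lt_trans (ler_normD _ _) _.
apply: le_lt_trans (lerD (ler_normD _ _) (lexx _)) _.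
real_lra.
Qed.

(** The product rule, in the form in which [right_primitive] takes a derivative. *)
Lemma has_right_deriv_pairing W A (t : R) U V (e : R) :
  has_right_deriv W t U -> has_right_deriv A t V -> 0 < e ->
  \forall s \near t^'+,
    `|L2_inner (W s) (A s) - L2_inner (W t) (A t) -
      (L2_inner U (A t) + L2_inner (W t) V) * (s - t)| <= e * (s - t).
Proof.
move=> /has_right_derivP WU /has_right_derivP AV e0.
have e3 : 0 < e / 3 by rewrite divr_gt0.
have A1 : 0 < Lp_norm (A t) + 1 by rewrite ltr_wpDl ?L2_norm_ge0.
have W1 : 0 < Lp_norm (W t) + 1 by rewrite ltr_wpDl ?L2_norm_ge0.
have U1 : 0 < Lp_norm U + 1 by rewrite ltr_wpDl ?L2_norm_ge0.
have V1 : 0 < Lp_norm V + 1 by rewrite ltr_wpDl ?L2_norm_ge0.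
have UV1 : 0 < (Lp_norm U + 1) * (Lp_norm V + 1) by rewrite mulr_gt0.
have small : \forall s \near t^'+, t < s < t + e / 3 / ((Lp_norm U + 1) * (Lp_norm V + 1)).
  apply/near_rightP; exists (e / 3 / ((Lp_norm U + 1) * (Lp_norm V + 1))).
    by rewrite divr_gt0.
  by move=> s -> ->.
apply: filterS (filterI small (filterI (filterI (WU _ ltr01) (AV _ ltr01))
  (filterI (WU _ (divr_gt0 e3 A1)) (AV _ (divr_gt0 e3 W1))))).
move=> s [/andP[ts sd] [[w1 a1] [we ae_]]].
have h0 : 0 < s - t by rewrite subr_gt0.
have {sd} : s - t < e / 3 / ((Lp_norm U + 1) * (Lp_norm V + 1)) by rewrite ltrBlDl.
rewrite ltr_pdivlMr// => hd.
move: (s - t) h0 hd w1 a1 we ae_ => h h0 hd w1 a1 we ae_.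
have incr (Z Z0 Z' : L2 R) : Lp_norm (Z - Z0 - h *: Z') <= 1 * h ->
    Lp_norm (Z - Z0) <= h * (Lp_norm Z' + 1).
  move=> hZ; have := L2_norm_triangle (Z - Z0 - h *: Z') (h *: Z').
  rewrite subrK L2_normZ (gtr0_norm h0) => /le_trans; apply.
  by rewrite mulrDr mulr1 addrC lerD2l -[leRHS]mul1r.
have -> : L2_inner (W s) (A s) - L2_inner (W t) (A t) -
    (L2_inner U (A t) + L2_inner (W t) V) * h =
    L2_inner (W s - W t) (A s - A t) + L2_inner (W s - W t - h *: U) (A t) +
    L2_inner (W t) (A s - A t - h *: V).
  rewrite L2_inner_expand [L2_inner (W s - W t - _) _]L2_innerBl L2_innerZl.
  by rewrite [L2_inner _ (A s - A t - _)]L2_innerBr L2_innerZr; ring.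
have h1 : `|L2_inner (W s - W t) (A s - A t)| <= e / 3 * h.
  apply: le_trans (L2_cauchy_schwarz_abs _ _) _.
  apply: le_trans (ler_pM _ _ (incr _ _ _ w1) (incr _ _ _ a1)) _; rewrite ?L2_norm_ge0//.
  by rewrite [leLHS]mulrCA [leLHS]mulrC ler_wpM2r ?(ltW h0)// -mulrA ltW.
have h2 : `|L2_inner (W s - W t - h *: U) (A t)| <= e / 3 * h.
  apply: le_trans (L2_cauchy_schwarz_abs _ _) _.
  apply: (@le_trans _ _ (e / 3 / (Lp_norm (A t) + 1) * h * (Lp_norm (A t) + 1))).
    by rewrite ler_pM ?L2_norm_ge0// lerDl.
  by rewrite mulrAC mulfVK ?gt_eqF.
have h3 : `|L2_inner (W t) (A s - A t - h *: V)| <= e / 3 * h.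
  rewrite L2_innerC; apply: le_trans (L2_cauchy_schwarz_abs _ _) _.
  apply: (@le_trans _ _ (e / 3 / (Lp_norm (W t) + 1) * h * (Lp_norm (W t) + 1))).
    by rewrite ler_pM ?L2_norm_ge0// lerDl.
  by rewrite mulrAC mulfVK ?gt_eqF.
apply: le_trans (ler_normD _ _) _.
apply: le_trans (lerD (ler_normD _ _) (lexx _)) _.
apply: le_trans (lerD (lerD h1 h2) h3) _.
by rewrite le_eqVlt; apply/orP; left; apply/eqP; field.
Qed.

(** The product [<W, A>] vanishes for small and large times when [A] does, so
    its right derivative integrates to zero. *)
Lemma pairing_integral (W G A B : R -> L2 R) (D : set R) (a b M : R) :
  0 < a -> a <= b -> countable D ->
  (forall t : R, 0 < t -> W s @[s --> t] --> W t) ->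
  (forall t : R, 0 < t -> A s @[s --> t] --> A t) ->
  (forall t : R, 0 < t -> has_right_deriv W t (G t)) ->
  (forall t : R, 0 < t -> has_right_deriv A t (B t)) ->
  (forall t : R, 0 < t -> G s @[s --> t^'+] --> G t) ->
  (forall t : R, 0 < t -> B s @[s --> t^'+] --> B t) ->
  (forall t : R, 0 < t -> ~ D t -> G s @[s --> t] --> G t) ->
  (forall t : R, 0 < t -> ~ D t -> B s @[s --> t] --> B t) ->
  (forall t : R, a <= t -> t <= b -> [/\ Lp_norm (W t) <= M, Lp_norm (G t) <= M,
    Lp_norm (A t) <= M & Lp_norm (B t) <= M]) ->
  (forall t : R, t <= a \/ b <= t -> A t = 0 /\ B t = 0) ->
  let p (t : R) := L2_inner (G t) (A t) + L2_inner (W t) (B t) in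
  lebR.-integrable `]0, +oo[ (EFin \o p) /\
  \int[lebR]_(t in `]0, +oo[) p t = 0.
Proof.
move=> a0 ab cD cW cA dW dA Gr Br Gc Bc bnd AB0 p.
have pos (t : R) : a <= t -> 0 < t by exact: lt_le_trans.
have cvg_left (Z : R -> L2 R) t : Z s @[s --> t] --> Z t ->
    Z s @[s --> t^'-] --> Z t.
  by move=> Zt; apply: cvg_trans Zt; apply: cvg_app; exact: cvg_within.
have cvg_right (Z : R -> L2 R) t : Z s @[s --> t] --> Z t ->
    Z s @[s --> t^'+] --> Z t.
  by move=> Zt; apply: cvg_trans Zt; apply: cvg_app; exact: cvg_within.
have mp : measurable_fun (`[a, b]%classic : set (measurableTypeR R)) p.
  apply: continuous_off_countable_measurable cD _ => // t /=.
  rewrite in_itv/= => /andP[/pos t0 _] Dt.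
  apply: cvgD; apply: L2_inner_cvg2; [exact: Gc|exact: cA|exact: cW|exact: Bc].
have pM t : a <= t -> t <= b -> `|p t| <= M ^+ 2 + M ^+ 2.
  move=> at_ tb; have [h1 h2 h3 h4] := bnd t at_ tb.
  rewrite (le_trans (ler_normD _ _))// !expr2 lerD//.
    by rewrite (le_trans (L2_cauchy_schwarz_abs _ _))// ler_pM ?L2_norm_ge0.
  by rewrite (le_trans (L2_cauchy_schwarz_abs _ _))// ler_pM ?L2_norm_ge0.
have [|||ip E] := @right_primitive R a b (M ^+ 2 + M ^+ 2)
    (fun t => L2_inner (W t) (A t)) p ab _ _ _ pM mp.
- move=> t at_ tb; have t0 : 0 < t by exact: lt_trans at_.
  by apply: L2_inner_cvg2; apply: cvg_left; [exact: cW|exact: cA].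
- move=> t /pos t0 tb e e0; exact: has_right_deriv_pairing (dW _ t0) (dA _ t0) e0.
- move=> t /pos t0 tb.
  apply: cvgD; apply: L2_inner_cvg2; [exact: Gr|apply: cvg_right; exact: cA|
    apply: cvg_right; exact: cW|exact: Br].
have p0 (t : R) : 0 < t -> t < a \/ b < t -> p t = 0.
  move=> t0 tab; have [|At0 Bt0] := AB0 t; first by case: tab => /ltW; [left|right].
  by rewrite /p At0 Bt0 !L2_inner0r addr0.
have [ip' ->] := integrable_half_line a0 p0 ip; split=> //.
have [|Ab _] := AB0 b; first by right.
have [|Aa _] := AB0 a; first by left.
by rewrite -E Ab Aa !L2_inner0r subrr.
Qed.

End pairings.

(** * The equations of the pushed-forward flow *)

Section curves.
Context {R : realType}.
Implicit Types (X V : R -> L2 R) (U : L2 R).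

Lemma locally_lipschitz_continuous X (t : R) : locally_lipschitz_curve X ->
  0 < t -> X s @[s --> t] --> X t.
Proof.
move=> XL t0; apply/L2_cvgP => e e0.
have t1 : 0 < t + 1 by rewrite addr_gt0.
have [L LP] := XL _ t1; have L1 : 0 < `|L| + 1 by rewrite ltr_wpDl.
apply/(near_nbhsP t); exists (Num.min (Num.min t 1) (e / (`|L| + 1))).
  by rewrite !lt_min t0 ltr01 divr_gt0.
move=> s; rewrite !lt_min ltr_pdivlMr// => /andP[/andP[st st1] se].
have sI : s \in `[0, t + 1].
  by move: st st1; rewrite in_itv/= !ltr_norml => /andP[? _] /andP[_ ?]; lra.
have tI : t \in `[0, t + 1] by rewrite in_itv/= (ltW t0) lerDl ler01.
apply: le_lt_trans (LP _ _ tI sI) _; apply: le_lt_trans se.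
by rewrite mulrC ler_wpM2l// (le_trans (ler_norm L))// lerDl.
Qed.

Lemma locally_lipschitz_bounded X (T : R) : locally_lipschitz_curve X ->
  exists M : R, forall t, 0 <= t -> t <= T -> Lp_norm (X t) <= M.
Proof.
move=> XL; have T1 : 0 < `|T| + 1 by rewrite ltr_wpDl.
have [L LP] := XL _ T1; exists (Lp_norm (X 0) + `|L| * (`|T| + 1)) => t t0 tT.
have tT' : t <= `|T| + 1 by rewrite (le_trans tT)// (le_trans (ler_norm _))// lerDl.
have I0 : 0 \in `[0, `|T| + 1] by rewrite in_itv/= lexx (ltW T1).
have It : t \in `[0, `|T| + 1] by rewrite in_itv/= t0.
have := L2_norm_triangle (X 0) (X t - X 0); rewrite subrKC => /le_trans; apply.
rewrite lerD2l (le_trans (LP _ _ I0 It))// subr0 (ger0_norm t0).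
by rewrite (@le_trans _ _ (`|L| * t)) ?ler_wpM2r ?ler_norm// ler_wpM2l.
Qed.

Lemma locally_lipschitz_right_deriv_bounded X V (T : R) :
  locally_lipschitz_curve X ->
  (forall t : R, 0 <= t -> has_right_deriv X t (V t)) ->
  exists M : R, forall t, 0 <= t -> t <= T -> Lp_norm (V t) <= M.
Proof.
move=> XL XV; have T1 : 0 < `|T| + 1 by rewrite ltr_wpDl.
have [L LP] := XL _ T1; exists L => t t0 tT.
apply: (has_right_deriv_norm_le (XV t t0)).
have tT' : t < `|T| + 1 by rewrite (le_lt_trans tT)// (le_lt_trans (ler_norm _))// ltrDl.
apply/near_rightP; exists (`|T| + 1 - t); first by rewrite subr_gt0.
move=> s ts sT; have sT' : s <= `|T| + 1 by rewrite ltW//; move: sT; rewrite subrKC.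
have := LP t s; rewrite !in_itv/= t0 (ltW tT') sT' (le_trans t0 (ltW ts)).
by rewrite (gtr0_norm (_ : 0 < s - t)) ?subr_gt0//; apply.
Qed.

Lemma has_right_deriv_cst U (t : R) : has_right_deriv (fun=> U) t 0.
Proof.
apply/has_right_derivP => e e0; apply/near_rightP; exists 1 => // s ts _.
by rewrite scaler0 subr0 subrr Lp_norm0 mulr_ge0 ?subr_ge0 ?ltW.
Qed.

Lemma measurable_affine (f g h : R -> R) : measurable_fun setT (f : R -> R) ->
  measurable_fun setT (g : R -> R) -> measurable_fun setT (h : R -> R) ->
  measurable_fun setT (fun x : R => f x + g x * h x).
Proof.
by move=> mf mg mh; apply: measurable_funD => //; exact: measurable_funM.
Qed.

Lemma measurable_affine_mul (f g h : R -> R) : measurable_fun setT (f : R -> R) ->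
  measurable_fun setT (g : R -> R) -> measurable_fun setT (h : R -> R) ->
  measurable_fun setT (fun x : R => g x * f x + g x ^+ 2 * h x).
Proof.
move=> mf mg mh; apply: measurable_affine => //; first exact: measurable_funM.
exact: measurable_funX.
Qed.

End curves.

Section flow_equations.
Context {R : realType}.
Local Notation lebR := (@lebesgue_measure R).
Variables (F : L2 R -> L2 R) (X Y V : R -> L2 R) (v : R -> R -> R) (D : set R).
Hypothesis KX : forall t : R, 0 <= t -> monotone_cone (X t).
Hypothesis XL : locally_lipschitz_curve X.
Hypothesis YL : locally_lipschitz_curve Y.
Hypothesis XV : forall t : R, 0 <= t -> has_right_deriv X t (V t).
Hypothesis Vr : forall t : R, 0 <= t -> V s @[s --> t^'+] --> V t.
Hypothesis YF : forall t : R, 0 <= t -> has_right_deriv Y t (F (X t)).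
Hypothesis Fc : forall t : R, 0 < t -> F (X s) @[s --> t] --> F (X t).
Hypothesis NV : forall t : R, 0 <= t -> normal_cone (X t) (Y t - V t).
Hypothesis cD : countable D.
Hypothesis Vc : forall t : R, 0 < t -> ~ D t -> V s @[s --> t] --> V t.
Hypothesis Vv : forall t : R, 0 < t -> ~ D t -> is_velocity (X t) (V t) (v t).

Let rho t := law (X t).

(** The energy is locally bounded, and continuous off the countable set [D]. *)
Lemma flow_energy : locally_finite_energy rho v.
Proof.
split.
  have [N [mN N0 DN]] := countable_negligible cD.
  exists N; split=> // t /= h; apply: DN; apply: contrapT => Dt; apply: h => t0.
  by have [] := Vv t0 Dt.
move=> a b a0 ab; have [M MP] := locally_lipschitz_right_deriv_bounded b XL XV.
have bnd t : a <= t -> t <= b -> `|Lp_norm (V t) ^+ 2| <= M ^+ 2.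
  move=> at_ tb; have t0 : 0 <= t by rewrite (le_trans (ltW a0)).
  rewrite ger0_norm ?sqr_ge0// ler_pXn2r ?nnegrE ?L2_norm_ge0 ?MP//.
  exact: le_trans (L2_norm_ge0 _) (MP t t0 tb).
have mV : measurable_fun (`[a, b]%classic : set (measurableTypeR R))
    (fun t => Lp_norm (V t) ^+ 2).
  apply: continuous_off_countable_measurable cD _ => // t /=.
  rewrite in_itv/= => /andP[at_ _] Dt; have t0 : 0 < t by exact: lt_le_trans at_.
  under eq_fun do rewrite L2_norm_sq.
  by rewrite L2_norm_sq; apply: L2_inner_cvg2; exact: Vc.
have iV := bounded_integrable mV bnd.
apply: (integrable_countable _ cD _ iV).1 => // t /=.
rewrite in_itv/= => /andP[at_ _] Dt; have t0 : 0 < t by exact: lt_le_trans at_.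
by rewrite (velocity_energy (Vv t0 Dt)).
Qed.

Section test_function.
Variable phi : R * R -> R.
Hypothesis phiT : space_time_test phi.

Let phit (t x : R) : R := 'D_(1, 0) phi (t, x).
Let phix (t x : R) : R := 'D_(0, 1) phi (t, x).

(** All that the weak formulations use of the test function: the curves of the
    compositions [phi t (X t)] and of their time derivatives. *)
Lemma test_curves : exists (A B : R -> L2 R) (a b C : R),
  [/\ [/\ 0 < a, a <= b &
        forall t : R, t <= a \/ b <= t -> A t = 0 /\ B t = 0],
      (forall t, A t =1 (fun m => phi (t, X t m))) /\
      (forall t, B t =1 (fun m => phit t (X t m) + V t m * phix t (X t m))),
      [/\ forall t, Lp_norm (A t) <= C,
          forall t, Lp_norm (B t) <= C + C * Lp_norm (V t) &
          forall t : R, measurable_fun setT (phit t : R -> R) /\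
            measurable_fun setT (phix t : R -> R)],
      [/\ forall t : R, 0 < t -> A s @[s --> t] --> A t &
          forall t : R, 0 < t -> has_right_deriv A t (B t)] &
      [/\ forall t : R, 0 < t -> B s @[s --> t^'+] --> B t &
          forall t : R, 0 < t -> ~ D t -> B s @[s --> t] --> B t]].
Proof.
have [C [K [K0 [pC ptC pxC] [pK ptK pxK] dpt dpx]]] := space_time_test_bounds phiT.
have [a [b [a0 ab zero]]] := space_time_test_support phiT.
have sec_lip (f : R -> R -> R) : (forall s t x y : R,
    `|f s x - f t y| <= K * (`|s - t| + `|x - y|)) ->
    forall t, measurable_fun setT (f t : R -> R).
  move=> fK t; apply: continuous_measurable_fun.
  apply: (lipschitz_continuous (K := K)) => x y.
  by have := fK t t x y; rewrite subrr normr0 add0r.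
have mt := sec_lip _ ptK; have mx := sec_lip _ pxK.
have [A [B [AE BE]]] := @test_curve_ex R (fun t x => phi (t, x)) phit phix C X V
  (sec_lip _ pK) mt mx pC ptC pxC.
have C0 : 0 <= C by exact: le_trans (pC 0 0).
exists A, B, a, b, C; split.
- split=> // [|t tab]; first exact: ltW.
  split; apply/LfuneqP => m; rewrite ?AE ?BE /phit /phix.
    by have [->] := zero t (X t m) tab.
  by have [_ -> ->] := zero t (X t m) tab; rewrite mulr0 addr0.
- by [].
- split=> [t|t|t]; last by split; [exact: mt|exact: mx].
    apply: (@le_trans _ _ (Lp_norm (C *: unit_L2 : L2 R))).
      by apply: L2_norm_le => m; rewrite L2E AE mulr1 (ger0_norm C0); exact: pC.
    by rewrite L2_normZ unit_L2_norm mulr1 (ger0_norm C0).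
  exact: (@test_curve_velocity_norm _ (fun t x => phi (t, x)) _ _ _ pC ptC pxC _ _ _ BE).
- split=> t t0.
    have /L2_cvgP Xc := locally_lipschitz_continuous XL t0.
    apply/L2_cvgP => e e0; have K1 : 0 < K + 1 by rewrite ltr_wpDl.
    have e2 : 0 < e / 2 / (K + 1) by rewrite !divr_gt0.
    have st : \forall s \near t, `|s - t| < e / 2 / (K + 1).
      by apply/(near_nbhsP t); exists (e / 2 / (K + 1)).
    apply: filterS (filterI st (Xc _ e2)) => s [].
    rewrite !(ltr_pdivlMr _ _ K1) => h1 h2.
    apply: le_lt_trans (@test_curve_dist _ (fun t x => phi (t, x)) _ K0 pK _ _ AE s t) _.
    have h3 : K * (`|s - t| + Lp_norm (X s - X t)) <=
        (`|s - t| + Lp_norm (X s - X t)) * (K + 1).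
      by rewrite mulrC ler_wpM2l ?lerDl// addr_ge0// L2_norm_ge0.
    by apply: le_lt_trans h3 _; rewrite mulrDl [e]splitr; exact: ltrD.
  exact: (@test_curve_right_deriv _ (fun t x => phi (t, x)) _ _ _ _ K0 pC pxC
    pK ptK dpt dpx _ _ _ _ AE BE _ (XV (ltW t0))).
- split=> t t0; [|move=> Dt].
    apply: (@test_curve_velocity_cvg _ (fun t x => phi (t, x)) _ _ _ _ K0 pC pxC ptK pxK _ _ _ BE) => //.
    + by apply: cvg_at_right_filter; exact: cvg_id.
    + by apply: cvg_at_right_filter; exact: locally_lipschitz_continuous.
    + exact: Vr (ltW t0).
  apply: (@test_curve_velocity_cvg _ (fun t x => phi (t, x)) _ _ _ _ K0 pC pxC ptK pxK _ _ _ BE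
    (nbhs t) _ t).
  - exact: cvg_id.
  - exact: locally_lipschitz_continuous.
  - exact: Vc.
Qed.

(** The constraint enters through the last identity: [Y t - V t] is normal to the
    cone, hence orthogonal to the functions of [X t], so [V t] may be replaced by
    [Y t], whose derivative is the force. *)
Lemma velocity_pairing (t : R) (B : L2 R) : 0 < t -> ~ D t ->
  measurable_fun setT (phit t : R -> R) -> measurable_fun setT (phix t : R -> R) ->
  B =1 (fun m => phit t (X t m) + V t m * phix t (X t m)) ->
  [/\ \int[rho t]_x (phit t x + v t x * phix t x) = L2_inner unit_L2 B,
      \int[rho t]_x (v t x * phit t x + v t x ^+ 2 * phix t x) =
        L2_inner (V t) B &
      L2_inner (V t) B = L2_inner (Y t) B].
Proof.
move=> t0 Dt mt mx BE; have vV := Vv t0 Dt.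
have mv := velocity_measurable vV; have [_ VE] := vV.
pose w (x : R) : R := phit t x + v t x * phix t x.
have mw : measurable_fun setT (w : R -> R) := measurable_affine mt mv mx.
have Bw : B = w \o X t %[ae leb01 R].
  by apply: filterS VE => m VEm mT; rewrite BE VEm.
split.
- by rewrite (integral_law_ae mw Bw) L2_inner_unit.
- have mw2 := measurable_affine_mul mt mv mx.
  rewrite (integral_law (X t) mw2).
  congr fine; apply: ae_eq_integral => //.
  + apply/measurable_EFinP.
    exact: measurableT_comp mw2 (measurable_funPT _).
  + exact: (measurable_int (leb01 R) (L2_integrableM _ _)).
  + apply: filterS VE => m VEm mT; rewrite BE VEm//=; congr EFin.
    by rewrite mulrDr expr2 mulrA.
- apply/esym/eqP; rewrite -subr_eq0 -L2_innerBl; apply/eqP.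
  exact: normal_cone_orthogonal_comp (KX (ltW t0)) (NV (ltW t0)) mw Bw.
Qed.

(** The inner product of [unit_L2] and [phi(t, X t)] is the integral of the test
    function against the law of [X t]. *)
Lemma flow_continuity :
  let pairing (t : R) := \int[rho t]_x (phit t x + v t x * phix t x) in
  lebR.-integrable `]0, +oo[ (EFin \o pairing) /\
  \int[lebR]_(t in `]0, +oo[) pairing t = 0.
Proof.
have [A [B [a [b [C [[a0 ab AB0] [_ BE] [AC BC mtx] [Ac Ad] [Br Bc]]]]]]] := test_curves.
have [M MP] := locally_lipschitz_right_deriv_bounded b XL XV.
have C0 : 0 <= C by exact: le_trans (L2_norm_ge0 _) (AC 0).
have pos (t : R) : a <= t -> 0 < t by exact: lt_le_trans.
have [] := @pairing_integral R (fun=> unit_L2) (fun=> 0) A B D a b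
    (1 + C + C * M) a0 ab cD.
- by move=> t _; exact: cvg_cst.
- exact: Ac.
- by move=> t _; exact: has_right_deriv_cst.
- exact: Ad.
- by move=> t _; exact: cvg_cst.
- exact: Br.
- by move=> t _ _; exact: cvg_cst.
- exact: Bc.
- move=> t /pos t0 tb; have VM := MP t (ltW t0) tb.
  have CM : 0 <= C * M by rewrite mulr_ge0// (le_trans (L2_norm_ge0 (V t))).
  rewrite unit_L2_norm Lp_norm0; split.
  + by rewrite -addrA lerDl addr_ge0.
  + by rewrite !addr_ge0.
  + by rewrite (le_trans (AC t))// addrAC lerDr addr_ge0.
  + rewrite (le_trans (BC t))// -addrA ler_wpDl// lerD2l ler_wpM2l//.
- exact: AB0.
move=> ip E pairing.
have moo : measurable (`]0, +oo[%classic : set (measurableTypeR R)) by [].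
have [|ip' E'] := integrable_countable (g := EFin \o pairing) moo cD _ ip.
  move=> t /=; rewrite in_itv/= andbT => t0 Dt; have [mt mx] := mtx t.
  have [E1 _ _] := velocity_pairing t0 Dt mt mx (BE t).
  by rewrite /pairing E1 L2_inner0l add0r.
by split=> //; rewrite /Rintegral -E'.
Qed.

(** Here [phi(t, X t)] is paired with [Y t]; the derivative of [Y] gives the source. *)
Lemma flow_momentum (source : R -> R) :
  (forall t : R, 0 < t ->
    source t = \int[leb01 R]_m (phi (t, X t m) * F (X t) m)) ->
  (forall T : R, exists M : R, forall t, 0 <= t -> t <= T -> Lp_norm (F (X t)) <= M) ->
  let pairing (t : R) :=
    \int[rho t]_x (v t x * phit t x + v t x ^+ 2 * phix t x) in
  [/\ lebR.-integrable `]0, +oo[ (EFin \o pairing),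
      lebR.-integrable `]0, +oo[ (EFin \o source) &
      - (\int[lebR]_(t in `]0, +oo[) pairing t) =
      \int[lebR]_(t in `]0, +oo[) source t].
Proof.
move=> sourceE Fb.
have [A [B [a [b [C [[a0 ab AB0] [AE BE] [AC BC mtx] [Ac Ad] [Br Bc]]]]]]] := test_curves.
have [M MP] := locally_lipschitz_right_deriv_bounded b XL XV.
have [M' M'P] := locally_lipschitz_bounded b YL.
have [N NP] := Fb b.
have C0 : 0 <= C by exact: le_trans (L2_norm_ge0 _) (AC 0).
have pos (t : R) : a <= t -> 0 < t by exact: lt_le_trans.
have sE (t : R) : 0 < t -> L2_inner (F (X t)) (A t) = source t.
  move=> t0; rewrite sourceE//; apply: eq_Rintegral => m _.
  by rewrite AE mulrC.
have b0 : 0 <= b by exact: le_trans (ltW a0) ab.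
have M0 : 0 <= M by exact: le_trans (L2_norm_ge0 _) (MP b b0 (lexx _)).
have M'0 : 0 <= M' by exact: le_trans (L2_norm_ge0 _) (M'P b b0 (lexx _)).
have N0 : 0 <= N by exact: le_trans (L2_norm_ge0 _) (NP b b0 (lexx _)).
have CM : 0 <= C * M by exact: mulr_ge0.
have [] := @pairing_integral R Y (fun t => F (X t)) A B D a b
    (M' + N + C + C * M) a0 ab cD.
- by move=> t; exact: locally_lipschitz_continuous.
- exact: Ac.
- by move=> t /ltW; exact: YF.
- exact: Ad.
- by move=> t t0; apply: cvg_at_right_filter; exact: Fc.
- exact: Br.
- by move=> t t0 _; exact: Fc.
- exact: Bc.
- move=> t /pos t0 tb; split.
  + by rewrite (le_trans (M'P t (ltW t0) tb))// -!addrA lerDl !addr_ge0.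
  + by rewrite (le_trans (NP t (ltW t0) tb))// -!addrA ler_wpDl// lerDl !addr_ge0.
  + by rewrite (le_trans (AC t))// -addrA ler_wpDl ?addr_ge0// lerDl.
  + rewrite (le_trans (BC t))// -addrA ler_wpDl ?addr_ge0// lerD2l ler_wpM2l//.
    exact: MP (ltW t0) tb.
- exact: AB0.
move=> ip E pairing.
have moo : measurable (`]0, +oo[%classic : set (measurableTypeR R)) by [].
have cont_source (t : R) : 0 < t ->
    L2_inner (F (X s)) (A s) @[s --> t] --> L2_inner (F (X t)) (A t).
  by move=> t0; apply: L2_inner_cvg2; [exact: Fc|exact: Ac].
have mS : measurable_fun (`[a, b]%classic : set (measurableTypeR R))
    (fun t => L2_inner (F (X t)) (A t)).
  apply: continuous_off_countable_measurable cD _ => // t /=.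
  by rewrite in_itv/= => /andP[/pos t0 _] _; exact: cont_source.
have bS (t : R) : a <= t -> t <= b -> `|L2_inner (F (X t)) (A t)| <= N * C.
  move=> /pos t0 tb; rewrite (le_trans (L2_cauchy_schwarz_abs _ _))//.
  by rewrite ler_pM ?L2_norm_ge0// NP ?(ltW t0).
have zS (t : R) : 0 < t -> t < a \/ b < t -> L2_inner (F (X t)) (A t) = 0.
  move=> t0 tab; have [|-> _] := AB0 t; first by case: tab => /ltW; [left|right].
  by rewrite L2_inner0r.
have [iS _] := integrable_half_line a0 zS (bounded_integrable mS bS).
have [|iS' ES] := integrable_countable (g := EFin \o source) moo (@countable0 R) _ iS.
  by move=> t /=; rewrite in_itv/= andbT => t0 _; rewrite sE.
have iB := integrableB moo ip iS.
have [|ip' E'] := integrable_countable (g := EFin \o pairing) moo cD _ iB.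
  move=> t /=; rewrite in_itv/= andbT => t0 Dt; have [mt mx] := mtx t.
  have [_ E1 E2] := velocity_pairing t0 Dt mt mx (BE t).
  by rewrite /pairing E1 E2 -EFinB addrAC subrr add0r.
split=> //.
have -> : \int[lebR]_(t in `]0, +oo[) source t =
    \int[lebR]_(t in `]0, +oo[) L2_inner (F (X t)) (A t) by rewrite /Rintegral -ES.
have -> : \int[lebR]_(t in `]0, +oo[) pairing t = 0 -
    \int[lebR]_(t in `]0, +oo[) L2_inner (F (X t)) (A t).
  by rewrite -[X in X - _]E -(RintegralB moo ip iS) /Rintegral -E'.
by rewrite sub0r opprK.
Qed.

End test_function.

End flow_equations.

(** * Initial traces *)

Section wasserstein.
Context {R : realType}.
Implicit Types X Z : L2 R.

(** The law of the pair is a coupling of the two laws. *)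
Lemma wasserstein2_law X Z :
  (wasserstein2 (law X) (law Z) <= (Lp_norm (X - Z))%:E)%E.
Proof.
have mXZ : measurable_fun setT (fun m : measurableTypeR R => (X m, Z m)).
  by apply: measurable_fun_pair; exact: measurable_funPT.
pose XZ : {mfun measurableTypeR R >-> (R * R)%type} := mfun_Sub (mem_set mXZ).
pose gamma : probability (R * R)%type R := distribution (leb01 R) XZ.
have coupling : is_coupling (law X) (law Z) gamma.
  move=> A mA; split; rewrite /gamma /law /distribution /pushforward /=.
    by congr (leb01 R _); apply/seteqP; split=> [m []|m].
  by congr (leb01 R _); apply/seteqP; split=> [m []|m].
have cost : (\int[gamma]_z ((z.1 - z.2) ^+ 2)%:E)%E = (Lp_norm (X - Z) ^+ 2)%:E.
  rewrite (@ge0_integral_distribution _ _ _ _ _ (leb01 R) XZ)//.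
  - by rewrite -L2_norm_sqE; apply: eq_integral => m _.
  - apply/measurable_EFinP; apply: measurable_funX.
    by apply: measurable_funB; [exact: measurable_fst|exact: measurable_snd].
  - by move=> z; rewrite lee_fin sqr_ge0.
have -> : (Lp_norm (X - Z))%:E = ((Lp_norm (X - Z) ^+ 2)%:E `^ 2^-1)%E.
  by rewrite poweR12_sqrt ?lee_fin ?sqr_ge0//= sqrtr_sqr ger0_norm ?L2_norm_ge0.
have inf0 : (0 <= ereal_inf [set \int[g]_z ((z.1 - z.2) ^+ 2)%:E |
    g in is_coupling (law X) (law Z)])%E.
  apply: le_ereal_inf_tmp => _ [g _ <-]; apply: integral_ge0 => z _.
  by rewrite lee_fin sqr_ge0.
apply: gt0_ler_poweR; rewrite ?in_itv/= ?leey ?andbT ?lee_fin ?sqr_ge0//.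
by rewrite -cost; apply: ereal_inf_lbound; exists gamma.
Qed.

Lemma wasserstein2_cvg (F : set_system R) {FF : Filter F} (X : R -> L2 R) Z :
  X s @[s --> F] --> Z -> wasserstein2 (law (X s)) (law Z) @[s --> F] --> 0%E.
Proof.
move=> /L2_cvgP XZ.
apply: (@squeeze_cvge _ _ _ _ (cst 0%E) _ (fun s => (Lp_norm (X s - Z))%:E)).
- by apply: nearW => s; rewrite /= poweR_ge0 wasserstein2_law.
- exact: cvg_cst.
- apply: cvg_EFin; first exact: nearW.
  apply/cvgrPdist_lt => e e0; apply: filterS (XZ e e0) => s.
  by rewrite /= sub0r normrN ger0_norm ?L2_norm_ge0.
Qed.

End wasserstein.

Section momentum.
Context {R : realType}.
Implicit Types (U V W X Y Z : L2 R).

(** The momentum is the integral of [zeta(X s) * V s] over the unit interval, and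
    the variation of [zeta(X s)] is a small multiplier of [V0]. *)
Lemma momentum_cvg (F : set_system R) {FF : Filter F} (X V : R -> L2 R) X0 V0
    (w : R -> R -> R) (w0 zeta : R -> R) (M : R) :
  X s @[s --> F] --> X0 -> V s @[s --> F] --> V0 ->
  is_velocity X0 V0 w0 ->
  (\forall s \near F, is_velocity (X s) (V s) (w s)) ->
  continuous zeta -> (forall x, `|zeta x| <= M) ->
  \int[law (X s)]_x (zeta x * w s x) @[s --> F] -->
    \int[law X0]_x (zeta x * w0 x).
Proof.
move=> XX0 VV0 wV0 wV cz zM.
have mz : measurable_fun setT (zeta : R -> R) by exact: continuous_measurable_fun.
have M0 : 0 <= M by exact: le_trans (zM 0).
have mzX Z : measurable_fun setT (fun m : measurableTypeR R => zeta (Z m)).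
  exact: measurableT_comp mz (measurable_funPT Z).
have ex Z U : exists P : L2 R, P =1 (fun m => zeta (Z m) * U m).
  by have [m|P PE _] := bounded_mul_L2 U (mzX Z) (C := M); [exact: zM|exists P].
have momE Z U (u : R -> R) (P : L2 R) : is_velocity Z U u ->
    P =1 (fun m => zeta (Z m) * U m) ->
    \int[law Z]_x (zeta x * u x) = L2_inner unit_L2 P.
  move=> uU PE; have mu := velocity_measurable uU; have [_ UE] := uU.
  rewrite L2_inner_unit (@integral_law_ae _ Z P) //; first exact: measurable_funM.
  by apply: filterS UE => m Um mT; rewrite PE Um.
have /choice[P PE] : forall s, exists P : L2 R, P =1 (fun m => zeta (X s m) * V s m).
  by move=> s; exact: ex.
have [P0 P0E] := ex X0 V0.
have PP0 : P s @[s --> F] --> P0.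
  apply/L2_cvgP => e e0; have e2 := half_gt0 e0.
  have M1 : 0 < M + 1 by rewrite ltr_wpDl.
  have bM x z : 0 <= `|zeta z - zeta x| <= M + M.
    by rewrite normr_ge0 (le_trans (ler_normB _ _))// lerD.
  have b0 x : `|zeta z - zeta x| @[z --> x] --> (0 : R).
    apply/cvgrPdist_lt => d d0; have /cvgrPdist_lt/(_ _ d0) := cz x.
    by apply: filterS => z; rewrite /= sub0r normrN normr_id distrC.
  have [d d0 dP] := small_multiplier V0 X0 bM b0 e2.
  have /L2_cvgP/(_ _ d0) Xd := XX0.
  have /L2_cvgP/(_ _ (divr_gt0 e2 M1)) Vd := VV0.
  apply: filterS (filterI Xd Vd) => s [Xs]; rewrite ltr_pdivlMr// => Vs.
  have mQ : measurable_fun setT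
      (fun m : measurableTypeR R => zeta (X s m) - zeta (X0 m)).
    by apply: measurable_funB; exact: mzX.
  have [m|Q QE _] := bounded_mul_L2 V0 mQ (C := M + M).
    by have /andP[] := bM (X0 m) (X s m).
  have Qe : Lp_norm Q < e / 2.
    by apply: (dP (X s)) => // m; rewrite QE normrM.
  apply: (@le_lt_trans _ _ (Lp_norm (M *: (V s - V0)) + Lp_norm Q)).
    apply: L2_norm_le_add => m; rewrite !L2E PE P0E QE.
    rewrite (_ : _ - _ = zeta (X s m) * (V s m - V0 m) +
      (zeta (X s m) - zeta (X0 m)) * V0 m); last by ring.
    rewrite (le_trans (ler_normD _ _))// lerD2r !normrM ler_wpM2r//.
    by rewrite (ger0_norm M0).
  rewrite [ltRHS]splitr ltrD// L2_normZ (ger0_norm M0).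
  by rewrite (le_lt_trans _ Vs)// mulrC ler_wpM2l ?L2_norm_ge0// lerDl.
rewrite (momE _ _ _ _ wV0 P0E).
have PPc : L2_inner unit_L2 (P s) @[s --> F] --> L2_inner unit_L2 P0.
  by apply: L2_inner_cvg2 PP0; exact: cvg_cst.
apply: cvg_trans PPc; apply: near_eq_cvg; apply: filterS wV => s ws.
by rewrite (momE _ _ _ _ ws (PE s)).
Qed.

(** The residual is orthogonal to the functions of [X], among them [Y]: by
    Pythagoras [V] is longer than [Y], unless they agree. *)
Lemma initial_velocity X Y V (w : R -> R) : monotone_cone X ->
  measurable_fun setT (w : R -> R) -> Y = w \o X %[ae leb01 R] ->
  normal_cone X (Y - V) ->
  (forall W, normal_cone X W -> Lp_norm V <= Lp_norm (Y - W)) ->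
  V = Y %[ae leb01 R].
Proof.
move=> KX mw YE NV Vmin; have WY := normal_cone_orthogonal_comp KX NV mw YE.
have N0 : normal_cone X 0 by move=> X' _; rewrite L2_inner0l.
have VY : Lp_norm V <= Lp_norm Y by have := Vmin _ N0; rewrite subr0.
apply/L2_dist_eq0P; rewrite Lp_norm_subC.
move: VY; rewrite -(@ler_pXn2r _ 2)// ?nnegrE ?L2_norm_ge0//.
rewrite -[in leLHS](subKr Y V) L2_norm_sq_sub (L2_innerC Y) WY mulr0 subr0.
by rewrite gerDl => h; apply/eqP; rewrite -sqrf_eq0 eq_le h sqr_ge0.
Qed.

End momentum.

Section tangent_cones.
Context {R : realType}.
Implicit Types (U V W X Y Z : L2 R).

Lemma tangent_cone_ae X X' V V' : X = X' %[ae leb01 R] -> V = V' %[ae leb01 R] ->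
  tangent_cone X V -> tangent_cone X' V'.
Proof.
move=> XX' VV' /tangent_coneP TV; apply/tangent_coneP => e /TV[theta [Z [th0 KZ VZ]]].
exists theta, Z; split=> //; rewrite (@L2_norm_ae _ _ (V - theta *: (Z - X)))//.
apply: filterS (filterI XX' VV') => m [Xm Vm] mT.
by rewrite !L2E (Xm mT) (Vm mT).
Qed.

(** The right derivative of a curve in the cone is a limit of tangent vectors. *)
Lemma right_deriv_tangent_cone (X : R -> L2 R) (t : R) V : 0 <= t ->
  (forall s : R, 0 <= s -> monotone_cone (X s)) -> has_right_deriv X t V ->
  tangent_cone (X t) V.
Proof.
move=> t0 KX /L2_cvgP XV; apply/tangent_coneP => e e0.
have /near_rightP[d d0 dP] := XV e e0.
have h0 : 0 < d / 2 by exact: half_gt0.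
exists (d / 2)^-1, (X (t + d / 2)); split.
- by rewrite invr_ge0 ltW.
- by apply: KX; rewrite addr_ge0// ltW.
- rewrite Lp_norm_subC; apply: dP => //.
  by rewrite add0r ltr_pdivrMr// ltr_pMr// ltr1n.
Qed.

End tangent_cones.

(** * The sticky solution *)

Section force_along_curve.
Context {R : realType}.
Variables (F : L2 R -> L2 R) (X : R -> L2 R).
Hypothesis hF : uniformly_continuous_force F.
Hypothesis KX : forall t : R, 0 <= t -> monotone_cone (X t).
Hypothesis XL : locally_lipschitz_curve X.

Lemma force_bounded (T : R) :
  exists M : R, forall t, 0 <= t -> t <= T -> Lp_norm (F (X t)) <= M.
Proof.
have [[C C0 FC] _] := hF; have [M MP] := locally_lipschitz_bounded T XL.
exists (C * (1 + M)) => t t0 tT; rewrite (le_trans (FC _ (KX t0)))//.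
by rewrite ler_wpM2l// lerD2l MP.
Qed.

Lemma force_continuous (t : R) : 0 <= t -> forall e : R, 0 < e ->
  exists2 d : R, 0 < d & forall s : R, 0 <= s -> `|s - t| < d ->
    Lp_norm (F (X s) - F (X t)) < e.
Proof.
move=> t0 e e0; have [_ [omega [_ comega omega0 _] FO]] := hF.
have z0 : `[0, +oo[%classic (0 : R) by rewrite /= in_itv/= lexx.
have /cvgrPdist_lt/(_ e e0) : omega r @[r --> within `[0, +oo[ (nbhs (0 : R))] --> omega 0.
  by have /subspace_continuousP/(_ 0 z0) := comega.
rewrite near_withinE => /(near_nbhsP 0 _).1.
move=> [d d0 dP]; have t1 : 0 < t + 1 by rewrite ltr_wpDl.
have [L LP] := XL t1; have L1 : 0 < `|L| + 1 by rewrite ltr_wpDl.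
exists (Num.min 1 (d / (`|L| + 1))); first by rewrite lt_min ltr01 divr_gt0.
move=> s s0; rewrite lt_min ltr_pdivlMr// => /andP[st1 std].
have XX : Lp_norm (X s - X t) < d.
  have sI : s \in `[0, t + 1].
    by rewrite in_itv/= s0; move: st1; rewrite ltr_norml => /andP[_]; lra.
  have tI : t \in `[0, t + 1] by rewrite in_itv/= t0 lerDl ler01.
  apply: le_lt_trans (LP _ _ tI sI) _; apply: le_lt_trans std.
  by rewrite mulrC ler_wpM2l// (le_trans (ler_norm L))// lerDl.
apply: le_lt_trans (FO _ _ (KX s0) (KX t0)) _.
have := dP (Lp_norm (X s - X t)); rewrite subr0 (ger0_norm (L2_norm_ge0 _)).
move=> /(_ XX); rewrite /= in_itv/= L2_norm_ge0 omega0 sub0r normrN => /(_ isT).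
exact: le_lt_trans (ler_norm _).
Qed.

Section integrated_force.
Variables (Y : R -> L2 R) (Vbar : L2 R).
Hypothesis YF : forall t : R, 0 <= t ->
  is_bochner_integral 0 t (fun s => F (X s)) (Y t - Vbar).

Lemma integrated_force_lipschitz : locally_lipschitz_curve Y.
Proof.
move=> T T0; have [M MP] := force_bounded T; exists M => s t.
rewrite !in_itv/= => /andP[s0 sT] /andP[t0 tT].
wlog st : s t s0 sT t0 tT / s <= t.
  move=> H; have [st|/ltW ts] := leP s t; first exact: H.
  by rewrite Lp_norm_subC distrC; exact: H.
have := @primitive_increment R (fun r => F (X r)) Y Vbar force_continuous YF s t M 0 s0 st.
rewrite scaler0 subr0 ger0_norm ?subr_ge0//; apply => r sr rt.
by rewrite subr0 MP// ?(le_trans rt)// (le_trans s0)// ltW.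
Qed.

Lemma integrated_force_right_deriv (t : R) : 0 <= t ->
  has_right_deriv Y t (F (X t)).
Proof.
move=> t0; apply/has_right_derivP => e e0.
have [d d0 dP] := force_continuous t0 e0.
apply/near_rightP; exists d => // s ts std.
apply: (primitive_increment force_continuous YF t0 (ltW ts)) => r tr rs.
rewrite ltW// dP ?(le_trans t0 (ltW tr))// gtr0_norm ?subr_gt0//.
by rewrite ltrBlDl (le_lt_trans rs).
Qed.

End integrated_force.

End force_along_curve.
Section traces.
Context {R : realType}.

Lemma L2_cvg_ae {T : Type} (F : set_system T) {FF : Filter F} (u : T -> L2 R)
    (U U' : L2 R) : U = U' %[ae leb01 R] -> u @ F --> U -> u @ F --> U'.
Proof.
move=> UU' /L2_cvgP uU; apply/L2_cvgP => e e0; apply: filterS (uU e e0) => s.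
apply: le_lt_trans; have := L2_dist_triangle (u s) U U'.
by have /L2_dist_eq0P -> := UU'; rewrite addr0.
Qed.

Lemma L2_cvg_unique {T : Type} (F : set_system T) {FF : ProperFilter F}
    (u : T -> L2 R) (U U' : L2 R) :
  u @ F --> U -> u @ F --> U' -> U = U' %[ae leb01 R].
Proof.
move=> /L2_cvgP uU /L2_cvgP uU'; apply/L2_dist_eq0P/eqP.
rewrite eq_le L2_norm_ge0 andbT; apply/ler_addgt0Pl => e e0; rewrite addr0.
have e2 := half_gt0 e0.
have [s [h1 h2]] := filter_ex (filterI (uU _ e2) (uU' _ e2)).
rewrite (le_trans (L2_dist_triangle U (u s) U'))// [leRHS]splitr.
by rewrite lerD// ltW// Lp_norm_subC.
Qed.

Lemma has_right_deriv_continuous (X : R -> L2 R) (t : R) V :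
  has_right_deriv X t V -> X s @[s --> t^'+] --> X t.
Proof.
move=> /has_right_derivP/(_ 1 ltr01)/near_rightP[d d0 dP].
apply/L2_cvgP => e e0; have V1 : 0 < Lp_norm V + 1 by rewrite ltr_wpDl ?L2_norm_ge0.
apply/near_rightP; exists (Num.min d (e / (Lp_norm V + 1))).
  by rewrite lt_min d0 divr_gt0.
move=> s ts; rewrite -ltrBlDl lt_min ltr_pdivlMr// => /andP[sd se].
have st0 : 0 < s - t by rewrite subr_gt0.
apply: le_lt_trans se; rewrite mulrDr mulr1 [leRHS]addrC.
have := L2_norm_triangle (X s - X t - (s - t) *: V) ((s - t) *: V).
rewrite subrK L2_normZ (gtr0_norm st0) => /le_trans; apply.
by rewrite lerD2r -[leRHS]mul1r dP// -ltrBlDl.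
Qed.

End traces.

Theorem theorem3p5 (R : realType) (F : L2 R -> L2 R) (Xbar Vbar : L2 R)
    (X Y : R -> L2 R)
    (hF : uniformly_continuous_force F)
    (hXbar : monotone_cone Xbar)
    (hX : forall t : R, 0 <= t -> monotone_cone (X t))
    (hXlip : locally_lipschitz_curve X)
    (hY : forall t : R, 0 <= t ->
       is_bochner_integral 0 t (fun s => F (X s)) (Y t - Vbar))
    (hX0 : X 0 = Xbar %[ae leb01 R])
    (hincl : \forall t \ae (@lebesgue_measure R), 0 < t ->
       exists2 D : L2 R, has_deriv X t D & normal_cone (X t) (Y t - D)) :
  exists V : R -> L2 R,
    let rho (t : R) : probability R R := law (X t) in
    let T0 : set R := [set t : R | 0 < t /\
       (Lp_norm (V s) @[s --> t] --> Lp_norm (V t))] in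
    [/\
    (* (1) *)
      forall t : R, 0 <= t -> has_right_deriv X t (V t),
    (* (2) *)
      forall t : R, 0 <= t ->
        is_min_norm_element [set Y t - W | W in normal_cone (X t)] (V t) /\
        normal_cone (X t) (Y t - V t),
    (* (3) *)
      forall t : R, 0 <= t -> is_projection (tangent_cone (X t)) (Y t) (V t),
    (* (4) *)
      [/\ forall t : R, 0 <= t -> V s @[s --> t^'+] --> V t,
          (V t @[t --> (0 : R)^'+] --> Vbar) <-> tangent_cone Xbar Vbar,
          (@lebesgue_measure R).-negligible (`]0, +oo[ `\` T0),
          forall t : R, T0 t ->
            (V s @[s --> t] --> V t) /\ has_deriv X t (V t) &
          forall t : R, T0 t ->
            [/\ is_projection (const_on_constancy (X t)) (Y t) (V t),
                const_on_constancy (X t) (V t) &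
                exists2 w : R -> R, is_velocity (X t) (V t) w &
                  forall w', is_velocity (X t) (V t) w' ->
                    w = w' %[ae rho t]]] &
    (* (5) *)
      forall (f : probability R R -> {charge set R -> \bar R}) (vbar : R -> R),
        force_compatible F f -> is_velocity Xbar Vbar vbar ->
        forall v : R -> R -> R,
          (forall t : R, T0 t -> is_velocity (X t) (V t) (v t)) ->
          [/\ distributional_solution rho v (fun t => f (rho t)),
              forall t : R, 0 <= t -> finite_second_moment (rho t),
              wasserstein2 (rho t) (law Xbar) @[t --> (0 : R)^'+] --> 0%E &
              forall zeta : R -> R, continuous zeta ->
                (exists M : R, forall x, `|zeta x| <= M) ->
                (\int[rho t]_x (zeta x * v t x))
                  @[t --> within T0 (0 : R)^'+] -->
                \int[law Xbar]_x (zeta x * vbar x)]].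
Proof.
have YL := integrated_force_lipschitz hF hX hXlip hY.
have YF := integrated_force_right_deriv hF hX hXlip hY.
have XY : lipschitz_evolution X Y by split.
have incl : derivative_inclusion X Y.
  have [N [mN N0 NP]] := hincl; exists N; split=> // t nt; apply: NP => h.
  by apply: nt => /h[D XD ND]; exists D => //; exact: has_deriv_right.
have [V VP] := minimal_velocity_exists XY incl.
have XV (t : R) : 0 <= t -> has_right_deriv X t (V t) by case/VP.
have NV (t : R) : 0 <= t -> normal_cone (X t) (Y t - V t) by case/VP.
have Vmin (t : R) : 0 <= t -> forall W, normal_cone (X t) W ->
    Lp_norm (V t) <= Lp_norm (Y t - W) by case/VP.
have Vr (t : R) (t0 : 0 <= t) := velocity_right_continuous XY VP t0.
have Vc (t : R) (t0 : 0 < t) := velocity_continuous XY VP t0.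
have TV (t : R) : 0 <= t -> tangent_cone (X t) (V t).
  by move=> t0; exact: right_deriv_tangent_cone (XV t t0).
have PV (t : R) : 0 <= t -> is_projection (tangent_cone (X t)) (Y t) (V t).
  by move=> t0; apply: projection_tangent_cone; [exact: hX|exact: TV|exact: NV|exact: Vmin].
have Y0 : Y 0 = Vbar %[ae leb01 R] := primitive_initial (force_continuous hF hX hXlip) hY.
have le00 : (0 : R) <= 0 by [].
exists V => rho T0.
pose D := [set t : R | 0 < t /\ ~ (Lp_norm (V s) @[s --> t] --> Lp_norm (V t))].
have cD : countable D := speed_continuous_cocountable XY VP.
have DT0 (t : R) : 0 < t -> ~ D t -> T0 t.
  by move=> t0 Dt; split=> //; apply: contrapT => nc; apply: Dt.
have T0c (t : R) : T0 t -> V s @[s --> t] --> V t by move=> [t0]; exact: Vc.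
have T0d (t : R) : T0 t -> has_deriv X t (V t).
  move=> Tt; have [t0 _] := Tt.
  exact: (@velocity_continuous_deriv R X Y V t XY VP t0 (T0c t Tt)).
have T0H (t : R) : T0 t -> const_on_constancy (X t) (V t).
  move=> Tt; have [t0 _] := Tt.
  exact: deriv_const_on_constancy t0 hX (T0d t Tt).
split.
- exact: XV.
- move=> t t0; split; last exact: NV.
  split; first by exists (Y t - V t); [exact: NV|rewrite subKr].
  by move=> _ [W NW <-]; exact: Vmin.
- exact: PV.
- split.
  + exact: Vr.
  (* By right continuity the limit is [V 0], the projection of [Y 0 = Vbar]. *)
  + split=> [VVbar|TVbar].
      have V0 : V 0 = Vbar %[ae leb01 R] by apply: L2_cvg_unique (Vr 0 le00) VVbar.
      exact: (@tangent_cone_ae R _ _ _ _ hX0 V0 (TV 0 le00)).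
    have X0 : Xbar = X 0 %[ae leb01 R].
      by apply: filterS hX0 => m h mT; rewrite h.
    have [_ /(_ Vbar)] := PV 0 le00.
    move=> /(_ (@tangent_cone_ae R _ _ _ _ X0 (aeW _ (fun _ _ => erefl)) TVbar)).
    have /L2_dist_eq0P -> := Y0 => YV0.
    have Y0V : Y 0 = V 0 %[ae leb01 R].
      by apply/L2_dist_eq0P/eqP; rewrite eq_le YV0 L2_norm_ge0.
    apply: L2_cvg_ae (Vr 0 le00).
    by apply: filterS (filterI Y0 Y0V) => m [h1 h2] mT; rewrite -h2// h1.
  + apply: negligibleS (countable_negligible cD) => t [].
    rewrite /= in_itv/= andbT => t0 nT; apply: contrapT => Dt; apply: nT.
    exact: DT0.
  + by move=> t Tt; split; [exact: T0c|exact: T0d].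
  + move=> t Tt; have [/ltW t0 _] := Tt; split.
    * by apply: projection_const_on_constancy; [exact: hX|exact: NV|exact: T0H].
    * exact: T0H.
    * have [w wV] := const_on_constancy_velocity (hX t t0) (T0H t Tt).
      by exists w => // w' w'V; exact: velocity_unique wV w'V.
- move=> f vbar hf hvbar v hv.
  have XXbar : X s @[s --> (0 : R)^'+] --> Xbar.
    exact: L2_cvg_ae hX0 (has_right_deriv_continuous (XV 0 le00)).
  have VVbar : V s @[s --> (0 : R)^'+] --> Vbar.
    have [_ vbarE] := hvbar.
    have Y0E : Y 0 = vbar \o X 0 %[ae leb01 R].
      apply: filterS (filterI Y0 (filterI hX0 vbarE)) => m [h1 [h2 h3]] mT /=.
      by rewrite h1// h3//= h2.
    have V0 := initial_velocity (hX 0 le00) (velocity_measurable hvbar) Y0E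
      (NV 0 le00) (Vmin 0 le00).
    apply: L2_cvg_ae (Vr 0 le00).
    by apply: filterS (filterI Y0 V0) => m [h1 h2] mT; rewrite h2// h1.
  have Fc (t : R) : 0 < t -> F (X s) @[s --> t] --> F (X t).
    move=> t0; apply/L2_cvgP => e e0.
    have [d d0 dP] := force_continuous hF hX hXlip (ltW t0) e0.
    apply/(near_nbhsP t); exists (Num.min t d); first by rewrite lt_min t0.
    move=> s; rewrite lt_min => /andP[st sd]; apply: dP sd.
    by move: st; rewrite ltr_norml => /andP[h _]; real_lra.
  have Vc' (t : R) : 0 < t -> ~ D t -> V s @[s --> t] --> V t.
    by move=> t0 Dt; apply: T0c; exact: DT0.
  have Vv (t : R) : 0 < t -> ~ D t -> is_velocity (X t) (V t) (v t).
    by move=> t0 Dt; apply: hv; exact: DT0.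
  split.
  + split.
    * exact: flow_energy hXlip XV cD Vc' Vv.
    * move=> phi phiT.
      exact: (flow_continuity hX hXlip XV Vr NV cD Vc' Vv phiT).
    * move=> phi phiT.
      apply: (flow_momentum hX hXlip YL XV Vr YF Fc NV cD Vc' Vv phiT).
        move=> t t0; apply: (hf _ (space_time_test_section t phiT) (rho t)) => //.
          exact: law_second_moment.
        exact: hX (ltW t0).
      exact: force_bounded.
  + by move=> t t0; exact: law_second_moment.
  + exact: wasserstein2_cvg XXbar.
  + move=> zeta cz [M zM].
    have wfilter (Z : R -> L2 R) (Z0 : L2 R) :
        Z s @[s --> (0 : R)^'+] --> Z0 ->
        Z s @[s --> within T0 (0 : R)^'+] --> Z0.
      by move=> ZZ0; apply: cvg_trans ZZ0; apply: cvg_app; exact: cvg_within.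
    apply: (momentum_cvg (wfilter _ _ XXbar) (wfilter _ _ VVbar) hvbar _ cz zM).
    by rewrite near_withinE; apply: filterE => t Tt; exact: hv.
Qed.
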